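(* Let $f$ be a transcendental meromorphic function in the complex plane $\mathbb{C}$ with finitely many poles. Then the differential equation $\dot z = \frac{dz}{dt} = f(z)$ has infinitely many pairwise disjoint trajectories, each of which tends to infinity in finite increasing time.
   Context: Here $t$ is a real variable. A trajectory of $\dot z = f(z)$, for $f$ meromorphic in a plane domain $D$ (here $D=\mathbb{C}$), is a path $z(t)$ in $D$ with $z'(t) = f(z(t)) \in \mathbb{C}$ for $t$ in some maximal interval $(\alpha,\beta) \subseteq \mathbb{R}$. A trajectory tends to infinity in finite increasing time if $\beta \in \mathbb{R}$ (i.e. $\beta<+\infty$) and $\lim_{t\to\beta-} z(t) = \infty$. Trajectories are disjoint if the corresponding subsets of $\mathbb{C}$ are disjoint. *)

(* Defs.v *)
From Stdlib Require Import Reals List.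
From Coquelicot Require Import Coquelicot.

Open Scope C_scope.

Definition holomorphic_at (f : C -> C) (z : C) : Prop :=
  locally z
    (fun w : C => @ex_derive C_AbsRing C_NormedModule f w).

(* A meromorphic function is represented by a total [f : C -> C] whose value at
   a pole is arbitrary: [rational] and [solution_on] ignore that value. *)
Definition is_pole (f : C -> C) (p : C) : Prop :=
  locally' p
    (fun w : C => @ex_derive C_AbsRing C_NormedModule f w) /\
  filterlim (fun w : C => Cmod (f w)) (locally' p) (Rbar_locally p_infty).

Definition meromorphic (f : C -> C) : Prop :=
  forall z : C, holomorphic_at f z \/ is_pole f z.

Definition finitely_many_poles (f : C -> C) : Prop :=
  exists l : list C, forall p : C, is_pole f p -> In p l.

(* The polynomial with coefficients [a], constant coefficient first. *)
Definition poly_eval (a : list C) (z : C) : C :=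
  fold_right (fun c v => c + z * v) 0 a.

Definition rational (f : C -> C) : Prop :=
  exists p q : list C,
    (exists z : C, poly_eval q z <> 0) /\
    forall z : C, ~ is_pole f z -> poly_eval q z <> 0 ->
      f z = poly_eval p z / poly_eval q z.

Definition transcendental_meromorphic (f : C -> C) : Prop :=
  meromorphic f /\ ~ rational f.

Definition in_interval (alpha beta : Rbar) (t : R) : Prop :=
  Rbar_lt alpha t /\ Rbar_lt t beta.

Definition solution_on (f : C -> C) (alpha beta : Rbar) (z : R -> C) : Prop :=
  Rbar_lt alpha beta /\
  forall t : R, in_interval alpha beta t ->
    ~ is_pole f (z t) /\
    @is_derive R_AbsRing C_R_NormedModule z t (f (z t)).

(* Only the restriction of [z] to (alpha, beta) is meaningful. *)
Definition trajectory (f : C -> C) (alpha beta : Rbar) (z : R -> C) : Prop :=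
  solution_on f alpha beta z /\
  forall (alpha' beta' : Rbar) (w : R -> C),
    solution_on f alpha' beta' w ->
    Rbar_le alpha' alpha -> Rbar_le beta beta' ->
    (forall t : R, in_interval alpha beta t -> w t = z t) ->
    alpha' = alpha /\ beta' = beta.

Definition to_infinity_in_finite_increasing_time
    (beta : Rbar) (z : R -> C) : Prop :=
  exists b : R, beta = Finite b /\
    filterlim (fun t : R => Cmod (z t)) (at_left b) (Rbar_locally p_infty).

Definition on_path (alpha beta : Rbar) (z : R -> C) (p : C) : Prop :=
  exists t : R, in_interval alpha beta t /\ z t = p.

(* Main.v *)
(** With z = e^s the equation becomes s' = v(s), where v(s) = f(e^s) e^(-s) is 2 pi i-periodic and
    holomorphic on a right half plane. As f is not rational, it outgrows every power of z; maximising
    |v(s)| e^(-n Re s) (b - Re s)^B yields s0 and N >= n with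
    |v(s)| <= (1 + delta) |v(s0)| e^(N Re (s - s0)) on a wide vertical strip around s0, and then
    v(s) ~ v(s0) e^(N (s - s0)) near s0 by Schwarz-Pick. In the coordinate w = N (s - s0) (rotated, with
    rescaled time) the equation is w' = V(w) with V(w) ~ e^w, so X = e^(-w) moves with velocity close to -1.

    Start from a short transversal arc near X = 1. If all these trajectories existed up to time 3/2, they
    would fill out a holomorphic function S of complex time zeta, and E = e^(-S) would be holomorphic,
    nonvanishing, bounded, and close to 1 - zeta away from a thin strip around the real axis. The maximum
    principle, applied to a product of rotated copies of E + zeta - 1, makes E close to 1 - zeta also near
    zeta = 1, and then its application to 1 / E is contradictory. So some trajectory ceases to exist before
    time 3/2, and by periodicity of V this happens only because Re w tends to infinity.

    The same holds in arbitrarily many neighbouring strips of width 2 pi. Each trajectory stays in its strip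
    up to time 9/10, more than the difference of any two life times, which makes the trajectories disjoint. *)

Require Import Defs.
From Stdlib Require Import Reals ZArith Lra Lia Psatz List Classical ClassicalEpsilon.
From Coquelicot Require Import Coquelicot.
Open Scope R_scope.

(** * Complex and real differentiation *)

(** The comparison of [V] with the exponential holds only for bounded [w], so no estimate can follow
    a trajectory to infinity. Escape is therefore proved indirectly: a bundle of trajectories that
    all survive would be a holomorphic function of complex time, and this is refuted. For this
    reason solutions are developed both in real and in complex time.

    Apart from Goursat's lemma, complex analysis enters through the maximum principle, in a form
    that tolerates isolated points of mere continuity. Applied to difference quotients
    [(g z - g b) / (z - b)], it yields Lipschitz bounds, removable singularities, Liouville's
    theorem and the Schwarz-Pick estimate.

    The number of strips is fixed before [s0] is chosen, so each [s0] gives finitely many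
    trajectories, and the families of different [s0] may overlap. Escaping trajectories that meet
    share their course and their remaining life from there on; meeting is thus transitive among
    them, and a trajectory already chosen meets at most one member of a new family. A family larger
    than the list of those already chosen always contains a new one. *)

Definition cder (f : C -> C) (z l : C) : Prop :=
  forall eps : R, 0 < eps -> exists d : R, 0 < d /\
    forall w : C, Cmod (w - z)%C < d ->
      Cmod (f w - f z - l * (w - z))%C <= eps * Cmod (w - z)%C.

Definition rder (s : R -> C) (t : R) (l : C) : Prop :=
  forall eps : R, 0 < eps -> exists d : R, 0 < d /\
    forall u : R, Rabs (u - t) < d ->
      Cmod (s u - s t - RtoC (u - t) * l)%C <= eps * Rabs (u - t).

(** Gives access to the library's rules for sums, products and compositions. The quotient-free form
    stays in use because it admits [w = z] and needs no division. *)
Lemma cder_is_derive (f : C -> C) (z l : C) :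
  cder f z l <-> @is_derive C_AbsRing (AbsRing_NormedModule C_AbsRing) f z l.
Proof.
  split.
  - intros H. split.
    + apply (is_linear_scal_l (K := C_AbsRing) (V := AbsRing_NormedModule C_AbsRing)).
    + intros x Hx eps.
      assert (Hz : z = x).
      { apply (is_filter_lim_locally_unique (K := C_AbsRing)
                 (V := AbsRing_NormedModule C_AbsRing)). exact Hx. }
      subst x.
      destruct (H eps (cond_pos eps)) as [d [Hd H1]].
      exists (mkposreal d Hd). intros w Hw.
      specialize (H1 w Hw).
      replace (f w - f z - l * (w - z))%C with
        (minus (minus (f w) (f z)) (scal (minus w z) l)) in H1; [exact H1|].
      unfold minus, scal, plus, opp; simpl. unfold mult; simpl. ring.
  - intros [_ H] eps Heps.
    destruct (H z (fun P HP => HP) (mkposreal eps Heps)) as [d Hd].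
    exists d. split; [apply cond_pos|]. intros w Hw.
    specialize (Hd w Hw). simpl in Hd.
    replace (f w - f z - l * (w - z))%C with
        (minus (minus (f w) (f z)) (scal (minus w z) l)); [exact Hd|].
    unfold minus, scal, plus, opp; simpl. unfold mult; simpl. ring.
Qed.

(** [holomorphic_at] is stated over [C_NormedModule], the product rule over [AbsRing_NormedModule].
    The two derivatives differ only in the linearity witness; the remainder estimates are
    convertible. *)
Lemma cder_is_derive' (f : C -> C) (z l : C) :
  cder f z l <-> @is_derive C_AbsRing C_NormedModule f z l.
Proof.
  rewrite cder_is_derive. split; intros [H1 H2].
  - split; [apply (is_linear_scal_l (K := C_AbsRing) (V := C_NormedModule))|exact H2].
  - split; [apply (is_linear_scal_l (K := C_AbsRing) (V := AbsRing_NormedModule C_AbsRing))|exact H2].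
Qed.

Lemma cder_eq (f : C -> C) (z a b : C) : cder f z a -> a = b -> cder f z b.
Proof. intros H <-. exact H. Qed.

Lemma rder_eq (s : R -> C) (t : R) (a b : C) : rder s t a -> a = b -> rder s t b.
Proof. intros H <-. exact H. Qed.

Lemma cder_const (c z : C) : cder (fun _ => c) z 0%C.
Proof. apply cder_is_derive. apply (is_derive_const (K := C_AbsRing) (V := AbsRing_NormedModule C_AbsRing)). Qed.

Lemma cder_id (z : C) : cder (fun w => w) z 1%C.
Proof. apply cder_is_derive. apply (is_derive_id (K := C_AbsRing)). Qed.

Lemma cder_plus (f g : C -> C) (z a b : C) :
  cder f z a -> cder g z b -> cder (fun w => f w + g w)%C z (a + b)%C.
Proof. rewrite !cder_is_derive. apply (is_derive_plus (K := C_AbsRing) (V := AbsRing_NormedModule C_AbsRing)). Qed.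

Lemma cder_minus (f g : C -> C) (z a b : C) :
  cder f z a -> cder g z b -> cder (fun w => f w - g w)%C z (a - b)%C.
Proof. rewrite !cder_is_derive. apply (is_derive_minus (K := C_AbsRing) (V := AbsRing_NormedModule C_AbsRing)). Qed.

Lemma cder_mult (f g : C -> C) (z a b : C) :
  cder f z a -> cder g z b -> cder (fun w => f w * g w)%C z (a * g z + f z * b)%C.
Proof.
  rewrite !cder_is_derive. intros H1 H2.
  apply (is_derive_mult (K := C_AbsRing) f g z a b H1 H2). intros; apply Cmult_comm.
Qed.

Lemma cder_comp (f g : C -> C) (z a b : C) :
  cder f (g z) a -> cder g z b -> cder (fun w => f (g w)) z (a * b)%C.
Proof.
  rewrite !cder_is_derive. intros H1 H2. rewrite Cmult_comm.
  apply (is_derive_comp (K := C_AbsRing) (V := AbsRing_NormedModule C_AbsRing) f g z a b H1 H2).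
Qed.

Lemma cder_ext_loc (f g : C -> C) (z l : C) (d : R) :
  0 < d -> (forall w, Cmod (w - z)%C < d -> f w = g w) -> cder f z l -> cder g z l.
Proof.
  intros Hd He Hf eps Heps. destruct (Hf eps Heps) as [d' [Hd' H]].
  exists (Rmin d d'). split; [apply Rmin_glb_lt; assumption|].
  intros w Hw. rewrite <- !He.
  - apply H. apply Rlt_le_trans with (1 := Hw), Rmin_r.
  - replace (z - z)%C with (0 : C) by ring. rewrite Cmod_0; exact Hd.
  - apply Rlt_le_trans with (1 := Hw), Rmin_l.
Qed.

Lemma Cmod_sub_comm (a b : C) : Cmod (a - b)%C = Cmod (b - a)%C.
Proof. replace (a - b)%C with (- (b - a))%C by ring. apply Cmod_opp. Qed.

Lemma Cmod_sub_self (a : C) : Cmod (a - a)%C = 0.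
Proof. replace (a - a)%C with (0 : C) by ring. apply Cmod_0. Qed.

Lemma Cmod_tri (a b c : C) : Cmod (a - c)%C <= Cmod (a - b)%C + Cmod (b - c)%C.
Proof. replace (a - c)%C with ((a - b) + (b - c))%C by ring. apply Cmod_triangle. Qed.

Lemma Cmod_sub_le (a b : C) : Cmod a <= Cmod b + Cmod (a - b)%C.
Proof. replace a with (b + (a - b))%C at 1 by ring. apply Cmod_triangle. Qed.

Lemma Cmod_minus_le (a b : C) : Cmod (a - b)%C <= Cmod a + Cmod b.
Proof. rewrite <- (Cmod_opp b). apply Cmod_triangle. Qed.

Lemma cder_cont (f : C -> C) (z l : C) : cder f z l ->
  forall eps : R, 0 < eps -> exists d : R, 0 < d /\
    forall w : C, Cmod (w - z)%C < d -> Cmod (f w - f z)%C < eps.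
Proof.
  intros H eps Heps. destruct (H 1 Rlt_0_1) as [d [Hd H1]].
  pose proof (Cmod_ge_0 l) as Hl.
  assert (Hq : 0 < eps / (Cmod l + 2)) by (apply Rdiv_lt_0_compat; lra).
  exists (Rmin d (eps / (Cmod l + 2))). split; [apply Rmin_glb_lt; assumption|].
  intros w Hw.
  assert (Hw1 := Rlt_le_trans _ _ _ Hw (Rmin_l _ _)).
  assert (Hw2 := Rlt_le_trans _ _ _ Hw (Rmin_r _ _)).
  specialize (H1 w Hw1).
  replace (f w - f z)%C with ((f w - f z - l * (w - z)) + l * (w - z))%C by ring.
  eapply Rle_lt_trans; [apply Cmod_triangle|]. rewrite Cmod_mult.
  apply Rle_lt_trans with ((Cmod l + 1) * Cmod (w - z)%C); [lra|].
  apply Rle_lt_trans with ((Cmod l + 1) * (eps / (Cmod l + 2))).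
  - apply Rmult_le_compat_l; lra.
  - apply Rlt_le_trans with ((Cmod l + 2) * (eps / (Cmod l + 2))).
    + apply Rmult_lt_compat_r; lra.
    + right. field. lra.
Qed.

Lemma cder_inv_id (z : C) : z <> 0%C -> cder (fun w => / w)%C z (- / (z * z))%C.
Proof.
  intros Hz eps Heps. assert (Hm := proj1 (Cmod_gt_0 z) Hz).
  set (m := Cmod z) in *.
  assert (H3 : 0 < m ^ 3) by (apply pow_lt; exact Hm).
  (* The first bound keeps [Cmod w >= m / 2]; the second absorbs the exact remainder
     [(w - z) ^ 2 / (w * z ^ 2)]. *)
  exists (Rmin (m / 2) (eps * m ^ 3 / 2)). split.
  { apply Rmin_glb_lt; [lra|]. apply Rmult_lt_0_compat; [nra|lra]. }
  intros w Hw.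
  assert (Hw1 := Rlt_le_trans _ _ _ Hw (Rmin_l _ _)).
  assert (Hw2 := Rlt_le_trans _ _ _ Hw (Rmin_r _ _)).
  assert (Hwm : m / 2 <= Cmod w).
  { pose proof (Cmod_sub_le z w) as H. rewrite (Cmod_sub_comm z w) in H. fold m in H. lra. }
  assert (Hw0 : w <> 0%C). { apply Cmod_gt_0. lra. }
  replace (/ w - / z - - / (z * z) * (w - z))%C with ((w - z) * (w - z) * / (w * (z * z)))%C
    by (field; split; assumption).
  rewrite !Cmod_mult, Cmod_inv, !Cmod_mult; [|repeat apply Cmult_neq_0; assumption].
  fold m. set (e := Cmod (w - z)%C) in *. set (n := Cmod w) in *.
  assert (He : 0 <= e) by apply Cmod_ge_0.
  assert (Hn : 0 < n * (m * m)). { apply Rmult_lt_0_compat; nra. }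
  apply Rmult_le_reg_r with (n * (m * m)); [exact Hn|].
  rewrite Rmult_assoc, Rinv_l, Rmult_1_r by lra.
  assert (e <= eps * (n * (m * m))).
  { apply Rle_trans with (eps * m ^ 3 / 2); [lra|].
    replace (eps * m ^ 3 / 2) with (eps * ((m / 2) * (m * m))) by field.
    apply Rmult_le_compat_l; [lra|]. apply Rmult_le_compat_r; nra. }
  nra.
Qed.

Lemma cder_inv (f : C -> C) (z l : C) : cder f z l -> f z <> 0%C ->
  cder (fun w => / f w)%C z (- / (f z * f z) * l)%C.
Proof.
  intros H Hz. apply (cder_comp (fun w => / w)%C f z); [|exact H].
  apply cder_inv_id, Hz.
Qed.

Lemma cder_div (f g : C -> C) (z a b : C) : cder f z a -> cder g z b -> g z <> 0%C ->
  exists l, cder (fun w => f w / g w)%C z l.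
Proof.
  intros Hf Hg Hz. eexists. apply cder_mult; [exact Hf|].
  apply cder_inv; [exact Hg|exact Hz].
Qed.

Lemma rder_cont (s : R -> C) (t : R) (l : C) : rder s t l ->
  forall eps : R, 0 < eps -> exists d : R, 0 < d /\
    forall u : R, Rabs (u - t) < d -> Cmod (s u - s t)%C < eps.
Proof.
  intros H eps Heps. destruct (H 1 Rlt_0_1) as [d [Hd H1]].
  pose proof (Cmod_ge_0 l) as Hl.
  assert (Hq : 0 < eps / (Cmod l + 2)) by (apply Rdiv_lt_0_compat; lra).
  exists (Rmin d (eps / (Cmod l + 2))). split; [apply Rmin_glb_lt; assumption|].
  intros w Hw.
  assert (Hw1 := Rlt_le_trans _ _ _ Hw (Rmin_l _ _)).
  assert (Hw2 := Rlt_le_trans _ _ _ Hw (Rmin_r _ _)).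
  specialize (H1 w Hw1).
  replace (s w - s t)%C with ((s w - s t - RtoC (w - t) * l) + RtoC (w - t) * l)%C by ring.
  eapply Rle_lt_trans; [apply Cmod_triangle|]. rewrite Cmod_mult, Cmod_R.
  apply Rle_lt_trans with ((Cmod l + 1) * Rabs (w - t)); [lra|].
  apply Rle_lt_trans with ((Cmod l + 1) * (eps / (Cmod l + 2))).
  - apply Rmult_le_compat_l; lra.
  - apply Rlt_le_trans with ((Cmod l + 2) * (eps / (Cmod l + 2))).
    + apply Rmult_lt_compat_r; lra.
    + right. field. lra.
Qed.

Lemma rder_comp (f : C -> C) (s : R -> C) (t : R) (a b : C) :
  cder f (s t) a -> rder s t b -> rder (fun u => f (s u)) t (a * b)%C.
Proof.
  intros Hf Hs eps Heps.
  pose proof (Cmod_ge_0 a) as Ha. pose proof (Cmod_ge_0 b) as Hb.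
  set (e1 := eps / (2 * (Cmod b + 1))).
  set (e2 := Rmin 1 (eps / (2 * (Cmod a + 1)))).
  assert (He1 : 0 < e1) by (apply Rdiv_lt_0_compat; lra).
  assert (He2 : 0 < e2). { apply Rmin_glb_lt; [lra|]. apply Rdiv_lt_0_compat; lra. }
  destruct (Hf e1 He1) as [d1 [Hd1 H1]].
  destruct (Hs e2 He2) as [d2 [Hd2 H2]].
  destruct (rder_cont s t b Hs d1 Hd1) as [d3 [Hd3 H3]].
  exists (Rmin d2 d3). split; [apply Rmin_glb_lt; assumption|].
  intros u Hu.
  assert (Hu2 := Rlt_le_trans _ _ _ Hu (Rmin_l _ _)).
  assert (Hu3 := Rlt_le_trans _ _ _ Hu (Rmin_r _ _)).
  specialize (H1 _ (H3 _ Hu3)). specialize (H2 _ Hu2).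
  set (r := Rabs (u - t)) in *. assert (Hr : 0 <= r) by apply Rabs_pos.
  assert (Hsu : Cmod (s u - s t)%C <= (Cmod b + 1) * r).
  { replace (s u - s t)%C with ((s u - s t - RtoC (u - t) * b) + RtoC (u - t) * b)%C by ring.
    eapply Rle_trans; [apply Cmod_triangle|]. rewrite Cmod_mult, Cmod_R. fold r.
    assert (e2 <= 1) by apply Rmin_l. nra. }
  replace (f (s u) - f (s t) - RtoC (u - t) * (a * b))%C with
    ((f (s u) - f (s t) - a * (s u - s t)) + a * (s u - s t - RtoC (u - t) * b))%C by ring.
  eapply Rle_trans; [apply Cmod_triangle|]. rewrite Cmod_mult.
  apply Rle_trans with (e1 * ((Cmod b + 1) * r) + Cmod a * (e2 * r)).
  - apply Rplus_le_compat.
    + eapply Rle_trans; [exact H1|]. apply Rmult_le_compat_l; lra.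
    + apply Rmult_le_compat_l; assumption.
  - assert (X1 : e1 * (Cmod b + 1) = eps / 2) by (unfold e1; field; lra).
    assert (X2 : Cmod a * e2 <= eps / 2).
    { apply Rle_trans with (Cmod a * (eps / (2 * (Cmod a + 1)))).
      - apply Rmult_le_compat_l; [assumption|apply Rmin_r].
      - apply Rle_trans with ((Cmod a + 1) * (eps / (2 * (Cmod a + 1)))).
        + apply Rmult_le_compat_r; [|lra]. left. apply Rdiv_lt_0_compat; lra.
        + right. field. lra. }
    replace (e1 * ((Cmod b + 1) * r)) with (e1 * (Cmod b + 1) * r) by ring.
    rewrite X1. nra.
Qed.

Lemma rder_ext_loc (f g : R -> C) (z : R) (l : C) (d : R) :
  0 < d -> (forall w, Rabs (w - z) < d -> f w = g w) -> rder f z l -> rder g z l.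
Proof.
  intros Hd He Hf eps Heps. destruct (Hf eps Heps) as [d' [Hd' H]].
  exists (Rmin d d'). split; [apply Rmin_glb_lt; assumption|].
  intros w Hw. rewrite <- !He.
  - apply H. apply Rlt_le_trans with (1 := Hw), Rmin_r.
  - rewrite Rminus_diag, Rabs_R0. exact Hd.
  - apply Rlt_le_trans with (1 := Hw), Rmin_l.
Qed.

Lemma rder_affine (p d : C) (t : R) : rder (fun u => p + RtoC u * d)%C t d.
Proof.
  intros eps Heps. exists 1. split; [lra|]. intros u _.
  replace (p + RtoC u * d - (p + RtoC t * d) - RtoC (u - t) * d)%C with (0 : C).
  - rewrite Cmod_0. apply Rmult_le_pos; [lra|apply Rabs_pos].
  - rewrite RtoC_minus. ring.
Qed.

Lemma rder_line (f : C -> C) (p d l : C) (t : R) :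
  cder f (p + RtoC t * d)%C l -> rder (fun u => f (p + RtoC u * d)%C) t (l * d)%C.
Proof. intros H. apply (rder_comp f (fun u => p + RtoC u * d)%C); [exact H|apply rder_affine]. Qed.

Lemma rder_shift (s : R -> C) (c t : R) (l : C) :
  rder s (t + c) l -> rder (fun u => s (u + c)) t l.
Proof.
  intros H eps Heps. destruct (H eps Heps) as [d [Hd H1]]. exists d. split; [exact Hd|].
  intros u Hu. specialize (H1 (u + c)). replace (u + c - (t + c)) with (u - t) in H1 by ring. auto.
Qed.

Lemma rder_scale (s : R -> C) (k t : R) (l : C) :
  rder s (k * t) l -> rder (fun u => s (k * u)) t (RtoC k * l)%C.
Proof.
  intros H eps Heps.
  destruct (H (eps / (Rabs k + 1))) as [d [Hd H1]].
  { apply Rdiv_lt_0_compat; [lra|]. pose proof (Rabs_pos k). lra. }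
  pose proof (Rabs_pos k) as Hk.
  exists (d / (Rabs k + 1)). split; [apply Rdiv_lt_0_compat; lra|].
  intros u Hu. specialize (H1 (k * u)).
  assert (E : k * u - k * t = k * (u - t)) by ring. rewrite E, Rabs_mult in H1.
  replace (RtoC (u - t) * (RtoC k * l))%C with (RtoC (k * (u - t)) * l)%C
    by (rewrite RtoC_mult; ring).
  assert (Hu' : (Rabs k + 1) * Rabs (u - t) < d).
  { apply Rmult_lt_compat_l with (r := Rabs k + 1) in Hu; [|lra].
    replace ((Rabs k + 1) * (d / (Rabs k + 1))) with d in Hu by (field; lra). exact Hu. }
  pose proof (Rabs_pos (u - t)) as Hut.
  eapply Rle_trans; [apply H1; nra|].
  replace (eps * Rabs (u - t)) with (eps / (Rabs k + 1) * ((Rabs k + 1) * Rabs (u - t))) by (field; lra).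
  apply Rmult_le_compat_l; [|nra]. left. apply Rdiv_lt_0_compat; lra.
Qed.

Lemma rder_is_derive (s : R -> C) (t : R) (l : C) :
  rder s t l <-> @is_derive R_AbsRing C_R_NormedModule s t l.
Proof.
  assert (N : forall z : C, @norm R_AbsRing C_R_NormedModule z = Cmod z).
  { intros z. unfold norm; simpl. unfold prod_norm, Cmod, norm; simpl. unfold abs; simpl.
    f_equal.
    rewrite !Rmult_1_r. rewrite <- !Rabs_mult, !Rabs_pos_eq; [reflexivity|nra|nra]. }
  assert (E : forall u, (s u - s t - RtoC (u - t) * l)%C =
     minus (minus (s u) (s t)) (@scal R_AbsRing C_R_NormedModule (minus u t) l)).
  { intros u. unfold minus, scal, plus, opp; simpl. unfold prod_plus, prod_opp, prod_scal.
    unfold scal, plus, opp; simpl. unfold mult; simpl.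
    apply injective_projections; simpl. all: ring. }
  split.
  - intros H. split.
    + apply (is_linear_scal_l (K := R_AbsRing) (V := C_R_NormedModule)).
    + intros x Hx eps.
      assert (Hz : t = x).
      { apply (is_filter_lim_locally_unique (K := R_AbsRing)
                 (V := R_NormedModule)). exact Hx. }
      subst x.
      destruct (H eps (cond_pos eps)) as [d [Hd H1]].
      exists (mkposreal d Hd). intros w Hw.
      specialize (H1 w Hw). rewrite E, <- N in H1. exact H1.
  - intros [_ H] eps Heps.
    destruct (H t (fun P HP => HP) (mkposreal eps Heps)) as [d Hd].
    exists d. split; [apply cond_pos|]. intros w Hw.
    specialize (Hd w Hw). simpl in Hd. rewrite E, <- N. exact Hd.
Qed.

Lemma Re_minus (a b : C) : Re (a - b)%C = Re a - Re b.
Proof. reflexivity. Qed.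

Lemma Re_plus (a b : C) : Re (a + b)%C = Re a + Re b.
Proof. reflexivity. Qed.

Lemma Re_scal (r : R) (a : C) : Re (RtoC r * a)%C = r * Re a.
Proof. unfold Re, RtoC, Cmult; simpl. ring. Qed.

Lemma rder_re (s : R -> C) (t : R) (l c : C) :
  rder s t l -> is_derive (fun u => Re (c * s u)%C) t (Re (c * l)%C).
Proof.
  intros H. split; [apply (is_linear_scal_l (K := R_AbsRing) (V := R_NormedModule))|].
  intros x Hx eps.
  assert (Hz : t = x).
  { apply (is_filter_lim_locally_unique (K := R_AbsRing) (V := R_NormedModule)). exact Hx. }
  subst x.
  pose proof (Cmod_ge_0 c) as Hc.
  destruct (H (eps / (Cmod c + 1))) as [d [Hd H1]].
  { apply Rdiv_lt_0_compat; [apply cond_pos|lra]. }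
  exists (mkposreal d Hd). intros u Hu. specialize (H1 u Hu).
  assert (B : Rabs (Re (c * s u)%C - Re (c * s t)%C - (u - t) * Re (c * l)%C) <= eps * Rabs (u - t)).
  { rewrite <- Re_scal, <- !Re_minus.
    replace (c * s u - c * s t - RtoC (u - t) * (c * l))%C
      with (c * (s u - s t - RtoC (u - t) * l))%C by ring.
    eapply Rle_trans; [apply re_le_Cmod|]. rewrite Cmod_mult.
    apply Rle_trans with (Cmod c * (eps / (Cmod c + 1) * Rabs (u - t))).
    { apply Rmult_le_compat_l; assumption. }
    pose proof (Rabs_pos (u - t)) as Hu'. pose proof (cond_pos eps) as He.
    apply Rle_trans with ((Cmod c + 1) * (eps / (Cmod c + 1) * Rabs (u - t))).
    { apply Rmult_le_compat_r; [|lra]. apply Rmult_le_pos; [|exact Hu'].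
      left. apply Rdiv_lt_0_compat; lra. }
    right. field. lra. }
  exact B.
Qed.

Lemma Re_mult_conj (z : C) : Re (Cconj z * z)%C = Cmod z * Cmod z.
Proof.
  replace (Cmod z * Cmod z) with (Cmod z ^ 2) by ring. rewrite Cmod2_alt.
  destruct z. unfold Re, Im, Cconj, Cmult; simpl. ring.
Qed.

(** Let [D] be the deviation to be bounded. The real mean value theorem for [Re (Cconj D * s t)]
    minus its linear part bounds [Re (Cconj D * D)], the square of [Cmod D], by
    [Cmod D * k * (b - a)]. *)
Lemma rder_mvt (s s' : R -> C) (c : C) (k a b : R) : a <= b ->
  (forall t, a <= t <= b -> rder s t (s' t)) ->
  (forall t, a <= t <= b -> Cmod (s' t - c)%C <= k) ->
  Cmod (s b - s a - RtoC (b - a) * c)%C <= k * (b - a).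
Proof.
  intros Hab Hs Hk.
  set (D := (s b - s a - RtoC (b - a) * c)%C).
  destruct (Req_dec (Cmod D) 0) as [H0|H0].
  { rewrite H0. apply Rmult_le_pos; [|lra]. eapply Rle_trans; [apply Cmod_ge_0|apply (Hk a)]. lra. }
  set (h := fun t => Re (Cconj D * s t)%C - t * Re (Cconj D * c)%C).
  destruct (MVT_gen h a b (fun t => Re (Cconj D * s' t)%C - Re (Cconj D * c)%C)) as [x [Hx E]].
  - intros x Hx. rewrite Rmin_left, Rmax_right in Hx by assumption.
    unfold h. apply (is_derive_minus (K := R_AbsRing) (V := R_NormedModule)).
    + apply rder_re, Hs. lra.
    + evar_last; [apply (is_derive_scal_l (K := R_AbsRing) (V := R_NormedModule) (fun t : R => t) x 1)|].
      * apply (is_derive_id (K := R_AbsRing)).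
      * unfold scal; simpl. unfold mult; simpl. ring.
  - intros x Hx. rewrite Rmin_left, Rmax_right in Hx by assumption.
    apply continuity_pt_filterlim, (ex_derive_continuous (K := R_AbsRing) (V := R_NormedModule)).
    eexists. apply (is_derive_minus (K := R_AbsRing) (V := R_NormedModule)).
    + apply rder_re, Hs. lra.
    + apply (is_derive_scal_l (K := R_AbsRing) (V := R_NormedModule) (fun t : R => t) x 1).
      apply (is_derive_id (K := R_AbsRing)).
  - rewrite Rmin_left, Rmax_right in Hx by assumption.
    assert (E1 : h b - h a = Re (Cconj D * D)%C).
    { replace (Cconj D * D)%C with (Cconj D * s b - Cconj D * s a - RtoC (b - a) * (Cconj D * c))%C
        by (transitivity (Cconj D * (s b - s a - RtoC (b - a) * c))%C; [ring|reflexivity]).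
      rewrite !Re_minus, Re_scal. unfold h. ring. }
    rewrite E1, Re_mult_conj in E.
    replace (Re (Cconj D * s' x)%C - Re (Cconj D * c)%C) with (Re (Cconj D * (s' x - c))%C) in E.
    2:{ rewrite <- Re_minus. f_equal. ring. }
    pose proof (Cmod_ge_0 D) as HD.
    assert (B : Re (Cconj D * (s' x - c))%C <= Cmod D * k).
    { eapply Rle_trans; [apply Rle_abs|]. eapply Rle_trans; [apply re_le_Cmod|].
      rewrite Cmod_mult, Cmod_conj. apply Rmult_le_compat_l; [exact HD|]. apply Hk. lra. }
    apply Rmult_le_reg_l with (Cmod D); [lra|]. rewrite E.
    replace (Cmod D * (k * (b - a))) with (Cmod D * k * (b - a)) by ring.
    apply Rmult_le_compat_r; lra.
Qed.

Lemma cder_mvt (f f' : C -> C) (a b c : C) (k : R) :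
  (forall t, 0 <= t <= 1 -> cder f (a + RtoC t * (b - a))%C (f' (a + RtoC t * (b - a))%C)) ->
  (forall t, 0 <= t <= 1 -> Cmod (f' (a + RtoC t * (b - a)) - c)%C <= k) ->
  Cmod (f b - f a - c * (b - a))%C <= k * Cmod (b - a)%C.
Proof.
  intros H1 H2.
  pose proof (rder_mvt (fun t => f (a + RtoC t * (b - a))%C)
    (fun t => f' (a + RtoC t * (b - a)) * (b - a))%C (c * (b - a))%C (k * Cmod (b - a)%C) 0 1
    Rle_0_1) as H. cbv beta in H.
  replace (a + 1 * (b - a))%C with b in H by ring.
  replace (a + 0 * (b - a))%C with a in H by ring.
  rewrite Rminus_0_r, Rmult_1_r in H.
  replace (1 * (c * (b - a)))%C with (c * (b - a))%C in H by ring.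
  apply H.
  - intros t Ht. apply rder_line, H1, Ht.
  - intros t Ht. replace (f' (a + t * (b - a)) * (b - a) - c * (b - a))%C with
      ((f' (a + t * (b - a)) - c) * (b - a))%C by ring.
    rewrite Cmod_mult. apply Rmult_le_compat_r; [apply Cmod_ge_0|]. apply H2, Ht.
Qed.

Definition hol (f : C -> C) (z : C) : Prop :=
  exists r : R, 0 < r /\ forall w, Cmod (w - z)%C < r -> exists l, cder f w l.

Lemma holomorphic_at_hol (f : C -> C) (z : C) :
  locally z (fun w : C => @ex_derive C_AbsRing C_NormedModule f w) <-> hol f z.
Proof.
  rewrite (locally_C z). split.
  - intros [d Hd]. exists d. split; [apply cond_pos|]. intros w Hw.
    destruct (Hd w Hw) as [l Hl]. exists l. apply cder_is_derive', Hl.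
  - intros [r [Hr H]]. exists (mkposreal r Hr). intros w Hw. destruct (H w Hw) as [l Hl].
    exists l. apply cder_is_derive', Hl.
Qed.

(** * Goursat's lemma *)

Lemma half_pow_small (w e : R) : 0 < e -> exists n : nat, w / 2 ^ n < e.
Proof.
  intros He. destruct (INR_unbounded (Rabs w / e)) as [n Hn]. exists n.
  assert (H2 : INR n < 2 ^ n) by (clear; induction n; [simpl; lra|rewrite S_INR; simpl; assert (1 <= 2 ^ n) by (apply pow_R1_Rle; lra); lra]).
  assert (Hp : 0 < 2 ^ n) by (apply pow_lt; lra).
  apply Rmult_lt_reg_r with (2 ^ n); [exact Hp|].
  unfold Rdiv. rewrite Rmult_assoc, Rinv_l, Rmult_1_r by lra.
  pose proof (Rle_abs w).
  apply Rmult_lt_compat_r with (r := e) in Hn; [|exact He].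
  unfold Rdiv in Hn. rewrite Rmult_assoc, Rinv_l, Rmult_1_r in Hn by lra. nra.
Qed.

Lemma monotone_nested (u v : nat -> R) :
  (forall n, u n <= u (S n)) -> (forall n, v (S n) <= v n) -> (forall n, u n <= v n) ->
  exists x, forall n, u n <= x <= v n.
Proof.
  intros Hu Hv Huv.
  assert (U : forall n m, u n <= u (n + m)%nat).
  { intros n m. induction m; [rewrite Nat.add_0_r; lra|].
    rewrite Nat.add_succ_r. eapply Rle_trans; [exact IHm|apply Hu]. }
  assert (V : forall n m, v (n + m)%nat <= v n).
  { intros n m. induction m; [rewrite Nat.add_0_r; lra|].
    rewrite Nat.add_succ_r. eapply Rle_trans; [apply Hv|exact IHm]. }
  assert (UV : forall n m, u n <= v m).
  { intros n m. eapply Rle_trans; [apply (U n m)|]. eapply Rle_trans; [apply Huv|].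
    rewrite Nat.add_comm. apply V. }
  destruct (completeness (fun x => exists n, x = u n)) as [x [Hx1 Hx2]].
  - exists (v 0%nat). intros x [n ->]. apply UV.
  - exists (u 0%nat). exists 0%nat. reflexivity.
  - exists x. intros n. split; [apply Hx1; exists n; reflexivity|].
    apply Hx2. intros y [m ->]. apply UV.
Qed.

(** * Bisection of rectangles and induction along an interval *)

Section Quadrisection.
Variable P : R -> R -> R -> R -> Prop.

Let rectangle := (R * R * (R * R))%type.
Let PP (q : rectangle) : Prop := P (fst (fst q)) (snd (fst q)) (fst (snd q)) (snd (snd q)).
Let mid (q : R * R) : R := (fst q + snd q) / 2.
Let lo (q : R * R) : R * R := (fst q, mid q).
Let hi (q : R * R) : R * R := (mid q, snd q).
(** A quarter on which [P] fails, provided [P] fails on [q]: by the subdivision hypothesis not all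
    four quarters can satisfy [P], so the fourth is taken untested once the other three pass. *)
Let step (q : rectangle) : rectangle :=
  if excluded_middle_informative (PP (lo (fst q), lo (snd q))) then
  if excluded_middle_informative (PP (lo (fst q), hi (snd q))) then
  if excluded_middle_informative (PP (hi (fst q), lo (snd q))) then (hi (fst q), hi (snd q))
  else (hi (fst q), lo (snd q)) else (lo (fst q), hi (snd q)) else (lo (fst q), lo (snd q)).

(* Cousin's lemma for rectangles. *)
Lemma quadrisection (a0 b0 c0 d0 : R) : a0 <= b0 -> c0 <= d0 ->
  (forall a b c d, a0 <= a <= b -> b <= b0 -> c0 <= c <= d -> d <= d0 ->
     P a ((a + b) / 2) c ((c + d) / 2) -> P a ((a + b) / 2) ((c + d) / 2) d ->
     P ((a + b) / 2) b c ((c + d) / 2) -> P ((a + b) / 2) b ((c + d) / 2) d -> P a b c d) ->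
  (forall x y, a0 <= x <= b0 -> c0 <= y <= d0 -> exists e, 0 < e /\
     forall a b c d, a0 <= a <= x -> x <= b <= b0 -> c0 <= c <= y -> y <= d <= d0 ->
       b - a < e -> d - c < e -> P a b c d) ->
  P a0 b0 c0 d0.
Proof.
  intros Hab Hcd Hsub Hloc. apply NNPP. intros Hn.
  set (q := fix q (n : nat) : rectangle := match n with O => ((a0, b0), (c0, d0)) | S n => step (q n) end).
  assert (Hq : forall n, ~ PP (q n) /\
     (a0 <= fst (fst (q n)) /\ fst (fst (q n)) <= snd (fst (q n)) <= b0 /\
      snd (fst (q n)) - fst (fst (q n)) = (b0 - a0) / 2 ^ n) /\
     (c0 <= fst (snd (q n)) /\ fst (snd (q n)) <= snd (snd (q n)) <= d0 /\
      snd (snd (q n)) - fst (snd (q n)) = (d0 - c0) / 2 ^ n)).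
  { induction n as [|n IH].
    - simpl. split; [exact Hn|]. lra.
    - destruct IH as [I1 [[I2 [I3 I4]] [I5 [I6 I7]]]].
      assert (I8 : ~ PP (step (q n))).
      { unfold step.
        destruct (excluded_middle_informative _) as [E1|E1]; [|exact E1].
        destruct (excluded_middle_informative _) as [E2|E2]; [|exact E2].
        destruct (excluded_middle_informative _) as [E3|E3]; [|exact E3].
        intros E4. apply I1. unfold PP in *. apply Hsub; try lra; assumption. }
      split; [exact I8|]. simpl q. clear I8 I1.
      assert (W1 : (b0 - a0) / 2 ^ S n = (b0 - a0) / 2 ^ n / 2)
        by (simpl; field; apply pow_nonzero; lra).
      assert (W2 : (d0 - c0) / 2 ^ S n = (d0 - c0) / 2 ^ n / 2)
        by (simpl; field; apply pow_nonzero; lra).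
      rewrite W1, W2.
      unfold step; repeat destruct (excluded_middle_informative _); simpl; unfold mid; lra. }
  assert (Hmono : forall n, fst (fst (q n)) <= fst (fst (q (S n))) /\ snd (fst (q (S n))) <= snd (fst (q n)) /\
     fst (snd (q n)) <= fst (snd (q (S n))) /\ snd (snd (q (S n))) <= snd (snd (q n))).
  { intros n. destruct (Hq n) as [_ [[_ [I3 _]] [_ [I6 _]]]]. simpl q.
    unfold step; repeat destruct (excluded_middle_informative _); simpl; unfold mid; lra. }
  destruct (monotone_nested (fun n => fst (fst (q n))) (fun n => snd (fst (q n)))) as [x Hx];
    [apply Hmono|apply Hmono|intros n; destruct (Hq n); lra|].
  destruct (monotone_nested (fun n => fst (snd (q n))) (fun n => snd (snd (q n)))) as [y Hy];
    [apply Hmono|apply Hmono|intros n; destruct (Hq n); lra|].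
  destruct (Hloc x y) as [e [He HP]]; [apply (Hx 0%nat)|apply (Hy 0%nat)|].
  destruct (half_pow_small ((b0 - a0) + (d0 - c0)) e He) as [n Hn2].
  destruct (Hq n) as [H1 [H2 H3]]. specialize (Hx n). specialize (Hy n). simpl in Hx, Hy.
  apply H1. unfold PP.
  assert (Hp : 0 < 2 ^ n) by (apply pow_lt; lra).
  assert (0 <= (b0 - a0) / 2 ^ n) by (apply Rmult_le_pos; [lra|left; apply Rinv_0_lt_compat; lra]).
  assert (0 <= (d0 - c0) / 2 ^ n) by (apply Rmult_le_pos; [lra|left; apply Rinv_0_lt_compat; lra]).
  replace (((b0 - a0) + (d0 - c0)) / 2 ^ n) with ((b0 - a0) / 2 ^ n + (d0 - c0) / 2 ^ n) in Hn2
    by (field; lra).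
  apply HP; lra.
Qed.
End Quadrisection.

(** Consider the supremum of the [t] such that [P] holds on [[a, t)]: the hypothesis carries [P]
    beyond it unless [b] is reached. At [x = a] the induction hypothesis is empty, so the step also
    covers the start. *)
Lemma real_induction (P : R -> Prop) (a b : R) : a <= b ->
  (forall x, a <= x <= b -> (forall y, a <= y < x -> P y) ->
     exists d, 0 < d /\ forall y, x <= y < x + d -> y <= b -> P y) ->
  forall x, a <= x <= b -> P x.
Proof.
  intros Hab H x Hx.
  destruct (completeness (fun t => a <= t <= b /\ forall y, a <= y < t -> P y)) as [s [Hs1 Hs2]].
  - exists b. intros t [Ht _]. lra.
  - exists a. split; [lra|]. intros y Hy. lra.
  - assert (Hsa : a <= s) by (apply Hs1; split; [lra|]; intros; lra).
    assert (Hsb : s <= b) by (apply Hs2; intros t [Ht _]; lra).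
    assert (Hlt : forall y, a <= y < s -> P y).
    { intros y Hy. destruct (classic (P y)) as [Py|Py]; [exact Py|exfalso].
      assert (s <= y); [|lra]. apply Hs2. intros t [Ht1 Ht2].
      destruct (Rle_lt_dec t y) as [|L]; [assumption|]. exfalso. apply Py, Ht2. lra. }
    destruct (H s (conj Hsa Hsb) Hlt) as [d [Hd H1]].
    destruct (Rlt_le_dec x s) as [L|L]; [apply Hlt; lra|].
    destruct (Rlt_le_dec x (s + d)) as [L'|L']; [apply H1; lra|]. exfalso.
    assert (s + d / 2 <= s); [|lra]. apply Hs1. split; [lra|].
    intros y Hy. destruct (Rlt_le_dec y s); [apply Hlt; lra|apply H1; lra].
Qed.

Lemma pair_C (x y : R) : ((x, y) : C) = (RtoC x + RtoC y * Ci)%C.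
Proof. apply injective_projections; simpl; ring. Qed.

(** * Integrals along segments *)

Definition seg (g : C -> C) (p d : C) (a b : R) : C :=
  RInt (V := C_R_CompleteNormedModule) (fun t => (g (p + RtoC t * d) * d)%C) a b.

Definition ccont (u : R -> C) (t : R) : Prop := @continuous R_UniformSpace C_R_CompleteNormedModule u t.

Lemma rder_ccont (s : R -> C) (t : R) (l : C) : rder s t l -> ccont s t.
Proof.
  intros H. apply (ex_derive_continuous (K := R_AbsRing) (V := C_R_NormedModule)).
  exists l. apply rder_is_derive, H.
Qed.

Lemma seg_ccont (g : C -> C) (p d l : C) (t : R) :
  cder g (p + RtoC t * d)%C l -> ccont (fun t => g (p + RtoC t * d) * d)%C t.
Proof.
  intros H. apply rder_ccont with (l * d * d)%C.
  evar_last. apply (rder_comp (fun z => z * d)%C (fun t => g (p + RtoC t * d)%C) t (1 * d + g (p + RtoC t * d) * 0)%C (l * d)%C).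
  - apply (cder_mult (fun z => z) (fun _ => d)); [apply cder_id|apply cder_const].
  - apply rder_line, H.
  - ring.
Qed.

Lemma norm_C_R (z : C) : @norm R_AbsRing C_R_NormedModule z = Cmod z.
Proof.
  unfold norm; simpl. unfold prod_norm, Cmod, norm; simpl. unfold abs; simpl.
  f_equal. rewrite !Rmult_1_r. rewrite <- !Rabs_mult, !Rabs_pos_eq; [reflexivity|nra|nra].
Qed.

Section Segments.
Variables (g : C -> C) (p d : C).
Let good (t : R) : Prop := exists l, cder g (p + RtoC t * d)%C l.

Lemma seg_Chasles (a m b : R) :
  (forall t, Rmin a m <= t <= Rmax a m -> good t) -> (forall t, Rmin m b <= t <= Rmax m b -> good t) ->
  (seg g p d a m + seg g p d m b)%C = seg g p d a b.
Proof.
  intros H1 H2.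
  apply (RInt_Chasles (V := C_R_CompleteNormedModule)); apply ex_RInt_continuous;
  intros t Ht; [destruct (H1 t Ht) as [l Hl]|destruct (H2 t Ht) as [l Hl]];
  exact (seg_ccont _ _ _ _ _ Hl).
Qed.

Lemma seg_swap (a b : R) : (forall t, Rmin a b <= t <= Rmax a b -> good t) ->
  seg g p d b a = (- seg g p d a b)%C.
Proof.
  intros H. symmetry. apply (opp_RInt_swap (V := C_R_CompleteNormedModule)), ex_RInt_continuous.
  intros t Ht. destruct (H t Ht) as [l Hl]. exact (seg_ccont _ _ _ _ _ Hl).
Qed.

(** The increment of [A] is the integral of [A'] along the segment. Approximations of [g] by
    functions with a known primitive thus become estimates of its integrals. *)
Lemma seg_est_le (A A' : C -> C) (k a b : R) : a <= b ->
  (forall t, a <= t <= b -> good t) ->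
  (forall t, a <= t <= b -> cder A (p + RtoC t * d)%C (A' (p + RtoC t * d)%C)) ->
  (forall t, a <= t <= b -> exists l, cder A' (p + RtoC t * d)%C l) ->
  (forall t, a <= t <= b -> Cmod (g (p + RtoC t * d) - A' (p + RtoC t * d))%C <= k) ->
  Cmod (seg g p d a b - (A (p + RtoC b * d) - A (p + RtoC a * d)))%C <= k * Cmod d * (b - a).
Proof.
  intros Hab Hg HA HA' Hk.
  assert (I1 : is_RInt (V := C_R_CompleteNormedModule) (fun t => (g (p + RtoC t * d) * d)%C) a b (seg g p d a b)).
  { apply RInt_correct, ex_RInt_continuous. rewrite Rmin_left, Rmax_right by assumption.
    intros t Ht. destruct (Hg t Ht) as [l Hl]. exact (seg_ccont _ _ _ _ _ Hl). }
  assert (I2 : is_RInt (V := C_R_CompleteNormedModule) (fun t => (A' (p + RtoC t * d) * d)%C) a b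
     (A (p + RtoC b * d) - A (p + RtoC a * d))%C).
  { apply (is_RInt_derive (V := C_R_CompleteNormedModule) (fun t => A (p + RtoC t * d)%C));
    rewrite Rmin_left, Rmax_right by assumption; intros t Ht.
    - apply rder_is_derive, rder_line, HA, Ht.
    - destruct (HA' t Ht) as [l Hl]. exact (seg_ccont _ _ _ _ _ Hl). }
  pose proof (is_RInt_minus _ _ _ _ _ _ I1 I2) as I3.
  rewrite <- norm_C_R. replace (k * Cmod d * (b - a)) with ((b - a) * (k * Cmod d)) by ring.
  refine (norm_RInt_le (V := C_R_NormedModule) _ (fun _ => k * Cmod d) a b _ _ Hab _ I3
    (is_RInt_const (V := R_NormedModule) a b (k * Cmod d))).
  intros t Ht. rewrite norm_C_R.
  apply Rle_trans with (Cmod ((g (p + RtoC t * d) - A' (p + RtoC t * d)) * d)%C).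
  - right. f_equal. apply injective_projections; simpl; unfold plus, opp; simpl; ring.
  - rewrite Cmod_mult. apply Rmult_le_compat_r; [apply Cmod_ge_0|]. apply Hk, Ht.
Qed.

Lemma seg_est (A A' : C -> C) (k a b : R) :
  (forall t, Rmin a b <= t <= Rmax a b -> good t /\
     cder A (p + RtoC t * d)%C (A' (p + RtoC t * d)%C) /\
     (exists l, cder A' (p + RtoC t * d)%C l) /\
     Cmod (g (p + RtoC t * d) - A' (p + RtoC t * d))%C <= k) ->
  Cmod (seg g p d a b - (A (p + RtoC b * d) - A (p + RtoC a * d)))%C <= k * Cmod d * Rabs (b - a).
Proof.
  intros H. destruct (Rle_lt_dec a b) as [L|L].
  - rewrite Rabs_pos_eq by lra. rewrite Rmin_left, Rmax_right in H by lra.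
    apply seg_est_le with A'; try exact L; intros t Ht; apply (H t Ht).
  - rewrite Rabs_left by lra. rewrite Rmin_right, Rmax_left in H by lra.
    rewrite seg_swap.
    + rewrite <- Cmod_opp.
      replace (- (- seg g p d b a - (A (p + RtoC b * d) - A (p + RtoC a * d))))%C with
        (seg g p d b a - (A (p + RtoC a * d) - A (p + RtoC b * d)))%C by ring.
      replace (- (b - a)) with (a - b) by ring.
      apply seg_est_le with A'; try lra; intros t Ht; apply (H t Ht).
    + rewrite Rmin_left, Rmax_right by lra. intros t Ht. apply (H t Ht).
Qed.
End Segments.

Definition hseg (g : C -> C) (y a b : R) : C := seg g (RtoC y * Ci)%C 1%C a b.
Definition vseg (g : C -> C) (x c d : R) : C := seg g (RtoC x) Ci c d.

Definition bdry (g : C -> C) (a b c d : R) : C :=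
  (hseg g c a b + vseg g b c d - hseg g d a b - vseg g a c d)%C.

Lemma horizontal_point (x y : R) : (RtoC y * Ci + RtoC x * 1)%C = ((x, y) : C).
Proof. rewrite pair_C. ring. Qed.

Lemma vertical_point (x y : R) : (RtoC x + RtoC y * Ci)%C = ((x, y) : C).
Proof. rewrite pair_C. ring. Qed.

Lemma hseg_Chasles (g : C -> C) (y a m b : R) : a <= m <= b ->
  (forall x, a <= x <= b -> exists l, cder g (x, y) l) ->
  (hseg g y a m + hseg g y m b)%C = hseg g y a b.
Proof.
  intros Hm H. unfold hseg, vseg. apply seg_Chasles; rewrite Rmin_left, Rmax_right by lra; intros t Ht;
  rewrite horizontal_point; apply H; lra.
Qed.

Lemma vseg_Chasles (g : C -> C) (x a m b : R) : a <= m <= b ->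
  (forall y, a <= y <= b -> exists l, cder g (x, y) l) ->
  (vseg g x a m + vseg g x m b)%C = vseg g x a b.
Proof.
  intros Hm H. unfold hseg, vseg. apply seg_Chasles; rewrite Rmin_left, Rmax_right by lra; intros t Ht;
  rewrite vertical_point; apply H; lra.
Qed.

Lemma hseg_est (g A A' : C -> C) (y k a b : R) : a <= b ->
  (forall x, a <= x <= b -> (exists l, cder g (x, y) l) /\ cder A (x, y) (A' (x, y)) /\
     (exists l, cder A' (x, y) l) /\ Cmod (g (x, y) - A' (x, y))%C <= k) ->
  Cmod (hseg g y a b - (A (b, y) - A (a, y)))%C <= k * (b - a).
Proof.
  intros Hab H. pose proof (seg_est g (RtoC y * Ci)%C 1%C A A' k a b) as E.
  rewrite !horizontal_point, Cmod_1, Rmult_1_r, Rabs_pos_eq in E by lra.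
  apply E. rewrite Rmin_left, Rmax_right by lra. intros t Ht. rewrite horizontal_point. apply H, Ht.
Qed.

Lemma vseg_est (g A A' : C -> C) (x k a b : R) : a <= b ->
  (forall y, a <= y <= b -> (exists l, cder g (x, y) l) /\ cder A (x, y) (A' (x, y)) /\
     (exists l, cder A' (x, y) l) /\ Cmod (g (x, y) - A' (x, y))%C <= k) ->
  Cmod (vseg g x a b - (A (x, b) - A (x, a)))%C <= k * (b - a).
Proof.
  intros Hab H. pose proof (seg_est g (RtoC x) Ci A A' k a b) as E.
  rewrite !vertical_point, Cmod_Ci, Rmult_1_r, Rabs_pos_eq in E by lra.
  apply E. rewrite Rmin_left, Rmax_right by lra. intros t Ht. rewrite vertical_point. apply H, Ht.
Qed.

Lemma Cmod_le_abs (z : C) : Cmod z <= Rabs (Re z) + Rabs (Im z).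
Proof.
  replace z with (RtoC (Re z) + RtoC (Im z) * Ci)%C.
  - eapply Rle_trans; [apply Cmod_triangle|]. rewrite Cmod_mult, Cmod_Ci, !Cmod_R.
    rewrite <- pair_C. simpl. lra.
  - rewrite <- pair_C. destruct z; reflexivity.
Qed.

Lemma Cmod4 (a b c d : C) : Cmod (a + b - c - d)%C <= Cmod a + Cmod b + Cmod c + Cmod d.
Proof.
  eapply Rle_trans; [apply Cmod_minus_le|]. apply Rplus_le_compat_r.
  eapply Rle_trans; [apply Cmod_minus_le|]. apply Rplus_le_compat_r. apply Cmod_triangle.
Qed.

(** The bound [eps * (width + height) ^ 2] is inherited from the four quarters, and small rectangles
    satisfy it because [g] is close there to an affine function, whose integral around the boundary
    vanishes. [quadrisection] combines the two, and [eps] is arbitrary. *)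
Lemma goursat (g : C -> C) (a b c d : R) : a <= b -> c <= d ->
  (forall x y, a <= x <= b -> c <= y <= d -> exists l, cder g (x, y) l) ->
  bdry g a b c d = 0%C.
Proof.
  intros Hab Hcd Hg.
  assert (K : forall eps, 0 < eps -> Cmod (bdry g a b c d) <= eps * ((b - a) + (d - c)) ^ 2).
  { intros eps Heps.
    apply (quadrisection (fun a b c d => Cmod (bdry g a b c d) <= eps * ((b - a) + (d - c)) ^ 2));
      [exact Hab|exact Hcd| |].
    - intros a' b' c' d' Ha Hb Hc Hd H1 H2 H3 H4.
      set (m := (a' + b') / 2) in *. set (n := (c' + d') / 2) in *.
      assert (Hm : a' <= m <= b') by (unfold m; lra).
      assert (Hn : c' <= n <= d') by (unfold n; lra).
      assert (E : bdry g a' b' c' d' =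
        (bdry g a' m c' n + bdry g a' m n d' + bdry g m b' c' n + bdry g m b' n d')%C).
      { unfold bdry.
        rewrite <- (hseg_Chasles g c' a' m b') by (try lra; intros; apply Hg; lra).
        rewrite <- (hseg_Chasles g d' a' m b') by (try lra; intros; apply Hg; lra).
        rewrite <- (vseg_Chasles g a' c' n d') by (try lra; intros; apply Hg; lra).
        rewrite <- (vseg_Chasles g b' c' n d') by (try lra; intros; apply Hg; lra).
        ring. }
      rewrite E. eapply Rle_trans; [apply Cmod_triangle|].
      eapply Rle_trans; [apply Rplus_le_compat_r, Cmod_triangle|].
      eapply Rle_trans; [apply Rplus_le_compat_r, Rplus_le_compat_r, Cmod_triangle|].
      (* Each quarter has half the width plus height, so the four bounds add up exactly to the bound
         for the whole. *)
      replace (eps * (b' - a' + (d' - c')) ^ 2) with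
        (eps * (m - a' + (n - c')) ^ 2 + eps * (m - a' + (d' - n)) ^ 2 +
         eps * (b' - m + (n - c')) ^ 2 + eps * (b' - m + (d' - n)) ^ 2) by (unfold m, n; field).
      lra.
    - intros x y Hx Hy. destruct (Hg x y Hx Hy) as [l Hl].
      destruct (Hl (eps / 2) ltac:(lra)) as [e [He H]].
      exists (e / 2). split; [lra|].
      intros a' b' c' d' Ha Hb Hc Hd Hw Hh.
      set (z0 := ((x, y) : C)) in *.
      (* [A'] is the first order expansion of [g] at [z0], and [A] is a primitive of [A']. *)
      set (A' := fun z => (g z0 + l * (z - z0))%C).
      set (A := fun z => (g z0 * z + l * (z * z / 2 - z0 * z))%C).
      assert (HA' : forall z, cder A' z l).
      { intros z. unfold A'.
        apply cder_eq with (0 + (0 * (z - z0) + l * (1 - 0)))%C; [|ring].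
        apply (cder_plus (fun _ => g z0) (fun z => l * (z - z0))%C); [apply cder_const|].
        apply (cder_mult (fun _ => l) (fun z => z - z0)%C); [apply cder_const|].
        apply (cder_minus (fun z => z) (fun _ => z0)); [apply cder_id|apply cder_const]. }
      assert (HA : forall z, cder A z (A' z)).
      { intros z. unfold A, A'.
        apply cder_eq with
          ((0 * z + g z0 * 1) + (0 * (z * z / 2 - z0 * z) + l * (((1 * z + z * 1) * / 2 + z * z * 0) - (0 * z + z0 * 1))))%C;
          [|field; intros E2; apply (f_equal fst) in E2; simpl in E2; lra].
        apply (cder_plus (fun z => g z0 * z)%C (fun z => l * (z * z / 2 - z0 * z))%C).
        - apply (cder_mult (fun _ => g z0) (fun z => z)); [apply cder_const|apply cder_id].
        - apply (cder_mult (fun _ => l) (fun z => z * z / 2 - z0 * z)%C); [apply cder_const|].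
          apply (cder_minus (fun z => z * z / 2)%C (fun z => z0 * z)%C).
          + apply (cder_mult (fun z => z * z)%C (fun _ => / 2)%C); [|apply cder_const].
            apply (cder_mult (fun z => z) (fun z => z)); apply cder_id.
          + apply (cder_mult (fun _ => z0) (fun z => z)); [apply cder_const|apply cder_id]. }
      assert (S : forall x' y', a' <= x' <= b' -> c' <= y' <= d' ->
        (exists l, cder g (x', y') l) /\ cder A (x', y') (A' (x', y')) /\
        (exists l, cder A' (x', y') l) /\
        Cmod (g (x', y') - A' (x', y'))%C <= eps / 2 * ((b' - a') + (d' - c'))).
      { intros x' y' Hx' Hy'. split; [apply Hg; lra|]. split; [apply HA|].
        split; [exists l; apply HA'|].
        assert (N : Cmod ((x', y') - z0)%C <= (b' - a') + (d' - c')).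
        { eapply Rle_trans; [apply Cmod_le_abs|]. simpl. unfold z0; simpl.
          apply Rplus_le_compat; apply Rabs_le; lra. }
        unfold A'. replace (g (x', y') - (g z0 + l * ((x', y') - z0)))%C with
          (g (x', y') - g z0 - l * ((x', y') - z0))%C by ring.
        eapply Rle_trans; [apply H; lra|]. apply Rmult_le_compat_l; lra. }
      assert (E1 := hseg_est g A A' c' _ a' b' ltac:(lra) (fun x' Hx' => S x' c' Hx' ltac:(lra))).
      assert (E2 := hseg_est g A A' d' _ a' b' ltac:(lra) (fun x' Hx' => S x' d' Hx' ltac:(lra))).
      assert (E3 := vseg_est g A A' a' _ c' d' ltac:(lra) (fun y' Hy' => S a' y' ltac:(lra) Hy')).
      assert (E4 := vseg_est g A A' b' _ c' d' ltac:(lra) (fun y' Hy' => S b' y' ltac:(lra) Hy')).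
      unfold bdry.
      (* The increments of [A] cancel around the closed boundary. *)
      replace (hseg g c' a' b' + vseg g b' c' d' - hseg g d' a' b' - vseg g a' c' d')%C with
        ((hseg g c' a' b' - (A (b', c') - A (a', c'))) + (vseg g b' c' d' - (A (b', d') - A (b', c')))
         - (hseg g d' a' b' - (A (b', d') - A (a', d'))) - (vseg g a' c' d' - (A (a', d') - A (a', c'))))%C
        by ring.
      eapply Rle_trans; [apply Cmod4|].
      set (W := b' - a') in *. set (Hh' := d' - c') in *.
      replace (eps * (W + Hh') ^ 2) with (eps / 2 * (W + Hh') * W + eps / 2 * (W + Hh') * Hh' +
        eps / 2 * (W + Hh') * W + eps / 2 * (W + Hh') * Hh') by field.
      lra. }
  apply Cmod_eq_0. apply Rle_antisym; [|apply Cmod_ge_0].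
  apply le_epsilon. intros eps Heps. rewrite Rplus_0_l.
  assert (Hq : 0 < (b - a + (d - c)) ^ 2 + 1) by (pose proof (pow2_ge_0 (b - a + (d - c))); lra).
  eapply Rle_trans; [apply (K (eps / ((b - a + (d - c)) ^ 2 + 1))); apply Rdiv_lt_0_compat; lra|].
  apply Rle_trans with (eps / ((b - a + (d - c)) ^ 2 + 1) * ((b - a + (d - c)) ^ 2 + 1)).
  - apply Rmult_le_compat_l; [left; apply Rdiv_lt_0_compat|]; lra.
  - right. field. lra.
Qed.

(** * The complex exponential and the maximum principle *)

Definition Cexp (z : C) : C := (exp (Re z) * cos (Im z), exp (Re z) * sin (Im z)).

Lemma Cexp_plus (a b : C) : Cexp (a + b)%C = (Cexp a * Cexp b)%C.
Proof.
  unfold Cexp, Re, Im; destruct a as [x y], b as [u v]; simpl.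
  rewrite exp_plus, cos_plus, sin_plus. apply injective_projections; simpl; ring.
Qed.

Lemma Cexp_0 : Cexp 0%C = 1%C.
Proof. unfold Cexp; simpl. rewrite exp_0, cos_0, sin_0. apply injective_projections; simpl; ring. Qed.

Lemma Cmod_Cexp (z : C) : Cmod (Cexp z) = exp (Re z).
Proof.
  apply Rsqr_inj; [apply Cmod_ge_0|left; apply exp_pos|].
  unfold Rsqr. replace (Cmod (Cexp z) * Cmod (Cexp z)) with (Cmod (Cexp z) ^ 2) by ring.
  rewrite Cmod2_alt. unfold Cexp; simpl.
  pose proof (sin2_cos2 (Im z)) as H. unfold Rsqr in H. simpl in H.
  transitivity (exp (Re z) * exp (Re z) * (sin (Im z) * sin (Im z) + cos (Im z) * cos (Im z))); [ring|].
  rewrite H. ring.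
Qed.

Lemma Cexp_neq_0 (z : C) : Cexp z <> 0%C.
Proof. apply Cmod_gt_0. rewrite Cmod_Cexp. apply exp_pos. Qed.

Lemma Cexp_opp (z : C) : Cexp (- z)%C = (/ Cexp z)%C.
Proof.
  pose proof (Cexp_neq_0 z) as H.
  assert (E : (Cexp z * Cexp (- z) = 1)%C).
  { rewrite <- Cexp_plus. replace (z + - z)%C with (0 : C) by ring. apply Cexp_0. }
  rewrite <- (Cmult_1_l (/ Cexp z)%C), <- E. field. exact H.
Qed.

Lemma Cexp_minus (a b : C) : Cexp (a - b)%C = (Cexp a / Cexp b)%C.
Proof. unfold Cminus. rewrite Cexp_plus, Cexp_opp. reflexivity. Qed.

Lemma Cexp_2PI (k : nat) : Cexp (RtoC (2 * INR k * PI) * Ci)%C = 1%C.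
Proof.
  unfold Cexp; simpl. replace (2 * INR k * PI * 0 - 0 * 1) with 0 by ring.
  replace (2 * INR k * PI * 1 + 0 * 0) with (0 + 2 * INR k * PI) by ring.
  rewrite cos_period, sin_period, exp_0, cos_0, sin_0. apply injective_projections; simpl; ring.
Qed.

Lemma polar_exists (z : C) : z <> 0%C -> exists s : C, Cexp s = z.
Proof.
  intros Hz. assert (Hr := proj1 (Cmod_gt_0 z) Hz). set (r := Cmod z) in *.
  assert (E : Re z ^ 2 + Im z ^ 2 = r ^ 2) by (symmetry; apply Cmod2_alt).
  set (x := Re z / r). set (y := Im z / r).
  assert (E' : x ^ 2 + y ^ 2 = 1).
  { unfold x, y. transitivity ((Re z ^ 2 + Im z ^ 2) / r ^ 2); [field; lra|]. rewrite E. field. lra. }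
  assert (Hx : -1 <= x <= 1) by nra.
  assert (Hy : sqrt (1 - x ^ 2) = Rabs y).
  { replace (1 - x ^ 2) with (Rsqr y) by (unfold Rsqr; nra). apply sqrt_Rsqr_abs. }
  assert (Hs : exists t, cos t = x /\ sin t = y).
  { destruct (Rle_lt_dec 0 y) as [L|L].
    - exists (acos x). rewrite cos_acos, sin_acos by exact Hx. split; [reflexivity|].
      replace (Rsqr x) with (x ^ 2) by (unfold Rsqr; ring). rewrite Hy. apply Rabs_pos_eq, L.
    - exists (- acos x). rewrite cos_neg, sin_neg, cos_acos, sin_acos by exact Hx. split; [reflexivity|].
      replace (Rsqr x) with (x ^ 2) by (unfold Rsqr; ring). rewrite Hy. rewrite Rabs_left by exact L. ring. }
  destruct Hs as [t [Ht1 Ht2]]. exists (ln r, t).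
  unfold Cexp; simpl. rewrite exp_ln, Ht1, Ht2 by exact Hr. unfold x, y.
  destruct z as [u v]; simpl. apply injective_projections; simpl; field; lra.
Qed.

Lemma derivable_pt_lim_abs (f : R -> R) (l : R) : derivable_pt_lim f 0 l ->
  forall eps, 0 < eps -> exists d, 0 < d /\ forall h, Rabs h < d -> Rabs (f h - f 0 - l * h) <= eps * Rabs h.
Proof.
  intros H eps Heps. destruct (H eps Heps) as [d Hd]. exists d. split; [apply cond_pos|].
  intros h Hh. destruct (Req_dec h 0) as [->|N].
  - replace (f 0 - f 0 - l * 0) with 0 by ring. rewrite Rabs_R0. lra.
  - specialize (Hd h N Hh). rewrite Rplus_0_l in Hd.
    replace (f h - f 0 - l * h) with (((f h - f 0) / h - l) * h) by (field; exact N).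
    rewrite Rabs_mult. apply Rmult_le_compat_r; [apply Rabs_pos|lra].
Qed.

(** Follows from the real derivatives of [exp], [cos] and [sin] at [0]; the functional equation
    afterwards moves it to every point. *)
Lemma cder_Cexp_0 : cder Cexp 0%C 1%C.
Proof.
  intros eps Heps. set (e := Rmin 1 (eps / 6)).
  assert (He : 0 < e) by (apply Rmin_glb_lt; lra).
  assert (He1 : e <= 1) by apply Rmin_l. assert (He2 : e <= eps / 6) by apply Rmin_r.
  destruct (derivable_pt_lim_abs exp _ (derivable_pt_lim_exp 0) e He) as [d1 [Hd1 H1]].
  destruct (derivable_pt_lim_abs cos _ (derivable_pt_lim_cos 0) e He) as [d2 [Hd2 H2]].
  destruct (derivable_pt_lim_abs sin _ (derivable_pt_lim_sin 0) e He) as [d3 [Hd3 H3]].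
  exists (Rmin (Rmin d1 d2) (Rmin d3 (e / 2))). split.
  { repeat apply Rmin_glb_lt; lra. }
  intros w Hw. rewrite Cexp_0. replace (Cexp w - 1 - 1 * (w - 0))%C with (Cexp w - 1 - w)%C by ring.
  replace (w - 0)%C with w in * by ring.
  assert (Hx : Rabs (Re w) <= Cmod w) by apply re_le_Cmod.
  assert (Hy : Rabs (Im w) <= Cmod w).
  { eapply Rle_trans; [|apply Rmax_Cmod]. apply Rmax_r. }
  destruct w as [x y]; simpl in Hx, Hy. set (m := Cmod (x, y)) in *.
  assert (M1 := Rlt_le_trans _ _ _ Hw (Rmin_l _ _)). assert (M2 := Rlt_le_trans _ _ _ Hw (Rmin_r _ _)).
  assert (M11 := Rlt_le_trans _ _ _ M1 (Rmin_l _ _)). assert (M12 := Rlt_le_trans _ _ _ M1 (Rmin_r _ _)).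
  assert (M21 := Rlt_le_trans _ _ _ M2 (Rmin_l _ _)). assert (M22 := Rlt_le_trans _ _ _ M2 (Rmin_r _ _)).
  specialize (H1 x ltac:(lra)). specialize (H2 y ltac:(lra)). specialize (H3 y ltac:(lra)).
  rewrite exp_0 in H1. rewrite cos_0, sin_0 in H2. rewrite sin_0, cos_0 in H3.
  pose proof (Rabs_pos x) as Px. pose proof (Rabs_pos y) as Py.
  set (a := exp x - 1 - 1 * x) in *. set (b := cos y - 1 - - 0 * y) in *. set (c := sin y - 0 - 1 * y) in *.
  assert (Ex : exp x = 1 + x + a) by (unfold a; ring).
  assert (Ec : cos y = 1 + b) by (unfold b; ring). assert (Es : sin y = y + c) by (unfold c; ring).
  assert (Hexp : Rabs (x + a) <= e).
  { eapply Rle_trans; [apply Rabs_triang|]. nra. }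
  assert (Hexp2 : Rabs (exp x) <= 2).
  { rewrite Ex. replace (1 + x + a) with (1 + (x + a)) by ring.
    eapply Rle_trans; [apply Rabs_triang|]. rewrite Rabs_R1. lra. }
  eapply Rle_trans; [apply Cmod_le_abs|].
  unfold Cexp; simpl.
  replace (exp x * cos y + - (1) + - x) with (a + exp x * b) by (rewrite Ec, Ex; ring).
  replace (exp x * sin y + - 0 + - y) with (exp x * c + (x + a) * y) by (rewrite Es, Ex; ring).
  assert (B1 : Rabs (a + exp x * b) <= e * m + 2 * (e * m)).
  { eapply Rle_trans; [apply Rabs_triang|]. rewrite Rabs_mult. apply Rplus_le_compat; [nra|].
    apply Rmult_le_compat; try apply Rabs_pos; [exact Hexp2|nra]. }
  assert (B2 : Rabs (exp x * c + (x + a) * y) <= 2 * (e * m) + e * m).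
  { eapply Rle_trans; [apply Rabs_triang|]. rewrite !Rabs_mult. apply Rplus_le_compat.
    - apply Rmult_le_compat; try apply Rabs_pos; [exact Hexp2|nra].
    - apply Rmult_le_compat; try apply Rabs_pos; [exact Hexp|lra]. }
  assert (0 <= m) by apply Cmod_ge_0. nra.
Qed.

Lemma cder_Cexp (z : C) : cder Cexp z (Cexp z).
Proof.
  apply cder_ext_loc with (f := fun w => (Cexp z * Cexp (w - z))%C) (d := 1); [lra| |].
  - intros w _. rewrite <- Cexp_plus. f_equal. ring.
  - eapply cder_eq.
    + apply (cder_mult (fun _ => Cexp z) (fun w => Cexp (w - z)%C)); [apply cder_const|].
      apply (cder_comp Cexp (fun w => w - z)%C z 1%C (1 - 0)%C).
      * replace (z - z)%C with (0 : C) by ring. apply cder_Cexp_0.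
      * apply (cder_minus (fun w => w) (fun _ => z)); [apply cder_id|apply cder_const].
    + ring.
Qed.

(** * The mean value property and the maximum principle *)

Definition pcont (g : C -> C) (z : C) : Prop :=
  forall eps, 0 < eps -> exists d, 0 < d /\ forall w, Cmod (w - z)%C < d -> Cmod (g w - g z)%C < eps.

Lemma cder_pcont (g : C -> C) (z l : C) : cder g z l -> pcont g z.
Proof. intros H eps Heps. exact (cder_cont g z l H eps Heps). Qed.

(* The mean value property: by Goursat in the coordinate [z = c + exp s], where circles become vertical
   segments, the mean of [g] over circles around [c] is constant; let the radius tend to [0]. *)
Lemma Re_mean_nonpos (g : C -> C) (c : C) (r rho : R) : 0 < rho < r ->
  (forall z, 0 < Cmod (z - c)%C < r -> exists l, cder g z l) -> pcont g c ->
  (forall z, Cmod (z - c)%C = rho -> Re (g z) <= 0) -> Re (g c) <= 0.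
Proof.
  intros Hrho Hg Hc Hre.
  set (G := fun s => g (c + Cexp s)%C).
  assert (HG : forall s, Re s < ln r -> exists l, cder G s l).
  { intros s Hs. destruct (Hg (c + Cexp s)%C) as [l Hl].
    - replace (c + Cexp s - c)%C with (Cexp s) by ring. rewrite Cmod_Cexp. split; [apply exp_pos|].
      rewrite <- (exp_ln r) by lra. apply exp_increasing, Hs.
    - eexists. apply (cder_comp g (fun s => c + Cexp s)%C); [exact Hl|].
      apply (cder_plus (fun _ => c) Cexp); [apply cder_const|apply cder_Cexp]. }
  pose proof PI_RGT_0 as HPI.
  assert (Hln : ln rho < ln r) by (apply ln_increasing; lra).
  assert (Heq : forall s1, s1 <= ln rho -> vseg G s1 0 (2 * PI) = vseg G (ln rho) 0 (2 * PI)).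
  { intros s1 Hs1.
    assert (B : bdry G s1 (ln rho) 0 (2 * PI) = 0%C).
    { apply goursat; [exact Hs1|lra|]. intros x y Hx Hy. apply HG. simpl. lra. }
    unfold bdry in B.
    (* The horizontal sides agree by periodicity and cancel; what remains compares the means over
       two circles. *)
    assert (P : hseg G (2 * PI) s1 (ln rho) = hseg G 0 s1 (ln rho)).
    { unfold hseg, seg. apply (RInt_ext (V := C_R_CompleteNormedModule)). intros t _. unfold G.
      rewrite !horizontal_point. f_equal. f_equal. f_equal. unfold Cexp; simpl.
      rewrite cos_2PI, sin_2PI, cos_0, sin_0. reflexivity. }
    rewrite P in B.
    transitivity (vseg G (ln rho) 0 (2 * PI) - (hseg G 0 s1 (ln rho) + vseg G (ln rho) 0 (2 * PI)
      - hseg G 0 s1 (ln rho) - vseg G s1 0 (2 * PI)))%C; [ring|]. rewrite B. ring. }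
  assert (HV : vseg G (ln rho) 0 (2 * PI) = (g c * (RtoC (2 * PI) * Ci))%C).
  { assert (K : forall eps, 0 < eps ->
      Cmod (vseg G (ln rho) 0 (2 * PI) - g c * (RtoC (2 * PI) * Ci))%C <= eps * (2 * PI - 0)).
    { intros eps Heps. destruct (Hc eps Heps) as [d [Hd H]].
      set (s1 := Rmin (ln rho) (ln (d / 2))).
      assert (Hs1 : s1 <= ln rho) by apply Rmin_l.
      rewrite <- (Heq s1 Hs1).
      replace (g c * (RtoC (2 * PI) * Ci))%C with
        (g c * (((s1, (2 * PI)%R) : C)) - g c * (((s1, 0%R) : C)))%C by (rewrite !pair_C; ring).
      apply (vseg_est G (fun z => g c * z)%C (fun _ => g c)); [lra|].
      intros y Hy. split; [apply HG; simpl; lra|]. split; [|split].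
      - eapply cder_eq; [apply (cder_mult (fun _ => g c) (fun z => z)); [apply cder_const|apply cder_id]|ring].
      - eexists; apply cder_const.
      - left. unfold G. apply H. replace (c + Cexp (s1, y) - c)%C with (Cexp (s1, y)) by ring.
        rewrite Cmod_Cexp. simpl. apply Rle_lt_trans with (exp (ln (d / 2))).
        + assert (s1 <= ln (d / 2)) by apply Rmin_r. destruct (Rle_lt_or_eq_dec _ _ H0) as [L|L].
          * left. apply exp_increasing, L.
          * rewrite L. lra.
        + rewrite exp_ln by lra. lra. }
    assert (Z : Cmod (vseg G (ln rho) 0 (2 * PI) - g c * (RtoC (2 * PI) * Ci))%C = 0).
    { apply Rle_antisym; [|apply Cmod_ge_0]. apply le_epsilon. intros eps Heps. rewrite Rplus_0_l.
      replace eps with (eps / (2 * PI) * (2 * PI - 0)) at 1 by (field; lra).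
      apply K. apply Rdiv_lt_0_compat; lra. }
    apply Cmod_eq_0 in Z.
    transitivity ((vseg G (ln rho) 0 (2 * PI) - g c * (RtoC (2 * PI) * Ci)) + g c * (RtoC (2 * PI) * Ci))%C;
      [ring|]. rewrite Z. ring. }
  assert (I : is_RInt (V := C_R_CompleteNormedModule) (fun t => (G (RtoC (ln rho) + RtoC t * Ci) * Ci)%C)
     0 (2 * PI) (vseg G (ln rho) 0 (2 * PI))).
  { apply RInt_correct, ex_RInt_continuous. rewrite Rmin_left, Rmax_right by lra.
    intros t Ht. destruct (HG (RtoC (ln rho) + RtoC t * Ci)%C) as [l Hl].
    - rewrite vertical_point. simpl. exact Hln.
    - exact (seg_ccont _ _ _ _ _ Hl). }
  (* The direction [Ci] of the vertical segment multiplies the integrand, so the real part of [g]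
     appears in the second component. *)
  apply (is_RInt_fct_extend_snd (U := R_NormedModule) (V := R_NormedModule)) in I.
  assert (N : snd (vseg G (ln rho) 0 (2 * PI)) <= 0).
  { replace 0 with (scal (2 * PI - 0) 0) at 2 by (unfold scal; simpl; unfold mult; simpl; ring).
    refine (is_RInt_le _ (fun _ => 0) 0 (2 * PI) _ _ ltac:(lra) I
      (is_RInt_const (V := R_NormedModule) 0 (2 * PI) 0) _).
    intros x Hx. rewrite vertical_point.
    assert (Re (G (ln rho, x)) <= 0).
    { apply Hre. replace (c + Cexp (ln rho, x) - c)%C with (Cexp (ln rho, x)) by ring.
      rewrite Cmod_Cexp. simpl. apply exp_ln. lra. }
    simpl. unfold Re in H. lra. }
  rewrite HV in N. simpl in N. unfold Re. nra.
Qed.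

(** If no point of [K] were maximal, then for every small rectangle some point of [K] would beat all
    points of [K] in it, by upper semicontinuity and closedness. This passes from quarters to the
    whole, and [quadrisection] yields a point that beats itself. *)
Lemma compact_max (K : C -> Prop) (psi : C -> R) (a b c d : R) : a <= b -> c <= d ->
  (forall z, K z -> a <= Re z <= b /\ c <= Im z <= d) ->
  (forall z, ~ K z -> exists e, 0 < e /\ forall w, Cmod (w - z)%C < e -> ~ K w) ->
  (forall z, K z -> forall eps, 0 < eps -> exists e, 0 < e /\
     forall w, K w -> Cmod (w - z)%C < e -> psi w < psi z + eps) ->
  (exists z, K z) -> exists z, K z /\ forall w, K w -> psi w <= psi z.
Proof.
  intros Hab Hcd Hin Hcl Hcont [k0 Hk0]. apply NNPP. intros Hn.
  assert (Hbig : forall z, K z -> exists w, K w /\ psi z < psi w).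
  { intros z Hz. apply NNPP. intros H. apply Hn. exists z. split; [exact Hz|].
    intros w Hw. apply Rnot_lt_le. intros L. apply H. exists w. tauto. }
  set (P := fun a b c d : R => exists z0, K z0 /\
     forall z, K z -> a <= Re z <= b -> c <= Im z <= d -> psi z < psi z0).
  assert (HP : P a b c d).
  { apply quadrisection; [exact Hab|exact Hcd| |].
    - intros a1 b1 c1 d1 _ _ _ _ [z1 [K1 H1]] [z2 [K2 H2]] [z3 [K3 H3]] [z4 [K4 H4]].
      assert (E : exists z0, K z0 /\ psi z1 <= psi z0 /\ psi z2 <= psi z0 /\ psi z3 <= psi z0 /\ psi z4 <= psi z0).
      { destruct (Rle_lt_dec (psi z1) (psi z2)); destruct (Rle_lt_dec (psi z3) (psi z4));
        [destruct (Rle_lt_dec (psi z2) (psi z4))|destruct (Rle_lt_dec (psi z2) (psi z3))|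
         destruct (Rle_lt_dec (psi z1) (psi z4))|destruct (Rle_lt_dec (psi z1) (psi z3))];
        first [exists z1; repeat split; (assumption || lra)|exists z2; repeat split; (assumption || lra)
          |exists z3; repeat split; (assumption || lra)|exists z4; repeat split; (assumption || lra)]. }
      destruct E as [z0 [K0 E]]. exists z0. split; [exact K0|]. intros z Kz Hx Hy.
      specialize (H1 z Kz). specialize (H2 z Kz). specialize (H3 z Kz). specialize (H4 z Kz).
      destruct (Rle_lt_dec (Re z) ((a1 + b1) / 2)); destruct (Rle_lt_dec (Im z) ((c1 + d1) / 2));
      [specialize (H1 ltac:(lra) ltac:(lra))|specialize (H2 ltac:(lra) ltac:(lra))|
       specialize (H3 ltac:(lra) ltac:(lra))|specialize (H4 ltac:(lra) ltac:(lra))]; lra.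
    - intros x y Hx Hy. set (z := ((x, y) : C)).
      assert (Near : forall e, 0 < e -> exists e', 0 < e' /\ forall a1 b1 c1 d1, a <= a1 <= x -> x <= b1 <= b ->
        c <= c1 <= y -> y <= d1 <= d -> b1 - a1 < e' -> d1 - c1 < e' -> forall w, a1 <= Re w <= b1 ->
        c1 <= Im w <= d1 -> Cmod (w - z)%C < e).
      { intros e He. exists (e / 2). split; [lra|]. intros a1 b1 c1 d1 ? ? ? ? ? ? w Hw1 Hw2.
        eapply Rle_lt_trans; [apply Cmod_le_abs|].
        replace e with (e / 2 + e / 2) by field. destruct w as [w1 w2]; simpl in *.
        apply Rplus_lt_compat; apply Rabs_def1; lra. }
      destruct (classic (K z)) as [Kz|Kz].
      + destruct (Hbig z Kz) as [z' [Kz' L]].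
        destruct (Hcont z Kz (psi z' - psi z) ltac:(lra)) as [e [He H]].
        destruct (Near e He) as [e' [He' N]]. exists e'. split; [exact He'|].
        intros a1 b1 c1 d1 A1 A2 A3 A4 A5 A6. exists z'. split; [exact Kz'|].
        intros w Kw W1 W2. assert (psi w < psi z + (psi z' - psi z)); [|lra].
        apply H; [exact Kw|]. apply (N a1 b1 c1 d1); assumption.
      + destruct (Hcl z Kz) as [e [He H]].
        destruct (Near e He) as [e' [He' N]]. exists e'. split; [exact He'|].
        intros a1 b1 c1 d1 A1 A2 A3 A4 A5 A6. exists k0. split; [exact Hk0|].
        intros w Kw W1 W2. exfalso. apply (H w); [|exact Kw]. apply (N a1 b1 c1 d1); assumption. }
  destruct HP as [z0 [K0 H]]. destruct (Hin z0 K0) as [H1 H2].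
  specialize (H z0 K0 H1 H2). lra.
Qed.

Lemma Im_le_Cmod (z : C) : Rabs (Im z) <= Cmod z.
Proof. eapply Rle_trans; [apply Rmax_r|apply Rmax_Cmod]. Qed.

Lemma abs_le_between (x e : R) : Rabs x <= e -> - e <= x <= e.
Proof. intros H. destruct (Rle_lt_dec 0 x); [rewrite Rabs_pos_eq in H by lra|rewrite Rabs_left in H by lra]; lra. Qed.

(* At an interior maximum [z0] of [|g|^2 + eps |z - c|^2], the tangent function [q] below is positive at [z0]
   but has nonpositive real part on a small circle around [z0]. *)
Lemma max_principle (g : C -> C) (c : C) (r M : R) : 0 < r ->
  (forall z, Cmod (z - c)%C <= r -> pcont g z) ->
  (forall z, Cmod (z - c)%C < r -> exists e, 0 < e /\ forall w, 0 < Cmod (w - z)%C < e -> exists l, cder g w l) ->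
  (forall z, Cmod (z - c)%C = r -> Cmod (g z) <= M) ->
  forall z, Cmod (z - c)%C <= r -> Cmod (g z) <= M.
Proof.
  intros Hr Hcont Hhol HM z Hz.
  assert (HM0 : 0 <= M).
  { eapply Rle_trans; [apply Cmod_ge_0|apply (HM (c + RtoC r)%C)].
    replace (c + RtoC r - c)%C with (RtoC r) by ring. rewrite Cmod_R. apply Rabs_pos_eq. lra. }
  assert (Key : forall eps, 0 < eps -> Cmod (g z) ^ 2 <= M ^ 2 + eps * r ^ 2).
  { intros eps Heps.
    set (psi := fun w => Cmod (g w) ^ 2 + eps * Cmod (w - c)%C ^ 2).
    destruct (compact_max (fun w => Cmod (w - c)%C <= r) psi (Re c - r) (Re c + r) (Im c - r) (Im c + r))
      as [z0 [Hz0 Hmax]]; try lra.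
    - intros w Hw. pose proof (re_le_Cmod (w - c)%C) as H1. pose proof (Im_le_Cmod (w - c)%C) as H2.
      assert (H1' := abs_le_between _ _ (Rle_trans _ _ _ H1 Hw)).
      assert (H2' := abs_le_between _ _ (Rle_trans _ _ _ H2 Hw)).
      destruct w, c; simpl in *. lra.
    - intros w Hw. exists (Cmod (w - c)%C - r). split; [lra|]. intros u Hu Hu'.
      pose proof (Cmod_tri w u c) as T. rewrite (Cmod_sub_comm w u) in T. lra.
    - intros w Hw e He. set (m := Cmod (g w)).
      assert (Pm : 0 <= m) by apply Cmod_ge_0.
      set (e1 := Rmin 1 (e / (2 * (2 * m + 1)))).
      assert (He1 : 0 < e1) by (apply Rmin_glb_lt; [lra|apply Rdiv_lt_0_compat; lra]).
      destruct (Hcont w Hw e1 He1) as [d [Hd H]].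
      set (d2 := Rmin 1 (e / (4 * eps * (2 * r + 1)))).
      assert (Hd2 : 0 < d2).
      { apply Rmin_glb_lt; [lra|apply Rdiv_lt_0_compat; [lra|]]. apply Rmult_lt_0_compat; lra. }
      exists (Rmin d d2). split; [apply Rmin_glb_lt; assumption|].
      intros u Hu Huw. assert (U1 := Rlt_le_trans _ _ _ Huw (Rmin_l _ _)).
      assert (U2 := Rlt_le_trans _ _ _ Huw (Rmin_r _ _)). specialize (H u U1).
      pose proof (Cmod_sub_le (g u) (g w)) as T1. fold m in T1.
      pose proof (Cmod_tri u w c) as T2.
      assert (A1 : Cmod (g u) ^ 2 <= m ^ 2 + e / 2).
      { assert (B1 : e1 <= 1) by apply Rmin_l.
        assert (B2 : e1 * (2 * m + 1) <= e / 2).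
        { apply Rle_trans with (e / (2 * (2 * m + 1)) * (2 * m + 1)).
          - apply Rmult_le_compat_r; [lra|apply Rmin_r].
          - right. field. lra. }
        pose proof (Cmod_ge_0 (g u)). apply Rle_trans with ((m + e1) ^ 2); [|nra].
        apply pow_incr. lra. }
      assert (A2 : eps * Cmod (u - c)%C ^ 2 <= eps * Cmod (w - c)%C ^ 2 + e / 4).
      { assert (B1 : d2 <= 1) by apply Rmin_l.
        assert (B2 : eps * (d2 * (2 * r + 1)) <= e / 4).
        { apply Rle_trans with (eps * (e / (4 * eps * (2 * r + 1)) * (2 * r + 1))).
          - apply Rmult_le_compat_l; [lra|]. apply Rmult_le_compat_r; [lra|apply Rmin_r].
          - right. field. lra. }
        pose proof (Cmod_ge_0 (u - c)%C). pose proof (Cmod_ge_0 (w - c)%C).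
        assert (Cmod (u - c)%C ^ 2 <= Cmod (w - c)%C ^ 2 + d2 * (2 * r + 1)).
        { apply Rle_trans with ((Cmod (w - c)%C + d2) ^ 2); [apply pow_incr; lra|nra]. }
        nra. }
      unfold psi. fold m. lra.
    - exists c. rewrite Cmod_sub_self. lra.
    - assert (Hpz : psi z <= psi z0) by (apply Hmax, Hz).
      assert (Hz0r : Cmod (z0 - c)%C = r).
      { apply NNPP. intros Hne. assert (Hlt : Cmod (z0 - c)%C < r) by lra.
        destruct (Hhol z0 Hlt) as [e [He Hd]].
        set (e0 := Rmin e (r - Cmod (z0 - c)%C)).
        assert (He0 : 0 < e0) by (apply Rmin_glb_lt; lra).
        set (rho := e0 / 2).
        set (A := g z0). set (b := (z0 - c)%C).
        set (q := fun w => (Cconj A * g w - Cconj A * A + RtoC eps * Cconj b * (w - z0) + RtoC (eps * rho ^ 2 / 2))%C).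
        assert (Q : Re (q z0) <= 0).
        { apply (Re_mean_nonpos q z0 e0 rho).
          - unfold rho. lra.
          - intros w Hw. destruct (Hd w) as [l Hl].
            { split; [lra|]. apply Rlt_le_trans with (1 := proj2 Hw), Rmin_l. }
            unfold q. eexists.
            apply (cder_plus (fun w => Cconj A * g w - Cconj A * A + RtoC eps * Cconj b * (w - z0))%C (fun _ => RtoC (eps * rho ^ 2 / 2))); [|apply cder_const].
            apply (cder_plus (fun w => Cconj A * g w - Cconj A * A)%C (fun w => RtoC eps * Cconj b * (w - z0))%C).
            + apply (cder_minus (fun w => Cconj A * g w)%C (fun _ => Cconj A * A)%C); [|apply cder_const].
              apply (cder_mult (fun _ => Cconj A) g); [apply cder_const|exact Hl].
            + apply (cder_mult (fun _ => RtoC eps * Cconj b)%C (fun w => w - z0)%C); [apply cder_const|].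
              apply (cder_minus (fun w => w) (fun _ => z0)); [apply cder_id|apply cder_const].
          - intros e1 He1.
            set (k1 := Cmod A + 1). set (k2 := eps * Cmod b + 1).
            assert (Hk1 : 0 < k1) by (unfold k1; pose proof (Cmod_ge_0 A); lra).
            assert (Hk2 : 0 < k2) by (unfold k2; pose proof (Cmod_ge_0 b); nra).
            destruct (Hcont z0 Hz0 (e1 / 2 / k1)) as [d1 [Hd1 H1]]; [apply Rdiv_lt_0_compat; lra|].
            exists (Rmin d1 (e1 / 2 / k2)). split; [apply Rmin_glb_lt; [lra|apply Rdiv_lt_0_compat; lra]|].
            intros w Hw. assert (U1 := Rlt_le_trans _ _ _ Hw (Rmin_l _ _)).
            assert (U2 := Rlt_le_trans _ _ _ Hw (Rmin_r _ _)). specialize (H1 w U1).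
            replace (q w - q z0)%C with (Cconj A * (g w - g z0) + RtoC eps * Cconj b * (w - z0))%C by (unfold q; ring).
            eapply Rle_lt_trans; [apply Cmod_triangle|].
            rewrite !Cmod_mult, !Cmod_conj, Cmod_R, Rabs_pos_eq by lra.
            replace e1 with (k1 * (e1 / 2 / k1) + k2 * (e1 / 2 / k2)) by (field; lra).
            apply Rplus_lt_compat.
            + apply Rle_lt_trans with (k1 * Cmod (g w - g z0)%C).
              * apply Rmult_le_compat_r; [apply Cmod_ge_0|unfold k1; lra].
              * apply Rmult_lt_compat_l; lra.
            + apply Rle_lt_trans with (k2 * Cmod (w - z0)%C).
              * apply Rmult_le_compat_r; [apply Cmod_ge_0|unfold k2; lra].
              * apply Rmult_lt_compat_l; lra.
          - intros w Hw.
            assert (Hwr : Cmod (w - c)%C <= r).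
            { pose proof (Cmod_tri w z0 c). assert (e0 <= r - Cmod (z0 - c)%C) by apply Rmin_r. unfold rho in Hw. lra. }
            specialize (Hmax w Hwr). unfold psi in Hmax.
            rewrite !Cmod2_alt in Hmax.
            assert (Hw2 : Cmod (w - z0)%C ^ 2 = rho ^ 2) by (rewrite Hw; reflexivity).
            rewrite Cmod2_alt in Hw2. fold A in Hmax. unfold q.
            assert (Hb : (w - c)%C = (w - z0 + b)%C) by (unfold b; ring).
            rewrite Hb in Hmax. fold b in Hmax.
            set (h := (w - z0)%C) in *. set (G := g w) in *. rewrite <- Hw2.
            (* Expanding the squares turns [Hmax] into [2 * Re (q w) + Cmod (G - A) ^ 2 <= 0], where
               [rho ^ 2] in [q] has been replaced by [Cmod h ^ 2]. *)
            clearbody A b h G. clear - Hmax Heps.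
            destruct A as [a1 a2], b as [b1 b2], h as [h1 h2], G as [g1 g2]. simpl in *.
            pose proof (pow2_ge_0 (g1 - a1)). pose proof (pow2_ge_0 (g2 - a2)). lra. }
        assert (E : Re (q z0) = eps * rho ^ 2 / 2).
        { unfold q. replace (Cconj A * g z0 - Cconj A * A + RtoC eps * Cconj b * (z0 - z0) + RtoC (eps * rho ^ 2 / 2))%C with (RtoC (eps * rho ^ 2 / 2)) by (unfold A; ring). reflexivity. }
        rewrite E in Q. assert (0 < rho) by (unfold rho; lra).
        assert (0 < eps * rho ^ 2) by (apply Rmult_lt_0_compat; [lra|apply pow_lt; lra]). lra. }
      specialize (HM z0 Hz0r). unfold psi in Hpz. rewrite Hz0r in Hpz.
      assert (Cmod (g z0) ^ 2 <= M ^ 2) by (apply pow_incr; split; [apply Cmod_ge_0|exact HM]).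
      assert (0 <= eps * Cmod (z - c)%C ^ 2) by (apply Rmult_le_pos; [lra|apply pow2_ge_0]). lra. }
  apply Rnot_lt_le. intros L.
  assert (Hd : 0 < Cmod (g z) ^ 2 - M ^ 2) by nra.
  assert (Hr2 : 0 < r ^ 2) by (apply pow_lt; lra).
  specialize (Key ((Cmod (g z) ^ 2 - M ^ 2) / (2 * r ^ 2))).
  assert (0 < (Cmod (g z) ^ 2 - M ^ 2) / (2 * r ^ 2)) by (apply Rdiv_lt_0_compat; lra).
  specialize (Key H).
  replace ((Cmod (g z) ^ 2 - M ^ 2) / (2 * r ^ 2) * r ^ 2) with ((Cmod (g z) ^ 2 - M ^ 2) / 2) in Key
    by (field; lra). lra.
Qed.

Lemma pcont_ext (f g : C -> C) (z : C) (d : R) :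
  0 < d -> (forall w, Cmod (w - z)%C < d -> f w = g w) -> pcont f z -> pcont g z.
Proof.
  intros Hd He Hf eps Heps. destruct (Hf eps Heps) as [d' [Hd' H]].
  exists (Rmin d d'). split; [apply Rmin_glb_lt; assumption|].
  intros w Hw. rewrite <- !He.
  - apply H. apply Rlt_le_trans with (1 := Hw), Rmin_r.
  - rewrite Cmod_sub_self. exact Hd.
  - apply Rlt_le_trans with (1 := Hw), Rmin_l.
Qed.

Lemma bernoulli (x : R) (k : nat) : 0 <= x -> 1 + INR k * x <= (1 + x) ^ k.
Proof.
  intros Hx. induction k as [|k IH]; [simpl; lra|]. rewrite S_INR. simpl.
  pose proof (pos_INR k). assert (0 <= INR k * x) by (apply Rmult_le_pos; assumption). nra.
Qed.

Lemma cder_pow (f : C -> C) (z l : C) (n : nat) : cder f z l -> exists l', cder (fun w => f w ^ n)%C z l'.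
Proof.
  intros H. induction n as [|n [l' IH]].
  - exists 0%C. apply (cder_const 1%C).
  - eexists. apply (cder_mult f (fun w => f w ^ n)%C); [exact H|exact IH].
Qed.

Lemma pcont_mult (f1 f2 : C -> C) (z : C) : pcont f1 z -> pcont f2 z -> pcont (fun u => f1 u * f2 u)%C z.
Proof.
  intros P1 P2 eps Heps.
  set (m1 := Cmod (f1 z) + 1). set (m2 := Cmod (f2 z) + 1).
  assert (0 < m1) by (unfold m1; pose proof (Cmod_ge_0 (f1 z)); lra).
  assert (0 < m2) by (unfold m2; pose proof (Cmod_ge_0 (f2 z)); lra).
  destruct (P1 (eps / 2 / m2)) as [d1 [Hd1 Q1]]; [apply Rdiv_lt_0_compat; lra|].
  destruct (P2 (Rmin 1 (eps / 2 / m1))) as [d2 [Hd2 Q2]].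
  { apply Rmin_glb_lt; [lra|apply Rdiv_lt_0_compat; lra]. }
  exists (Rmin d1 d2). split; [apply Rmin_glb_lt; assumption|].
  intros u Hu. specialize (Q1 u (Rlt_le_trans _ _ _ Hu (Rmin_l _ _))).
  specialize (Q2 u (Rlt_le_trans _ _ _ Hu (Rmin_r _ _))).
  replace (f1 u * f2 u - f1 z * f2 z)%C with ((f1 u - f1 z) * f2 u + f1 z * (f2 u - f2 z))%C by ring.
  eapply Rle_lt_trans; [apply Cmod_triangle|]. rewrite !Cmod_mult.
  assert (Q2a := Rlt_le_trans _ _ _ Q2 (Rmin_l _ _)). assert (Q2b := Rlt_le_trans _ _ _ Q2 (Rmin_r _ _)).
  assert (B2 : Cmod (f2 u) <= m2) by (pose proof (Cmod_sub_le (f2 u) (f2 z)); unfold m2; lra).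
  replace eps with (eps / 2 / m2 * m2 + m1 * (eps / 2 / m1)) by (field; lra).
  apply Rplus_lt_le_compat.
  - apply Rle_lt_trans with (Cmod (f1 u - f1 z)%C * m2).
    + apply Rmult_le_compat_l; [apply Cmod_ge_0|exact B2].
    + apply Rmult_lt_compat_r; lra.
  - apply Rmult_le_compat; try apply Cmod_ge_0; [unfold m1|]; lra.
Qed.

(* Apply the maximum principle to [g ^ k * (z - c)], which vanishes at [c], and let [k] grow. *)
Lemma max_principle_punctured (g : C -> C) (c : C) (r M B : R) : 0 < r ->
  (forall z, 0 < Cmod (z - c)%C <= r -> pcont g z) ->
  (forall z, 0 < Cmod (z - c)%C < r -> exists e, 0 < e /\ forall w, 0 < Cmod (w - z)%C < e -> exists l, cder g w l) ->
  (exists e, 0 < e /\ forall w, 0 < Cmod (w - c)%C < e -> (exists l, cder g w l) /\ Cmod (g w) <= B) ->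
  (forall z, Cmod (z - c)%C = r -> Cmod (g z) <= M) ->
  forall z, 0 < Cmod (z - c)%C <= r -> Cmod (g z) <= M.
Proof.
  intros Hr Hcont Hhol [e0 [He0 HB]] HM z Hz.
  assert (HM0 : 0 <= M).
  { eapply Rle_trans; [apply Cmod_ge_0|apply (HM (c + RtoC r)%C)].
    replace (c + RtoC r - c)%C with (RtoC r) by ring. rewrite Cmod_R. apply Rabs_pos_eq. lra. }
  assert (Key : forall k, Cmod (g z) ^ k * Cmod (z - c)%C <= M ^ k * r).
  { intros k.
    set (h := fun w => (g w ^ k * (w - c))%C).
    (* The value [0] at [c] makes [h0] continuous there, since [g] is bounded near [c] and [w - c]
       tends to [0]. *)
    set (h0 := fun w => if excluded_middle_informative (w = c) then RtoC 0 else h w).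
    assert (H0 : forall w, 0 < Cmod (w - c)%C -> h0 w = h w).
    { intros w Hw. unfold h0. destruct (excluded_middle_informative (w = c)) as [->|N]; [|reflexivity].
      rewrite Cmod_sub_self in Hw. lra. }
    assert (Hc0 : h0 c = 0%C).
    { unfold h0. destruct (excluded_middle_informative (c = c)) as [_|N]; [reflexivity|destruct N; reflexivity]. }
    assert (Nb : forall w, 0 < Cmod (w - c)%C -> forall u, Cmod (u - w)%C < Cmod (w - c)%C -> h u = h0 u).
    { intros w Hw u Hu. symmetry. apply H0. pose proof (Cmod_tri w u c). rewrite (Cmod_sub_comm w u) in H. lra. }
    assert (Hder : forall w, 0 < Cmod (w - c)%C -> (exists l, cder g w l) -> exists l, cder h0 w l).
    { intros w Hw [l Hl]. destruct (cder_pow g w l k Hl) as [l' Hl'].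
      eexists. apply cder_ext_loc with (f := h) (d := Cmod (w - c)%C); [exact Hw|apply Nb, Hw|].
      apply (cder_mult (fun w => g w ^ k)%C (fun w => w - c)%C); [exact Hl'|].
      apply (cder_minus (fun w => w) (fun _ => c)); [apply cder_id|apply cder_const]. }
    assert (E : Cmod (h0 z) <= M ^ k * r).
    { apply (max_principle h0 c r); [exact Hr| | | |lra].
      - intros w Hw. destruct (Rle_lt_or_eq_dec _ _ (Cmod_ge_0 (w - c)%C)) as [L|L].
        + destruct (Hcont w (conj L Hw) 1 Rlt_0_1) as [_ _].
          apply pcont_ext with (f := h) (d := Cmod (w - c)%C); [exact L|apply Nb, L|].
          assert (PC : forall n, pcont (fun u => g u ^ n * (u - c))%C w).
          { intros n. apply pcont_mult.
            - induction n as [|n IH].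
              + exact (cder_pcont _ w _ (cder_const 1%C w)).
              + apply (pcont_mult g (fun u => g u ^ n)%C); [apply Hcont; lra|exact IH].
            - apply cder_pcont with (1 - 0)%C.
              apply (cder_minus (fun w => w) (fun _ => c)); [apply cder_id|apply cder_const]. }
          apply PC.
        + assert (Ew : w = c).
          { symmetry in L. apply Cmod_eq_0 in L. replace w with (w - c + c)%C by ring. rewrite L. ring. }
          subst w. intros eps Heps.
          set (b := Rabs B ^ k + 1). assert (Hb : 0 < b).
          { unfold b. pose proof (pow_le (Rabs B) k (Rabs_pos B)). lra. }
          exists (Rmin e0 (eps / b)). split; [apply Rmin_glb_lt; [lra|apply Rdiv_lt_0_compat; lra]|].
          intros w Hw2. rewrite Hc0.
          destruct (Rle_lt_or_eq_dec _ _ (Cmod_ge_0 (w - c)%C)) as [L'|L'].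
          * rewrite H0 by exact L'. unfold h. replace (g w ^ k * (w - c) - 0)%C with (g w ^ k * (w - c))%C by ring.
            rewrite Cmod_mult, Cmod_pow.
            destruct (HB w) as [_ HBw]; [split; [exact L'|apply Rlt_le_trans with (1 := Hw2), Rmin_l]|].
            apply Rle_lt_trans with (b * Cmod (w - c)%C).
            -- apply Rmult_le_compat_r; [lra|]. apply Rle_trans with (Rabs B ^ k); [|unfold b; lra].
               apply pow_incr. split; [apply Cmod_ge_0|]. eapply Rle_trans; [exact HBw|apply Rle_abs].
            -- replace eps with (b * (eps / b)) by (field; lra). apply Rmult_lt_compat_l; [lra|].
               apply Rlt_le_trans with (1 := Hw2), Rmin_r.
          * unfold h0. destruct (excluded_middle_informative (w = c)) as [_|N].
            -- rewrite Cmod_sub_self. exact Heps.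
            -- destruct N. symmetry in L'. apply Cmod_eq_0 in L'. replace w with (w - c + c)%C by ring. rewrite L'. ring.
      - intros w Hw. destruct (Rle_lt_or_eq_dec _ _ (Cmod_ge_0 (w - c)%C)) as [L'|L'].
        + destruct (Hhol w (conj L' Hw)) as [e [He H]].
          exists (Rmin e (Cmod (w - c)%C)). split; [apply Rmin_glb_lt; assumption|].
          intros u Hu. apply Hder.
          * pose proof (Cmod_tri w u c). rewrite (Cmod_sub_comm w u) in H1.
            assert (Cmod (u - w)%C < Cmod (w - c)%C) by (apply Rlt_le_trans with (1 := proj2 Hu), Rmin_r). lra.
          * apply H. split; [lra|]. apply Rlt_le_trans with (1 := proj2 Hu), Rmin_l.
        + assert (Ew : w = c).
          { symmetry in L'. apply Cmod_eq_0 in L'. replace w with (w - c + c)%C by ring. rewrite L'. ring. }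
          subst w. exists e0. split; [exact He0|]. intros u Hu. apply Hder; [lra|]. apply HB, Hu.
      - intros w Hw. rewrite H0 by lra. unfold h. rewrite Cmod_mult, Hw, Cmod_pow.
        apply Rmult_le_compat_r; [lra|]. apply pow_incr. split; [apply Cmod_ge_0|apply HM, Hw]. }
    rewrite H0 in E by lra. unfold h in E. rewrite Cmod_mult, Cmod_pow in E. exact E. }
  apply Rnot_lt_le. intros L.
  set (m := Cmod (g z)) in *. set (dd := Cmod (z - c)%C) in *.
  (* The midpoint replaces [M] because it is positive even for [M = 0]; by Bernoulli's inequality
     [(m / M1) ^ k] exceeds [r / dd] for large [k]. *)
  set (M1 := (M + m) / 2). assert (HM1 : 0 < M1 < m) by (unfold M1; lra).
  set (x := m / M1 - 1). assert (Hx : 0 < x).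
  { unfold x. assert (1 < m / M1); [|lra]. apply Rmult_lt_reg_r with M1; [lra|].
    unfold Rdiv. rewrite Rmult_assoc, Rinv_l by lra. lra. }
  destruct (INR_unbounded (r / dd / x)) as [k Hk].
  assert (Hxk : r / dd < INR k * x).
  { apply Rmult_lt_compat_r with (r := x) in Hk; [|lra]. replace (r / dd / x * x) with (r / dd) in Hk by (field; lra). lra. }
  pose proof (bernoulli x k (Rlt_le _ _ Hx)) as Hb.
  assert (Em : m ^ k = M1 ^ k * (1 + x) ^ k).
  { rewrite <- Rpow_mult_distr. f_equal. unfold x. field. lra. }
  specialize (Key k). rewrite Em in Key.
  assert (PM : 0 < M1 ^ k) by (apply pow_lt; lra).
  assert (PMk : M ^ k <= M1 ^ k) by (apply pow_incr; unfold M1; lra).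
  assert (K1 : M1 ^ k * (1 + x) ^ k * dd <= M1 ^ k * r).
  { eapply Rle_trans; [exact Key|]. apply Rmult_le_compat_r; lra. }
  assert (K2 : (1 + x) ^ k * dd <= r) by (apply Rmult_le_reg_l with (M1 ^ k); [exact PM|lra]).
  assert (K3 : r / dd * dd < (1 + x) ^ k * dd) by (apply Rmult_lt_compat_r; lra).
  replace (r / dd * dd) with r in K3 by (field; lra). lra.
Qed.

(** With [l] the derivative at [b], the quotient is continuous at [b] and differentiable wherever
    else [g] is, which is the regularity that [max_principle] asks for. Bounds on a circle thus
    become Lipschitz bounds without an estimate of derivatives. *)
Definition dquot (g : C -> C) (b l : C) (z : C) : C :=
  if excluded_middle_informative (z = b) then l else ((g z - g b) / (z - b))%C.

Lemma Csub_neq0 (z b : C) : z <> b -> (z - b)%C <> 0%C.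
Proof. intros H E. apply H. replace z with (z - b + b)%C by ring. rewrite E. ring. Qed.

Lemma Cmod_sub_pos (z b : C) : z <> b <-> 0 < Cmod (z - b)%C.
Proof.
  split; intros H.
  - apply Cmod_gt_0, Csub_neq0, H.
  - intros ->. rewrite Cmod_sub_self in H. lra.
Qed.

Lemma dquot_eq (g : C -> C) (b l z : C) : z <> b -> dquot g b l z = ((g z - g b) / (z - b))%C.
Proof. intros H. unfold dquot. destruct (excluded_middle_informative (z = b)); [contradiction|reflexivity]. Qed.

Lemma dquot_mult (g : C -> C) (b l z : C) : (g z - g b)%C = (dquot g b l z * (z - b))%C.
Proof.
  unfold dquot. destruct (excluded_middle_informative (z = b)) as [->|N]; [ring|].
  field. apply Csub_neq0, N.
Qed.

Lemma dquot_cder (g : C -> C) (b l z l' : C) : z <> b -> cder g z l' -> exists k, cder (dquot g b l) z k.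
Proof.
  intros N H. assert (L := proj1 (Cmod_sub_pos z b) N).
  destruct (cder_div (fun w => g w - g b)%C (fun w => w - b)%C z (l' - 0)%C (1 - 0)%C) as [k Hk].
  - apply (cder_minus g (fun _ => g b)); [exact H|apply cder_const].
  - apply (cder_minus (fun w => w) (fun _ => b)); [apply cder_id|apply cder_const].
  - apply Csub_neq0, N.
  - exists k. apply cder_ext_loc with (f := fun w => ((g w - g b) / (w - b))%C) (d := Cmod (z - b)%C);
      [exact L| |exact Hk].
    intros w Hw. symmetry. apply dquot_eq, Cmod_sub_pos.
    pose proof (Cmod_tri z w b) as T. rewrite (Cmod_sub_comm z w) in T. lra.
Qed.

Lemma dquot_pcont (g : C -> C) (b l : C) : cder g b l -> pcont (dquot g b l) b.
Proof.
  intros H eps Heps. destruct (H (eps / 2)) as [d [Hd H1]]; [lra|].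
  exists d. split; [exact Hd|]. intros w Hw.
  assert (Eb : dquot g b l b = l).
  { unfold dquot. destruct (excluded_middle_informative (b = b)) as [_|N]; [reflexivity|destruct N; reflexivity]. }
  rewrite Eb. destruct (classic (w = b)) as [->|N].
  - rewrite Eb, Cmod_sub_self. exact Heps.
  - specialize (H1 w Hw). rewrite (dquot_mult g b l) in H1.
    replace (dquot g b l w * (w - b) - l * (w - b))%C with ((dquot g b l w - l) * (w - b))%C in H1 by ring.
    rewrite Cmod_mult in H1. apply Cmod_sub_pos in N.
    assert (Cmod (dquot g b l w - l)%C <= eps / 2) by (apply Rmult_le_reg_r with (Cmod (w - b)%C); lra). lra.
Qed.

Lemma dquot_bound (g : C -> C) (b l z : C) (M d : R) : 0 < d -> d <= Cmod (z - b)%C ->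
  Cmod (g z) <= M -> Cmod (g b) <= M -> Cmod (dquot g b l z) <= 2 * M / d.
Proof.
  intros Hd Hz H1 H2. assert (N : z <> b) by (apply Cmod_sub_pos; lra).
  rewrite dquot_eq, Cmod_div by (try apply Csub_neq0; exact N).
  pose proof (Cmod_minus_le (g z) (g b)). pose proof (Cmod_ge_0 (g z - g b)%C).
  apply Rmult_le_compat; [lra| |lra|].
  - left. apply Rinv_0_lt_compat. lra.
  - apply Rinv_le_contravar; lra.
Qed.

(** Cauchy's estimate without derivatives: points of the circle of radius [3 * r / 4] are at least
    [r / 4] away from [b], so the difference quotient is at most [2 * M / (r / 4)] there, and hence
    also at [a]. *)
Lemma holomorphic_lipschitz (g : C -> C) (c : C) (r M : R) : 0 < r ->
  (forall z, Cmod (z - c)%C < r -> exists l, cder g z l) ->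
  (forall z, Cmod (z - c)%C < r -> Cmod (g z) <= M) ->
  forall a b, Cmod (a - c)%C <= r / 2 -> Cmod (b - c)%C <= r / 2 ->
    Cmod (g a - g b)%C <= 8 * M / r * Cmod (a - b)%C.
Proof.
  intros Hr Hg HM a b Ha Hb. destruct (Hg b ltac:(lra)) as [l Hl].
  assert (Q : Cmod (dquot g b l a) <= 2 * M / (r / 4)).
  { apply (max_principle (dquot g b l) c (3 * r / 4)); [lra| | | |lra].
    - intros z Hz. destruct (classic (z = b)) as [->|N].
      + apply dquot_pcont, Hl.
      + destruct (Hg z ltac:(lra)) as [lz Hlz]. destruct (dquot_cder g b l z lz N Hlz) as [k Hk].
        exact (cder_pcont _ _ _ Hk).
    - intros z Hz. set (e := r - Cmod (z - c)%C).
      destruct (classic (z = b)) as [->|N].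
      + exists e. split; [unfold e; lra|]. intros w Hw. destruct (Hg w) as [lw Hlw].
        * pose proof (Cmod_tri w b c). unfold e in Hw. lra.
        * apply dquot_cder with lw; [apply Cmod_sub_pos; lra|exact Hlw].
      + apply Cmod_sub_pos in N. exists (Rmin e (Cmod (z - b)%C)). split; [apply Rmin_glb_lt; unfold e; lra|].
        intros w [Hw0 Hw]. assert (W1 := Rlt_le_trans _ _ _ Hw (Rmin_l _ _)).
        assert (W2 := Rlt_le_trans _ _ _ Hw (Rmin_r _ _)). destruct (Hg w) as [lw Hlw].
        * pose proof (Cmod_tri w z c). unfold e in W1. lra.
        * apply dquot_cder with lw; [|exact Hlw]. apply Cmod_sub_pos.
          pose proof (Cmod_tri z w b). rewrite (Cmod_sub_comm z w) in H. lra.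
    - intros z Hz. apply dquot_bound; try lra; [|apply HM; lra|apply HM; lra].
      pose proof (Cmod_tri z b c). lra. }
  rewrite (dquot_mult g b l), Cmod_mult. apply Rmult_le_compat_r; [apply Cmod_ge_0|].
  replace (8 * M / r) with (2 * M / (r / 4)) by (field; lra). exact Q.
Qed.

Lemma geometric_limit_R (u : nat -> R) (A : R) : 0 <= A ->
  (forall n, Rabs (u (S n) - u n) <= A / 2 ^ n) ->
  exists l, forall n, Rabs (l - u n) <= 2 * A / 2 ^ n.
Proof.
  intros HA H.
  assert (P : forall n, 0 < 2 ^ n) by (intros; apply pow_lt; lra).
  assert (E : forall n, 2 * A / 2 ^ S n = A / 2 ^ n) by (intros n; simpl; field; specialize (P n); lra).
  assert (E2 : forall n, 2 * A / 2 ^ n = A / 2 ^ n + A / 2 ^ n) by (intros n; field; specialize (P n); lra).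
  destruct (monotone_nested (fun n => u n - 2 * A / 2 ^ n) (fun n => u n + 2 * A / 2 ^ n)) as [l Hl].
  - intros n. specialize (H n). apply abs_le_between in H. rewrite E, E2. lra.
  - intros n. specialize (H n). apply abs_le_between in H. rewrite E, E2. lra.
  - intros n. specialize (P n). assert (0 <= 2 * A / 2 ^ n); [|lra].
    apply Rmult_le_pos; [lra|left; apply Rinv_0_lt_compat, P].
  - exists l. intros n. specialize (Hl n). apply Rabs_le. lra.
Qed.

Lemma geometric_limit (u : nat -> C) (A : R) : 0 <= A ->
  (forall n, Cmod (u (S n) - u n)%C <= A / 2 ^ n) ->
  exists l, forall n, Cmod (l - u n)%C <= 4 * A / 2 ^ n.
Proof.
  intros HA H.
  destruct (geometric_limit_R (fun n => Re (u n)) A HA) as [x Hx].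
  { intros n. eapply Rle_trans; [|apply H]. apply (re_le_Cmod (u (S n) - u n)%C). }
  destruct (geometric_limit_R (fun n => Im (u n)) A HA) as [y Hy].
  { intros n. eapply Rle_trans; [|apply H]. apply (Im_le_Cmod (u (S n) - u n)%C). }
  exists ((x, y) : C). intros n. eapply Rle_trans; [apply Cmod_le_abs|].
  replace (4 * A / 2 ^ n) with (2 * A / 2 ^ n + 2 * A / 2 ^ n) by (field; apply pow_nonzero; lra).
  apply Rplus_le_compat; [apply Hx|apply Hy].
Qed.

Lemma half_pow_lim (A x : R) : 0 <= A -> (forall n : nat, x <= A / 2 ^ n) -> x <= 0.
Proof.
  intros HA H. apply Rnot_lt_le. intros L. destruct (half_pow_small A x L) as [n Hn].
  specialize (H n). lra.
Qed.

(** The difference quotients at base points [b] near [p] are at most [2 * M / (r / 2)] on the circle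
    of radius [r], and the punctured maximum principle carries this inward. So [h] is Lipschitz off
    [p] with a constant independent of [b], and a limit [l] is approached at a linear rate. *)
Lemma removable_singularity (h : C -> C) (p : C) (r M : R) : 0 < r ->
  (forall z, 0 < Cmod (z - p)%C < 2 * r -> exists l, cder h z l) ->
  (forall z, 0 < Cmod (z - p)%C < 2 * r -> Cmod (h z) <= M) ->
  exists l, forall z, 0 < Cmod (z - p)%C <= r / 2 -> Cmod (h z - l)%C <= 4 * M / r * Cmod (z - p)%C.
Proof.
  intros Hr Hh HM.
  assert (L : forall z b, 0 < Cmod (z - p)%C <= r / 2 -> 0 < Cmod (b - p)%C <= r / 2 ->
    Cmod (h z - h b)%C <= 4 * M / r * Cmod (z - b)%C).
  { intros z b Hz Hb. destruct (Hh b ltac:(lra)) as [l Hl].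
    assert (Q : Cmod (dquot h b l z) <= 2 * M / (r / 2)).
    { apply (max_principle_punctured (dquot h b l) p r _ (2 * M / (Cmod (b - p)%C / 2))); [lra| | | | |lra].
      - intros w Hw. destruct (classic (w = b)) as [->|N].
        + apply dquot_pcont, Hl.
        + destruct (Hh w ltac:(lra)) as [lz Hlz]. destruct (dquot_cder h b l w lz N Hlz) as [k Hk].
          exact (cder_pcont _ _ _ Hk).
      - intros w Hw.
        assert (X : exists e, 0 < e /\ forall u, 0 < Cmod (u - w)%C < e -> u <> b).
        { destruct (classic (w = b)) as [->|N].
          - exists 1. split; [lra|]. intros u Hu. apply Cmod_sub_pos; lra.
          - apply Cmod_sub_pos in N. exists (Cmod (w - b)%C). split; [exact N|]. intros u Hu ->.
            rewrite (Cmod_sub_comm w b) in Hu. lra. }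
        destruct X as [e [He X]].
        exists (Rmin e (Rmin (Cmod (w - p)%C) r)). split; [repeat apply Rmin_glb_lt; lra|].
        intros u [Hu0 Hu]. assert (U1 := Rlt_le_trans _ _ _ Hu (Rmin_l _ _)).
        assert (U2 := Rlt_le_trans _ _ _ Hu (Rmin_r _ _)).
        assert (U3 := Rlt_le_trans _ _ _ U2 (Rmin_l _ _)). assert (U4 := Rlt_le_trans _ _ _ U2 (Rmin_r _ _)).
        destruct (Hh u) as [lu Hlu].
        + pose proof (Cmod_tri w u p). rewrite (Cmod_sub_comm w u) in H. pose proof (Cmod_tri u w p). lra.
        + apply dquot_cder with lu; [apply X; lra|exact Hlu].
      - exists (Cmod (b - p)%C / 2). split; [lra|]. intros w Hw.
        assert (D : Cmod (b - p)%C / 2 <= Cmod (w - b)%C).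
        { pose proof (Cmod_tri b w p). rewrite (Cmod_sub_comm b w) in H. lra. }
        split.
        + destruct (Hh w ltac:(lra)) as [lu Hlu]. apply dquot_cder with lu; [|exact Hlu]. apply Cmod_sub_pos. lra.
        + apply dquot_bound; [lra|exact D|apply HM; lra|apply HM; lra].
      - intros w Hw. apply dquot_bound; [lra| |apply HM; lra|apply HM; lra].
        pose proof (Cmod_tri w b p). lra. }
    rewrite (dquot_mult h b l), Cmod_mult. apply Rmult_le_compat_r; [apply Cmod_ge_0|].
    replace (4 * M / r) with (2 * M / (r / 2)) by (field; lra). exact Q. }
  assert (HM0 : 0 <= M).
  { eapply Rle_trans; [apply Cmod_ge_0|]. apply (HM (p + RtoC r)%C).
    replace (p + RtoC r - p)%C with (RtoC r) by ring. rewrite Cmod_R, Rabs_pos_eq; lra. }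
  set (b := fun n : nat => (p + RtoC (r / 2 / 2 ^ n))%C).
  assert (P2 : forall n, 1 <= 2 ^ n) by (intros; apply pow_R1_Rle; lra).
  assert (Hb : forall n, Cmod (b n - p)%C = r / 2 / 2 ^ n).
  { intros n. unfold b. replace (p + RtoC (r / 2 / 2 ^ n) - p)%C with (RtoC (r / 2 / 2 ^ n)) by ring.
    rewrite Cmod_R, Rabs_pos_eq; [reflexivity|]. specialize (P2 n). left. apply Rdiv_lt_0_compat; lra. }
  assert (Hb2 : forall n, 0 < Cmod (b n - p)%C <= r / 2).
  { intros n. rewrite Hb. specialize (P2 n). split; [apply Rdiv_lt_0_compat; lra|].
    apply Rmult_le_reg_r with (2 ^ n); [lra|]. unfold Rdiv at 1. rewrite Rmult_assoc, Rinv_l by lra. nra. }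
  set (k := 4 * M / r). assert (Hk : 0 <= k) by (apply Rmult_le_pos; [lra|left; apply Rinv_0_lt_compat; lra]).
  destruct (geometric_limit (fun n => h (b n)) (k * (r / 2))) as [l Hl].
  - apply Rmult_le_pos; lra.
  - intros n. eapply Rle_trans; [apply L; apply Hb2|]. fold k.
    replace (b (S n) - b n)%C with (- RtoC (r / 2 / 2 ^ n / 2))%C.
    + rewrite Cmod_opp, Cmod_R, Rabs_pos_eq.
      * specialize (P2 n). unfold Rdiv. rewrite !Rmult_assoc. apply Rmult_le_compat_l; [exact Hk|].
        apply Rmult_le_compat_l; [lra|]. apply Rmult_le_compat_l; [lra|].
        assert (0 < / 2 ^ n) by (apply Rinv_0_lt_compat; lra). lra.
      * specialize (P2 n). left. apply Rdiv_lt_0_compat; [apply Rdiv_lt_0_compat; lra|lra].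
    + unfold b. replace (r / 2 / 2 ^ S n) with (r / 2 / 2 ^ n - r / 2 / 2 ^ n / 2).
      * rewrite RtoC_minus. ring.
      * simpl. field. specialize (P2 n). lra.
  - exists l. intros z Hz. fold k.
    assert (Cmod (h z - l)%C - k * Cmod (z - p)%C <= 0); [|lra].
    apply (half_pow_lim (k * r / 2 + 4 * (k * (r / 2)))); [nra|].
    intros n. specialize (Hl n).
    pose proof (Cmod_tri (h z) (h (b n)) l) as T1. rewrite (Cmod_sub_comm (h (b n)) l) in T1.
    pose proof (L z (b n) Hz (Hb2 n)) as T2. fold k in T2.
    pose proof (Cmod_tri z p (b n)) as T3. rewrite (Cmod_sub_comm p (b n)), Hb in T3.
    assert (k * Cmod (z - b n)%C <= k * (Cmod (z - p)%C + r / 2 / 2 ^ n)) by (apply Rmult_le_compat_l; assumption).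
    replace ((k * r / 2 + 4 * (k * (r / 2))) / 2 ^ n) with (k * (r / 2 / 2 ^ n) + 4 * (k * (r / 2)) / 2 ^ n)
      by (field; specialize (P2 n); lra). lra.
Qed.

(** * Differential equations in complex time *)

Lemma hseg_swap (g : C -> C) (y a b : R) :
  (forall x, Rmin a b <= x <= Rmax a b -> exists l, cder g (x, y) l) -> hseg g y b a = (- hseg g y a b)%C.
Proof. intros H. unfold hseg, vseg. apply seg_swap. intros t Ht. rewrite horizontal_point. apply H, Ht. Qed.

Lemma vseg_swap (g : C -> C) (x a b : R) :
  (forall y, Rmin a b <= y <= Rmax a b -> exists l, cder g (x, y) l) -> vseg g x b a = (- vseg g x a b)%C.
Proof. intros H. unfold hseg, vseg. apply seg_swap. intros t Ht. rewrite vertical_point. apply H, Ht. Qed.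

Lemma goursat_unordered (g : C -> C) (a b c d : R) :
  (forall x y, Rmin a b <= x <= Rmax a b -> Rmin c d <= y <= Rmax c d -> exists l, cder g (x, y) l) ->
  bdry g a b c d = 0%C.
Proof.
  intros Hg.
  assert (Ha : Rmin a b <= a <= Rmax a b) by (split; [apply Rmin_l|apply Rmax_l]).
  assert (Hb : Rmin a b <= b <= Rmax a b) by (split; [apply Rmin_r|apply Rmax_r]).
  assert (Hc : Rmin c d <= c <= Rmax c d) by (split; [apply Rmin_l|apply Rmax_l]).
  assert (Hd : Rmin c d <= d <= Rmax c d) by (split; [apply Rmin_r|apply Rmax_r]).
  assert (S1 : forall y, Rmin c d <= y <= Rmax c d -> hseg g y b a = (- hseg g y a b)%C)
    by (intros; apply hseg_swap; intros; apply Hg; assumption).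
  assert (S2 : forall x, Rmin a b <= x <= Rmax a b -> vseg g x d c = (- vseg g x c d)%C)
    by (intros; apply vseg_swap; intros; apply Hg; assumption).
  assert (B : bdry g (Rmin a b) (Rmax a b) (Rmin c d) (Rmax c d) = 0%C).
  { apply goursat; [lra|lra|exact Hg]. }
  assert (K : bdry g a b c d = bdry g (Rmin a b) (Rmax a b) (Rmin c d) (Rmax c d) \/
     bdry g a b c d = (- bdry g (Rmin a b) (Rmax a b) (Rmin c d) (Rmax c d))%C).
  { destruct (Rle_lt_dec a b) as [L|L]; destruct (Rle_lt_dec c d) as [L'|L'];
    [rewrite (Rmin_left a b), (Rmax_right a b), (Rmin_left c d), (Rmax_right c d) by lra; left
    |rewrite (Rmin_left a b), (Rmax_right a b), (Rmin_right c d), (Rmax_left c d) by lra; right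
    |rewrite (Rmin_right a b), (Rmax_left a b), (Rmin_left c d), (Rmax_right c d) by lra; right
    |rewrite (Rmin_right a b), (Rmax_left a b), (Rmin_right c d), (Rmax_left c d) by lra; left];
    unfold bdry; rewrite ?S1, ?S2 by assumption; ring. }
  rewrite B in K. destruct K as [->| ->]; ring.
Qed.

(** Keeps integration paths that run horizontally from the centre and then vertically inside the
    disc. *)
Lemma disc_corner (c : C) (x y u v : R) (r : R) : Cmod ((x, y) - c)%C < r ->
  Rabs (u - Re c) <= Rabs (x - Re c) -> Rabs (v - Im c) <= Rabs (y - Im c) -> Cmod ((u, v) - c)%C < r.
Proof.
  intros H H1 H2. eapply Rle_lt_trans; [|exact H].
  destruct c as [a b]; simpl in *. unfold Cmod; simpl. apply sqrt_le_1_alt.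
  assert (E : forall z, z * (z * 1) = Rabs z * Rabs z) by (intros; rewrite <- Rabs_mult, Rabs_pos_eq; nra).
  rewrite !E. pose proof (Rabs_pos (u - a)). pose proof (Rabs_pos (v - b)).
  unfold Rminus in *. nra.
Qed.

Lemma between_abs (c x t : R) : Rmin c x <= t <= Rmax c x -> Rabs (t - c) <= Rabs (x - c).
Proof.
  intros H. destruct (Rle_lt_dec c x).
  - rewrite Rmin_left, Rmax_right in H by lra. rewrite !Rabs_pos_eq; lra.
  - rewrite Rmin_right, Rmax_left in H by lra. rewrite !Rabs_left1; lra.
Qed.

(** The primitive integrates from the centre first horizontally, then vertically. Goursat's lemma on
    the rectangle with sides [[x0, x]] and [[c2, y0]] reroutes the difference of two values along a
    horizontal and a vertical segment from [z0] to [z], where [g] is close to [g z0]. *)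
Lemma primitive_on_disc (g : C -> C) (c : C) (r : R) :
  (forall z, Cmod (z - c)%C < r -> exists l, cder g z l) ->
  exists G : C -> C, forall z, Cmod (z - c)%C < r -> cder G z (g z).
Proof.
  intros Hg. set (c1 := Re c). set (c2 := Im c).
  exists (fun z => hseg g c2 c1 (Re z) + vseg g (Re z) c2 (Im z))%C.
  intros z0 Hz0 eps Heps. destruct z0 as [x0 y0].
  destruct (Hg _ Hz0) as [l Hl].
  destruct (cder_cont g _ l Hl (eps / 2) ltac:(lra)) as [d [Hd Hcont]].
  set (e := r - Cmod ((x0, y0) - c)%C). assert (He : 0 < e) by (unfold e; lra).
  exists (Rmin (d / 2) (e / 2)). split; [apply Rmin_glb_lt; lra|].
  intros [x y] Hz.
  assert (Z1 := Rlt_le_trans _ _ _ Hz (Rmin_l _ _)). assert (Z2 := Rlt_le_trans _ _ _ Hz (Rmin_r _ _)).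
  assert (Hx : Rabs (x - x0) <= Cmod ((x, y) - (x0, y0))%C) by apply (re_le_Cmod ((x, y) - (x0, y0))%C).
  assert (Hy : Rabs (y - y0) <= Cmod ((x, y) - (x0, y0))%C) by apply (Im_le_Cmod ((x, y) - (x0, y0))%C).
  assert (Near : forall u v, Rabs (u - x0) <= Rabs (x - x0) -> Rabs (v - y0) <= Rabs (y - y0) ->
    Cmod ((u, v) - (x0, y0))%C < d /\ Cmod ((u, v) - c)%C < r).
  { intros u v Hu Hv. assert (B : Cmod ((u, v) - (x0, y0))%C <= Rabs (u - x0) + Rabs (v - y0)) by apply Cmod_le_abs.
    split; [lra|]. pose proof (Cmod_tri (u, v) (x0, y0) c). unfold e in *. lra. }
  assert (D1 : forall t, Rmin c1 x0 <= t <= Rmax c1 x0 -> exists l, cder g (t, c2) l).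
  { intros t Ht. apply Hg. apply disc_corner with x0 y0; [exact Hz0| |].
    - apply between_abs, Ht.
    - unfold c2. rewrite Rminus_diag, Rabs_R0. apply Rabs_pos. }
  assert (D0 : forall u v, Rabs (u - x0) <= Rabs (x - x0) -> Rmin c2 y0 <= v <= Rmax c2 y0 -> Cmod ((u, v) - c)%C < r).
  { intros u v Hu Hv. apply disc_corner with u y0.
    - apply Near; [exact Hu|]. rewrite Rminus_diag, Rabs_R0. apply Rabs_pos.
    - lra.
    - apply between_abs, Hv. }
  assert (D2 : forall t, Rmin x0 x <= t <= Rmax x0 x -> exists l, cder g (t, c2) l).
  { intros t Ht. apply Hg, D0; [apply between_abs, Ht|]. split; [apply Rmin_l|apply Rmax_l]. }
  assert (D3 : forall t, Rmin c2 y0 <= t <= Rmax c2 y0 -> exists l, cder g (x, t) l).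
  { intros t Ht. apply Hg, D0; [lra|exact Ht]. }
  assert (D4 : forall t, Rmin y0 y <= t <= Rmax y0 y -> exists l, cder g (x, t) l).
  { intros t Ht. apply Hg, Near; [lra|]. apply between_abs, Ht. }
  assert (E1 : (hseg g c2 c1 x0 + hseg g c2 x0 x)%C = hseg g c2 c1 x).
  { unfold hseg. apply seg_Chasles; intros t Ht; rewrite horizontal_point; [apply D1|apply D2]; exact Ht. }
  assert (E2 : (vseg g x c2 y0 + vseg g x y0 y)%C = vseg g x c2 y).
  { unfold vseg. apply seg_Chasles; intros t Ht; rewrite vertical_point; [apply D3|apply D4]; exact Ht. }
  assert (E3 : bdry g x0 x c2 y0 = 0%C).
  { apply goursat_unordered. intros u v Hu Hv. apply Hg, D0; [apply between_abs, Hu|exact Hv]. }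
  unfold bdry in E3. cbn [Re Im fst snd]. unfold Re, Im; simpl fst; simpl snd.
  set (z0 := ((x0, y0) : C)) in *. set (z := ((x, y) : C)) in *.
  assert (H1 : Cmod (hseg g y0 x0 x - (g z0 * (x, y0) - g z0 * (x0, y0)))%C <= eps / 2 * Rabs (x - x0)).
  { pose proof (seg_est g (RtoC y0 * Ci)%C 1%C (fun z => g z0 * z)%C (fun _ => g z0) (eps / 2) x0 x) as E.
    rewrite !horizontal_point, Cmod_1, Rmult_1_r in E. apply E. intros t Ht. rewrite horizontal_point.
    assert (T := between_abs _ _ _ Ht).
    assert (T2 : Rabs (y0 - y0) <= Rabs (y - y0)) by (rewrite Rminus_diag, Rabs_R0; apply Rabs_pos).
    destruct (Near t y0 T T2) as [N1 N2].
    repeat split; [apply Hg, N2| |eexists; apply cder_const|left; apply Hcont, N1].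
    eapply cder_eq; [apply (cder_mult (fun _ => g z0) (fun z => z)); [apply cder_const|apply cder_id]|ring]. }
  assert (H2 : Cmod (vseg g x y0 y - (g z0 * (x, y) - g z0 * (x, y0)))%C <= eps / 2 * Rabs (y - y0)).
  { pose proof (seg_est g (RtoC x) Ci (fun z => g z0 * z)%C (fun _ => g z0) (eps / 2) y0 y) as E.
    rewrite !vertical_point, Cmod_Ci, Rmult_1_r in E. apply E. intros t Ht. rewrite vertical_point.
    assert (T := between_abs _ _ _ Ht).
    destruct (Near x t ltac:(lra) T) as [N1 N2].
    repeat split; [apply Hg, N2| |eexists; apply cder_const|left; apply Hcont, N1].
    eapply cder_eq; [apply (cder_mult (fun _ => g z0) (fun z => z)); [apply cder_const|apply cder_id]|ring]. }
  fold z in H2. fold z0 in H1.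
  rewrite <- E1, <- E2.
  replace (hseg g c2 c1 x0 + hseg g c2 x0 x + (vseg g x c2 y0 + vseg g x y0 y) -
     (hseg g c2 c1 x0 + vseg g x0 c2 y0) - g z0 * (z - z0))%C with
    ((hseg g c2 x0 x + vseg g x c2 y0 - hseg g y0 x0 x - vseg g x0 c2 y0) +
     (hseg g y0 x0 x - (g z0 * (x, y0) - g z0 * z0)) +
     (vseg g x y0 y - (g z0 * z - g z0 * (x, y0))))%C by ring.
  rewrite E3, Cplus_0_l. eapply Rle_trans; [apply Cmod_triangle|].
  replace (eps * Cmod (z - z0)%C) with (eps / 2 * Cmod (z - z0)%C + eps / 2 * Cmod (z - z0)%C) by field.
  apply Rplus_le_compat.
  - eapply Rle_trans; [exact H1|]. apply Rmult_le_compat_l; lra.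
  - eapply Rle_trans; [exact H2|]. apply Rmult_le_compat_l; lra.
Qed.

Lemma segment_in_disc (c a b : C) (r t : R) : Cmod (a - c)%C < r -> Cmod (b - c)%C < r -> 0 <= t <= 1 ->
  Cmod (a + RtoC t * (b - a) - c)%C < r.
Proof.
  intros Ha Hb Ht.
  replace (a + RtoC t * (b - a) - c)%C with (RtoC (1 - t) * (a - c) + RtoC t * (b - c))%C
    by (rewrite RtoC_minus; ring).
  eapply Rle_lt_trans; [apply Cmod_triangle|]. rewrite !Cmod_mult, !Cmod_R, !Rabs_pos_eq by lra.
  destruct (Rle_lt_dec t (1/2)); nra.
Qed.

Section Picard.
Variables (g : C -> C) (p : C) (rho M : R).
Hypotheses (Hrho : 0 < rho) (HM : 0 < M).
Hypothesis Hg : forall z, Cmod (z - p)%C < rho -> exists l, cder g z l.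
Hypothesis HgM : forall z, Cmod (z - p)%C < rho -> Cmod (g z) <= M.
(** With the Lipschitz constant [8 * M / rho] on the disc of radius [rho / 2], this radius makes
    every Picard step a contraction by [1 / 2]; it also moves the iterates by at most
    [M * r = rho / 16] away from [p]. *)
Let r := rho / (16 * M).

Let Lip (a b : C) : Cmod (a - p)%C <= rho / 2 -> Cmod (b - p)%C <= rho / 2 ->
  Cmod (g a - g b)%C <= 8 * M / rho * Cmod (a - b)%C.
Proof. apply (holomorphic_lipschitz g p rho M Hrho Hg HgM). Qed.

Let good (S : C -> C) : Prop := S 0%C = p /\
  forall u, Cmod (u - 0)%C < r -> (exists l, cder S u l) /\ Cmod (S u - p)%C <= rho / 2.

Lemma picard_step (S : C -> C) : good S ->
  exists S' : C -> C, good S' /\ forall u, Cmod (u - 0)%C < r -> cder S' u (g (S u)).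
Proof.
  intros [HS0 HS].
  assert (Hr : 0 < r) by (apply Rdiv_lt_0_compat; lra).
  destruct (primitive_on_disc (fun u => g (S u)) 0%C r) as [G HG].
  { intros u Hu. destruct (HS u Hu) as [[l Hl] HSu]. destruct (Hg (S u)) as [k Hk]; [lra|].
    eexists. apply (cder_comp g S); eassumption. }
  assert (D : forall u, Cmod (u - 0)%C < r -> cder (fun u => p + (G u - G 0))%C u (g (S u))).
  { intros u Hu. eapply cder_eq.
    - apply (cder_plus (fun _ => p) (fun u => G u - G 0)%C); [apply cder_const|].
      apply (cder_minus G (fun _ => G 0%C)); [apply HG, Hu|apply cder_const].
    - ring. }
  exists (fun u => p + (G u - G 0))%C. split; [split|exact D].
  - ring.
  - intros u Hu. split; [exists (g (S u)); apply D, Hu|].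
    replace (p + (G u - G 0) - p)%C with (G u - G 0 - 0 * (u - 0))%C by ring.
    eapply Rle_trans; [apply (cder_mvt G (fun u => g (S u)) 0%C u 0%C M)|].
    + intros t Ht. apply HG. apply segment_in_disc; [rewrite Cmod_sub_self; exact Hr|exact Hu|exact Ht].
    + intros t Ht. unfold Cminus at 1. replace (- (0))%C with (0 : C) by ring. rewrite Cplus_0_r.
      apply HgM. assert (Cmod (S (0 + RtoC t * (u - 0))%C - p)%C <= rho / 2); [|lra].
      apply HS. apply segment_in_disc; [rewrite Cmod_sub_self; exact Hr|exact Hu|exact Ht].
    + apply Rle_trans with (M * r); [apply Rmult_le_compat_l; lra|].
      unfold r. replace (M * (rho / (16 * M))) with (rho / 16) by (field; lra). lra.
Qed.

(** The iterates converge geometrically. That the limit solves the equation is shown by passing to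
    the limit in a quadratic remainder estimate, which avoids a theorem on uniform limits of
    holomorphic functions. *)
Lemma complex_ode_0 : exists G : C -> C, G 0%C = p /\
  forall u, Cmod (u - 0)%C < r -> Cmod (G u - p)%C <= rho / 2 /\ cder G u (g (G u)).
Proof.
  assert (Hr : 0 < r) by (apply Rdiv_lt_0_compat; lra).
  assert (HL : 8 * M / rho * r = 1 / 2) by (unfold r; field; lra).
  set (L := 8 * M / rho) in *. assert (HL0 : 0 < L) by (apply Rdiv_lt_0_compat; lra).
  assert (good0 : good (fun _ => p)).
  { split; [reflexivity|]. intros u _. split; [exists 0%C; apply cder_const|]. rewrite Cmod_sub_self. lra. }
  set (step := fun S : {S | good S} =>
    let X := constructive_indefinite_description _ (picard_step (proj1_sig S) (proj2_sig S)) in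
    exist good (proj1_sig X) (proj1 (proj2_sig X))).
  set (T := fix T (n : nat) : {S | good S} := match n with O => exist good _ good0 | S n => step (T n) end).
  set (S := fun n => proj1_sig (T n)).
  assert (GS : forall n, good (S n)) by (intros n; apply (proj2_sig (T n))).
  assert (DS : forall n u, Cmod (u - 0)%C < r -> cder (S (Datatypes.S n)) u (g (S n u))).
  { intros n u Hu. unfold S at 1. simpl T. unfold step.
    destruct (constructive_indefinite_description _ _) as [S' [Q1 Q2]]. simpl. apply Q2, Hu. }
  assert (Seg : forall u v t, Cmod (u - 0)%C < r -> Cmod (v - 0)%C < r -> 0 <= t <= 1 ->
     Cmod (u + RtoC t * (v - u) - 0)%C < r) by (intros; apply segment_in_disc; assumption).
  assert (Z0 : Cmod (0 - 0)%C < r) by (rewrite Cmod_sub_self; exact Hr).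
  assert (Conv : forall n u, Cmod (u - 0)%C < r -> Cmod (S (Datatypes.S n) u - S n u)%C <= rho / 2 ^ n).
  { induction n as [|n IH]; intros u Hu.
    - simpl pow. replace (rho / 1) with (rho / 2 + rho / 2) by field.
      eapply Rle_trans; [apply (Cmod_tri _ p)|]. rewrite (Cmod_sub_comm p).
      apply Rplus_le_compat; apply GS, Hu.
    - assert (E0 : (S (Datatypes.S (Datatypes.S n)) 0%C - S (Datatypes.S n) 0%C)%C = 0%C).
      { rewrite (proj1 (GS _)), (proj1 (GS _)). ring. }
      replace (S (Datatypes.S (Datatypes.S n)) u - S (Datatypes.S n) u)%C with
        ((S (Datatypes.S (Datatypes.S n)) u - S (Datatypes.S n) u) - (S (Datatypes.S (Datatypes.S n)) 0%C - S (Datatypes.S n) 0%C) - 0 * (u - 0))%C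
        by (rewrite E0; ring).
      eapply Rle_trans; [apply (cder_mvt (fun u => S (Datatypes.S (Datatypes.S n)) u - S (Datatypes.S n) u)%C
        (fun u => g (S (Datatypes.S n) u) - g (S n u))%C 0%C u 0%C (L * (rho / 2 ^ n)))|].
      + intros t Ht. apply cder_minus; apply DS; apply Seg; assumption.
      + intros t Ht. set (w := (0 + RtoC t * (u - 0))%C).
        assert (Hw : Cmod (w - 0)%C < r) by (apply Seg; assumption).
        replace (g (S (Datatypes.S n) w) - g (S n w) - 0)%C with (g (S (Datatypes.S n) w) - g (S n w))%C by ring.
        eapply Rle_trans; [apply Lip; apply GS, Hw|]. apply Rmult_le_compat_l; [lra|]. apply IH, Hw.
      + assert (P : 0 < 2 ^ n) by (apply pow_lt; lra).
        assert (P2 : 0 < rho / 2 ^ n) by (apply Rdiv_lt_0_compat; lra).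
        apply Rle_trans with (L * (rho / 2 ^ n) * r).
        * apply Rmult_le_compat_l; [|lra]. apply Rmult_le_pos; lra.
        * replace (L * (rho / 2 ^ n) * r) with (L * r * (rho / 2 ^ n)) by ring. rewrite HL.
          right. simpl. field. lra. }
  assert (Lim : forall u, exists l, Cmod (u - 0)%C < r -> forall n, Cmod (l - S n u)%C <= 4 * rho / 2 ^ n).
  { intros u. destruct (Rlt_le_dec (Cmod (u - 0)%C) r) as [Lt|Ge].
    - destruct (geometric_limit (fun n => S n u) rho (Rlt_le _ _ Hrho) (fun n => Conv n u Lt)) as [l Hl].
      exists l. intros _. exact Hl.
    - exists 0%C. intros; lra. }
  destruct (choice _ Lim) as [G HG].
  assert (G0 : G 0%C = p).
  { assert (E : Cmod (G 0%C - p)%C <= 0).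
    { apply (half_pow_lim (4 * rho)); [lra|]. intros n. rewrite <- (proj1 (GS n)). apply HG, Z0. }
    assert (E2 : (G 0%C - p)%C = 0%C) by (apply Cmod_eq_0; pose proof (Cmod_ge_0 (G 0%C - p)%C); lra).
    replace (G 0%C) with (G 0%C - p + p)%C by ring. rewrite E2. ring. }
  assert (GP : forall u, Cmod (u - 0)%C < r -> Cmod (G u - p)%C <= rho / 2).
  { intros u Hu. assert (Cmod (G u - p)%C - rho / 2 <= 0); [|lra].
    apply (half_pow_lim (4 * rho)); [lra|]. intros n. specialize (HG u Hu n).
    pose proof (Cmod_tri (G u) (S n u) p). pose proof (proj2 (proj2 (GS n) u Hu)). lra. }
  assert (GL : forall u v, Cmod (u - 0)%C < r -> Cmod (v - 0)%C < r -> Cmod (G v - G u)%C <= M * Cmod (v - u)%C).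
  { intros u v Hu Hv. assert (Cmod (G v - G u)%C - M * Cmod (v - u)%C <= 0); [|lra].
    apply (half_pow_lim (8 * rho)); [lra|]. intros n.
    pose proof (HG u Hu (Datatypes.S n)) as H1. pose proof (HG v Hv (Datatypes.S n)) as H2.
    assert (H3 : Cmod (S (Datatypes.S n) v - S (Datatypes.S n) u)%C <= M * Cmod (v - u)%C).
    { replace (S (Datatypes.S n) v - S (Datatypes.S n) u)%C with (S (Datatypes.S n) v - S (Datatypes.S n) u - 0 * (v - u))%C by ring.
      apply (cder_mvt (S (Datatypes.S n)) (fun u => g (S n u))).
      - intros t Ht. apply DS, Seg; assumption.
      - intros t Ht. set (w := (u + RtoC t * (v - u))%C). assert (Hw : Cmod (w - 0)%C < r) by (apply Seg; assumption).
        replace (g (S n w) - 0)%C with (g (S n w)) by ring. apply HgM.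
        pose proof (proj2 (proj2 (GS n) w Hw)). lra. }
    pose proof (Cmod_tri (G v) (S (Datatypes.S n) v) (G u)) as T1.
    pose proof (Cmod_tri (S (Datatypes.S n) v) (S (Datatypes.S n) u) (G u)) as T2.
    rewrite (Cmod_sub_comm (S (Datatypes.S n) u) (G u)) in T2.
    assert (P : 0 < 2 ^ n) by (apply pow_lt; lra).
    assert (E : 4 * rho / 2 ^ Datatypes.S n = 2 * rho / 2 ^ n) by (simpl; field; lra). rewrite E in *.
    replace (8 * rho / 2 ^ n) with (4 * (2 * rho / 2 ^ n)) by (field; lra).
    assert (0 < 2 * rho / 2 ^ n) by (apply Rdiv_lt_0_compat; lra). lra. }
  exists G. split; [exact G0|]. intros u Hu. split; [apply GP, Hu|].
  (* On the segment from [u] to [v] the derivative [g (S n w)] differs from [g (G u)] by at most [L]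
     times the distance from [S n w] to [G u], and this distance is at most the approximation error
     plus [M * Cmod (v - u)]. *)
  assert (Q : forall v, Cmod (v - 0)%C < r -> Cmod (G v - G u - g (G u) * (v - u))%C <= L * M * Cmod (v - u)%C * Cmod (v - u)%C).
  { intros v Hv. assert (Cmod (G v - G u - g (G u) * (v - u))%C - L * M * Cmod (v - u)%C * Cmod (v - u)%C <= 0); [|lra].
    set (m := Cmod (v - u)%C). assert (Hm : 0 <= m) by apply Cmod_ge_0.
    apply (half_pow_lim (4 * rho + 4 * rho + L * (4 * rho) * m)).
    { assert (0 <= L * (4 * rho) * m); [apply Rmult_le_pos; [apply Rmult_le_pos|]|]; lra. }
    intros n. assert (P : 1 <= 2 ^ n) by (apply pow_R1_Rle; lra).
    set (d := 4 * rho / 2 ^ n). assert (Hd : 0 < d) by (apply Rdiv_lt_0_compat; lra).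
    assert (E : 4 * rho / 2 ^ Datatypes.S n <= d).
    { unfold d. simpl. replace (4 * rho / (2 * 2 ^ n)) with (4 * rho / 2 ^ n / 2) by (field; lra). fold d. lra. }
    pose proof (HG u Hu (Datatypes.S n)) as H1. pose proof (HG v Hv (Datatypes.S n)) as H2.
    assert (H3 : Cmod (S (Datatypes.S n) v - S (Datatypes.S n) u - g (G u) * (v - u))%C <= L * (d + M * m) * m).
    { apply (cder_mvt (S (Datatypes.S n)) (fun u => g (S n u))).
      - intros t Ht. apply DS, Seg; assumption.
      - intros t Ht. set (w := (u + RtoC t * (v - u))%C). assert (Hw : Cmod (w - 0)%C < r) by (apply Seg; assumption).
        eapply Rle_trans; [apply Lip; [apply GS, Hw|apply GP, Hu]|]. apply Rmult_le_compat_l; [lra|].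
        eapply Rle_trans; [apply (Cmod_tri _ (G w))|]. apply Rplus_le_compat.
        + rewrite Cmod_sub_comm. apply HG, Hw.
        + eapply Rle_trans; [apply GL; assumption|]. apply Rmult_le_compat_l; [lra|].
          unfold w. replace (u + RtoC t * (v - u) - u)%C with (RtoC t * (v - u))%C by ring.
          rewrite Cmod_mult, Cmod_R, Rabs_pos_eq by lra. fold m. nra. }
    replace (G v - G u - g (G u) * (v - u))%C with ((G v - S (Datatypes.S n) v) - (G u - S (Datatypes.S n) u)
      + (S (Datatypes.S n) v - S (Datatypes.S n) u - g (G u) * (v - u)))%C by ring.
    pose proof (Cmod_triangle ((G v - S (Datatypes.S n) v) - (G u - S (Datatypes.S n) u))%C
      (S (Datatypes.S n) v - S (Datatypes.S n) u - g (G u) * (v - u))%C) as T1.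
    pose proof (Cmod_minus_le (G v - S (Datatypes.S n) v)%C (G u - S (Datatypes.S n) u)%C) as T2.
    replace ((4 * rho + 4 * rho + L * (4 * rho) * m) / 2 ^ n) with (d + d + L * d * m) by (unfold d; field; lra).
    replace (L * (d + M * m) * m) with (L * d * m + L * M * m * m) in H3 by ring. lra. }
  intros eps Heps. exists (Rmin (r - Cmod (u - 0)%C) (eps / (L * M))). split.
  { apply Rmin_glb_lt; [lra|]. apply Rdiv_lt_0_compat; [lra|]. apply Rmult_lt_0_compat; lra. }
  intros v Hv. assert (V1 := Rlt_le_trans _ _ _ Hv (Rmin_l _ _)). assert (V2 := Rlt_le_trans _ _ _ Hv (Rmin_r _ _)).
  eapply Rle_trans; [apply Q|].
  - pose proof (Cmod_tri v u 0%C). lra.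
  - apply Rmult_le_compat_r; [apply Cmod_ge_0|].
    assert (HLM : 0 < L * M) by (apply Rmult_lt_0_compat; lra).
    apply Rle_trans with (L * M * (eps / (L * M))); [apply Rmult_le_compat_l; lra|].
    right. field. lra.
Qed.

Lemma complex_ode (u0 : C) : exists G : C -> C, G u0 = p /\
  forall u, Cmod (u - u0)%C < r -> Cmod (G u - p)%C <= rho / 2 /\ cder G u (g (G u)).
Proof.
  destruct complex_ode_0 as [G [G0 HG]].
  exists (fun u => G (u - u0)%C). split.
  - replace (u0 - u0)%C with (0 : C) by ring. exact G0.
  - intros u Hu. destruct (HG (u - u0)%C) as [H1 H2].
    + replace (u - u0 - 0)%C with (u - u0)%C by ring. exact Hu.
    + split; [exact H1|]. eapply cder_eq.
      * apply (cder_comp G (fun u => u - u0)%C); [exact H2|].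
        apply (cder_minus (fun u => u) (fun _ => u0)); [apply cder_id|apply cder_const].
      * ring.
Qed.
End Picard.

(** * Trajectories in real time *)

Lemma rder_minus (f g : R -> C) (t : R) (a b : C) :
  rder f t a -> rder g t b -> rder (fun u => f u - g u)%C t (a - b)%C.
Proof.
  rewrite !rder_is_derive. apply (is_derive_minus (K := R_AbsRing) (V := C_R_NormedModule)).
Qed.

Lemma rder_neg_arg (s : R -> C) (c t : R) (l : C) :
  rder s (c - t) l -> rder (fun u => s (c - u)) t (- l)%C.
Proof.
  intros H eps Heps. destruct (H eps Heps) as [d [Hd H1]]. exists d. split; [exact Hd|].
  intros u Hu. specialize (H1 (c - u)).
  replace (c - u - (c - t)) with (- (u - t)) in H1 by ring. rewrite Rabs_Ropp in H1.
  rewrite RtoC_opp in H1. specialize (H1 Hu).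
  replace (s (c - u)%R - s (c - t)%R - RtoC (u - t) * - l)%C with
    (s (c - u)%R - s (c - t)%R - - RtoC (u - t) * l)%C by ring. exact H1.
Qed.

Lemma hol_bounded (g : C -> C) (p : C) : hol g p -> exists rho M, 0 < rho /\ 0 < M /\
  (forall z, Cmod (z - p)%C < rho -> exists l, cder g z l) /\
  (forall z, Cmod (z - p)%C < rho -> Cmod (g z) <= M).
Proof.
  intros [r [Hr H]]. destruct (H p) as [l Hl]; [rewrite Cmod_sub_self; exact Hr|].
  destruct (cder_cont g p l Hl 1 Rlt_0_1) as [d [Hd Hc]].
  pose proof (Cmod_ge_0 (g p)).
  exists (Rmin r d), (Cmod (g p) + 1). repeat split; [apply Rmin_glb_lt; assumption|lra| |].
  - intros z Hz. apply H. apply Rlt_le_trans with (1 := Hz), Rmin_l.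
  - intros z Hz. pose proof (Cmod_sub_le (g z) (g p)).
    specialize (Hc z (Rlt_le_trans _ _ _ Hz (Rmin_r _ _))). lra.
Qed.

Lemma hol_cder (g : C -> C) (p : C) : hol g p -> exists l, cder g p l.
Proof. intros [r [Hr H]]. apply H. rewrite Cmod_sub_self. exact Hr. Qed.

(** During a time of at most [/ (2 * L)], integrating a bound for [s1 - s2] through the Lipschitz
    estimate halves it; the bounds [rho / 2 ^ n] follow by induction and force equality. *)
Lemma ode_local_unique (g : C -> C) (s1 s2 : R -> C) (t0 e : R) : 0 < e -> hol g (s1 t0) -> s1 t0 = s2 t0 ->
  (forall t, Rabs (t - t0) < e -> rder s1 t (g (s1 t)) /\ rder s2 t (g (s2 t))) ->
  exists d, 0 < d /\ forall t, Rabs (t - t0) < d -> s1 t = s2 t.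
Proof.
  intros He Hh E H. destruct (hol_bounded _ _ Hh) as [rho [M [Hrho [HM [Hg HgM]]]]].
  set (p := s1 t0) in *. pose proof (holomorphic_lipschitz g p rho M Hrho Hg HgM) as Lip.
  set (L := 8 * M / rho) in *. assert (HL : 0 < L) by (apply Rdiv_lt_0_compat; lra).
  assert (H0 : Rabs (t0 - t0) < e) by (rewrite Rminus_diag, Rabs_R0; exact He).
  destruct (rder_cont _ _ _ (proj1 (H t0 H0)) (rho / 2)) as [d1 [Hd1 C1]]; [lra|].
  destruct (rder_cont _ _ _ (proj2 (H t0 H0)) (rho / 2)) as [d2 [Hd2 C2]]; [lra|].
  rewrite <- E in C2. fold p in C1, C2. change (s1 t0 = s2 t0) in E.
  set (d := Rmin (Rmin d1 d2) (Rmin e (/ (2 * L)))).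
  assert (Hd : 0 < d).
  { repeat apply Rmin_glb_lt; try assumption. apply Rinv_0_lt_compat. lra. }
  assert (Dd : d <= d1 /\ d <= d2 /\ d <= e /\ d <= / (2 * L)).
  { unfold d. pose proof (Rmin_l (Rmin d1 d2) (Rmin e (/ (2 * L)))). pose proof (Rmin_r (Rmin d1 d2) (Rmin e (/ (2 * L)))).
    pose proof (Rmin_l d1 d2). pose proof (Rmin_r d1 d2). pose proof (Rmin_l e (/ (2 * L))). pose proof (Rmin_r e (/ (2 * L))). lra. }
  assert (K : forall n t, Rabs (t - t0) < d -> Cmod (s1 t - s2 t)%C <= rho / 2 ^ n).
  { induction n as [|n IH]; intros t Ht.
    - simpl. replace (rho / 1) with (rho / 2 + rho / 2) by field. eapply Rle_trans; [apply (Cmod_tri _ p)|].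
      rewrite (Cmod_sub_comm p). specialize (C1 t ltac:(lra)). specialize (C2 t ltac:(lra)). lra.
    - assert (P : 0 < 2 ^ n) by (apply pow_lt; lra). assert (P2 : 0 < rho / 2 ^ n) by (apply Rdiv_lt_0_compat; lra).
      assert (Der : forall u, Rabs (u - t0) < d -> rder (fun u => s1 u - s2 u)%C u (g (s1 u) - g (s2 u))%C).
      { intros u Hu. apply rder_minus; apply H; lra. }
      assert (Bd : forall u, Rabs (u - t0) < d -> Cmod (g (s1 u) - g (s2 u) - 0)%C <= L * (rho / 2 ^ n)).
      { intros u Hu. replace (g (s1 u) - g (s2 u) - 0)%C with (g (s1 u) - g (s2 u))%C by ring.
        eapply Rle_trans; [apply Lip|apply Rmult_le_compat_l; [lra|apply IH, Hu]].
        - left. apply C1. lra.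
        - left. apply C2. lra. }
      assert (X : Cmod (s1 t - s2 t)%C <= L * (rho / 2 ^ n) * Rabs (t - t0)).
      { assert (E0 : (s1 t0 - s2 t0)%C = 0%C) by (rewrite <- E; ring).
        destruct (Rle_lt_dec t0 t) as [Lt|Lt].
        - rewrite Rabs_pos_eq by lra.
          replace (s1 t - s2 t)%C with (s1 t - s2 t - (s1 t0 - s2 t0) - RtoC (t - t0) * 0)%C by (rewrite E0; ring).
          apply (rder_mvt (fun u => s1 u - s2 u)%C (fun u => g (s1 u) - g (s2 u))%C 0%C); [exact Lt| |];
          intros u Hu; [apply Der|apply Bd]; rewrite Rabs_pos_eq in *; lra.
        - rewrite Rabs_left by lra. rewrite <- Cmod_opp.
          replace (- (s1 t - s2 t))%C with (s1 t0 - s2 t0 - (s1 t - s2 t) - RtoC (t0 - t) * 0)%C by (rewrite E0; ring).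
          replace (- (t - t0)) with (t0 - t) by ring.
          apply (rder_mvt (fun u => s1 u - s2 u)%C (fun u => g (s1 u) - g (s2 u))%C 0%C); [lra| |];
          intros u Hu; [apply Der|apply Bd]; rewrite Rabs_left1 in *; lra. }
      eapply Rle_trans; [exact X|].
      apply Rle_trans with (L * (rho / 2 ^ n) * / (2 * L)).
      + apply Rmult_le_compat_l; [|lra]. apply Rmult_le_pos; lra.
      + right. simpl. field. lra. }
  exists d. split; [exact Hd|]. intros t Ht.
  assert (E0 : Cmod (s1 t - s2 t)%C <= 0) by (apply (half_pow_lim rho); [lra|intros n; apply K, Ht]).
  assert (E1 : (s1 t - s2 t)%C = 0%C) by (apply Cmod_eq_0; pose proof (Cmod_ge_0 (s1 t - s2 t)%C); lra).
  replace (s1 t) with (s1 t - s2 t + s2 t)%C by ring. rewrite E1. ring.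
Qed.

Lemma in_interval_between (alpha beta : Rbar) (a b t : R) : in_interval alpha beta a -> in_interval alpha beta b ->
  a <= t <= b -> in_interval alpha beta t.
Proof.
  intros [H1 _] [_ H4] [H5 H6]. split.
  - apply Rbar_lt_le_trans with (1 := H1). exact H5.
  - apply Rbar_le_lt_trans with (2 := H4). exact H6.
Qed.

Lemma in_interval_near (alpha beta : Rbar) (t : R) : in_interval alpha beta t ->
  exists d, 0 < d /\ forall u, Rabs (u - t) < d -> in_interval alpha beta u.
Proof.
  intros [H1 H2].
  assert (A : exists d, 0 < d /\ forall u, Rabs (u - t) < d -> Rbar_lt alpha u).
  { destruct alpha as [a| |]; simpl in *.
    - exists (t - a). split; [lra|]. intros u Hu. apply Rabs_def2 in Hu. lra.
    - contradiction.
    - exists 1. split; [lra|]. trivial. }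
  assert (B : exists d, 0 < d /\ forall u, Rabs (u - t) < d -> Rbar_lt u beta).
  { destruct beta as [b| |]; simpl in *.
    - exists (b - t). split; [lra|]. intros u Hu. apply Rabs_def2 in Hu. lra.
    - exists 1. split; [lra|]. trivial.
    - contradiction. }
  destruct A as [d1 [Hd1 A]]. destruct B as [d2 [Hd2 B]].
  exists (Rmin d1 d2). split; [apply Rmin_glb_lt; assumption|]. intros u Hu. split.
  - apply A. apply Rlt_le_trans with (1 := Hu), Rmin_l.
  - apply B. apply Rlt_le_trans with (1 := Hu), Rmin_r.
Qed.

(** [P] is open and closed in the interval. [Core] treats both directions from [t0] at once: [f x]
    is [t0 + x] or [t0 - x], and [real_induction] acts on [x]. *)
Lemma interval_connected (alpha beta : Rbar) (t0 : R) (P : R -> Prop) : in_interval alpha beta t0 -> P t0 ->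
  (forall x, in_interval alpha beta x -> P x -> exists d, 0 < d /\ forall y, Rabs (y - x) < d -> P y) ->
  (forall x, in_interval alpha beta x -> (forall d, 0 < d -> exists y, Rabs (y - x) < d /\ in_interval alpha beta y /\ P y) -> P x) ->
  forall t, in_interval alpha beta t -> P t.
Proof.
  intros I0 P0 Hopen Hclosed.
  assert (Core : forall (f : R -> R) b, 0 <= b -> (forall x y, Rabs (f x - f y) = Rabs (x - y)) ->
     f 0 = t0 -> (forall x, 0 <= x <= b -> in_interval alpha beta (f x)) -> (forall y, exists x, f x = y) -> P (f b)).
  { intros f b Hb Hf Hf0 Hin Hsur.
    apply (real_induction (fun x => P (f x)) 0 b Hb); [|lra].
    intros x Hx Hlt.
    assert (Px : P (f x)).
    { destruct (Rle_lt_or_eq_dec 0 x (proj1 Hx)) as [L|L].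
      - apply Hclosed; [apply Hin; exact Hx|]. intros d Hd.
        exists (f (Rmax 0 (x - d / 2))). pose proof (Rmax_l 0 (x - d / 2)). pose proof (Rmax_r 0 (x - d / 2)).
        assert (Rmax 0 (x - d / 2) < x) by (apply Rmax_lub_lt; lra).
        rewrite Hf. split; [apply Rabs_def1; lra|]. split; [apply Hin; lra|apply Hlt; lra].
      - subst x. rewrite Hf0. exact P0. }
    destruct (Hopen (f x) (Hin x Hx) Px) as [d [Hd Ho]].
    exists d. split; [exact Hd|]. intros y Hy _. apply Ho. rewrite Hf. apply Rabs_def1; lra. }
  intros t It. destruct (Rle_lt_dec t0 t) as [L|L].
  - replace t with ((fun x => t0 + x) (t - t0)) by (simpl; ring).
    apply Core; [lra| |simpl; ring| |].
    + intros x y. f_equal. ring.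
    + intros x Hx. apply in_interval_between with t0 t; [exact I0|exact It|lra].
    + intros y. exists (y - t0). ring.
  - replace t with ((fun x => t0 - x) (t0 - t)) by (simpl; ring).
    apply Core; [lra| |simpl; ring| |].
    + intros x y. rewrite Rabs_minus_sym. f_equal. ring.
    + intros x Hx. apply in_interval_between with t t0; [exact It|exact I0|lra].
    + intros y. exists (t0 - y). ring.
Qed.

(** [hol g (s t)] stands for the avoidance of poles: for meromorphic [g] the two conditions agree by
    [meromorphic_cases], and holomorphy is what the local theory uses. *)
Definition sol (g : C -> C) (alpha beta : Rbar) (s : R -> C) : Prop :=
  forall t, in_interval alpha beta t -> hol g (s t) /\ rder s t (g (s t)).

Lemma rder_closed_eq (s1 s2 : R -> C) (x : R) (l1 l2 : C) : rder s1 x l1 -> rder s2 x l2 ->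
  (forall d, 0 < d -> exists y, Rabs (y - x) < d /\ s1 y = s2 y) -> s1 x = s2 x.
Proof.
  intros H1 H2 H.
  assert (E : Cmod (s1 x - s2 x)%C = 0).
  { apply Rle_antisym; [|apply Cmod_ge_0]. apply le_epsilon. intros eps Heps. rewrite Rplus_0_l.
    destruct (rder_cont _ _ _ H1 (eps / 2)) as [d1 [Hd1 C1]]; [lra|].
    destruct (rder_cont _ _ _ H2 (eps / 2)) as [d2 [Hd2 C2]]; [lra|].
    destruct (H (Rmin d1 d2)) as [y [Hy Ey]]; [apply Rmin_glb_lt; assumption|].
    specialize (C1 y (Rlt_le_trans _ _ _ Hy (Rmin_l _ _))). specialize (C2 y (Rlt_le_trans _ _ _ Hy (Rmin_r _ _))).
    pose proof (Cmod_tri (s1 x) (s1 y) (s2 x)). rewrite (Cmod_sub_comm (s1 x) (s1 y)), Ey in H0. rewrite Ey in C1. lra. }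
  apply Cmod_eq_0 in E. replace (s1 x) with (s1 x - s2 x + s2 x)%C by ring. rewrite E. ring.
Qed.

(** The times of agreement form an open set by local uniqueness and a closed set by continuity. *)
Lemma ode_unique (g : C -> C) (alpha beta : Rbar) (s1 s2 : R -> C) (t0 : R) : in_interval alpha beta t0 ->
  sol g alpha beta s1 -> sol g alpha beta s2 -> s1 t0 = s2 t0 ->
  forall t, in_interval alpha beta t -> s1 t = s2 t.
Proof.
  intros I0 S1 S2 E. apply (interval_connected alpha beta t0 (fun t => s1 t = s2 t) I0 E).
  - intros x Ix Ex. destruct (in_interval_near _ _ _ Ix) as [e [He Hn]].
    apply (ode_local_unique g s1 s2 x e He); [apply S1, Ix|exact Ex|].
    intros t Ht. split; [apply S1|apply S2]; apply Hn, Ht.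
  - intros x Ix H. apply (rder_closed_eq s1 s2 x _ _ (proj2 (S1 x Ix)) (proj2 (S2 x Ix))).
    intros d Hd. destruct (H d Hd) as [y [Hy [_ Ey]]]. exists y. split; assumption.
Qed.

Lemma sol_restrict (g : C -> C) (a b a' b' : Rbar) (s : R -> C) : Rbar_le a a' -> Rbar_le b' b ->
  sol g a b s -> sol g a' b' s.
Proof.
  intros H1 H2 H t [T1 T2]. apply H. split.
  - apply Rbar_le_lt_trans with (1 := H1), T1.
  - apply Rbar_lt_le_trans with (1 := T2), H2.
Qed.

Lemma in_interval_shift (a b : Rbar) (c t : R) : in_interval (Rbar_minus a c) (Rbar_minus b c) t <-> in_interval a b (t + c).
Proof. unfold in_interval. destruct a, b; simpl; split; intros [H1 H2]; split; try tauto; try lra. Qed.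

Lemma sol_shift (g : C -> C) (a b : Rbar) (s : R -> C) (c : R) : sol g a b s ->
  sol g (Rbar_minus a c) (Rbar_minus b c) (fun t => s (t + c)).
Proof.
  intros H t Ht. apply in_interval_shift in Ht. destruct (H _ Ht) as [H1 H2].
  split; [exact H1|]. apply rder_shift, H2.
Qed.

Lemma ode_unique_overlap (g : C -> C) (a b a' b' : Rbar) (w w' : R -> C) (t0 t : R) :
  in_interval a b t0 -> in_interval a' b' t0 -> in_interval a b t -> in_interval a' b' t ->
  sol g a b w -> sol g a' b' w' -> w t0 = w' t0 -> w t = w' t.
Proof.
  intros I1 I2 I3 I4 S1 S2 E.
  assert (HA : exists A, Rbar_le a A /\ Rbar_le a' A /\ (A = a \/ A = a')).
  { destruct (Rbar_le_lt_dec a a') as [L|L]; [exists a'|exists a]; repeat split; auto using Rbar_le_refl, Rbar_lt_le. }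
  assert (HB : exists B, Rbar_le B b /\ Rbar_le B b' /\ (B = b \/ B = b')).
  { destruct (Rbar_le_lt_dec b b') as [L|L]; [exists b|exists b']; repeat split; auto using Rbar_le_refl, Rbar_lt_le. }
  destruct HA as [A [A1 [A2 A3]]]. destruct HB as [B [B1 [B2 B3]]].
  apply (ode_unique g A B w w' t0).
  - destruct I1, I2. split; [destruct A3 as [->| ->]|destruct B3 as [->| ->]]; assumption.
  - apply sol_restrict with (3 := S1); assumption.
  - apply sol_restrict with (3 := S2); assumption.
  - exact E.
  - destruct I3, I4. split; [destruct A3 as [->| ->]|destruct B3 as [->| ->]]; assumption.
Qed.

Lemma sol_rder_ext (g : C -> C) (s w : R -> C) (t d : R) : 0 < d -> (forall u, Rabs (u - t) < d -> w u = s u) ->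
  hol g (w t) /\ rder w t (g (w t)) -> hol g (s t) /\ rder s t (g (s t)).
Proof.
  intros Hd E [H1 H2]. assert (Et : w t = s t) by (apply E; rewrite Rminus_diag, Rabs_R0; exact Hd).
  rewrite <- Et. split; [exact H1|]. apply rder_ext_loc with (f := w) (d := d); assumption.
Qed.

Lemma local_solution (g : C -> C) (p : C) (rho M t0 : R) : 0 < rho -> 0 < M ->
  (forall z, Cmod (z - p)%C < rho -> exists l, cder g z l) ->
  (forall z, Cmod (z - p)%C < rho -> Cmod (g z) <= M) ->
  exists w, w t0 = p /\ sol g (t0 - rho / (16 * M)) (t0 + rho / (16 * M)) w.
Proof.
  intros Hrho HM Hg HgM. destruct (complex_ode g p rho M Hrho HM Hg HgM (RtoC t0)) as [G [G0 HG]].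
  exists (fun t => G (RtoC t)). split; [exact G0|].
  intros t [T1 T2]. simpl in T1, T2.
  destruct (HG (RtoC t)) as [H1 H2].
  - rewrite <- RtoC_minus, Cmod_R. apply Rabs_def1; lra.
  - split.
    + exists (rho / 2). split; [lra|]. intros w Hw. apply Hg. pose proof (Cmod_tri w (G (RtoC t)) p). lra.
    + apply (rder_ext_loc (fun u => G (0 + RtoC u * 1)%C) _ t _ 1); [lra| |].
      * intros u _. replace (0 + RtoC u * 1)%C with (RtoC u) by ring. reflexivity.
      * apply rder_eq with (g (G (RtoC t)) * 1)%C; [apply (rder_line G 0%C 1%C)|ring].
        replace (0 + RtoC t * 1)%C with (RtoC t) by ring. exact H2.
Qed.

(** All solutions through [p] at time [0] agree where they overlap, so they glue to one function;
    its life span runs from the infimum to the supremum of the times that any of them reaches. *)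
Lemma maximal_solution (g : C -> C) (p : C) : hol g p ->
  exists (alpha beta : Rbar) (s : R -> C), in_interval alpha beta 0 /\ s 0 = p /\ sol g alpha beta s /\
    forall alpha' beta' w, in_interval alpha' beta' 0 -> w 0 = p -> sol g alpha' beta' w ->
      Rbar_le alpha alpha' /\ Rbar_le beta' beta /\ forall t, in_interval alpha' beta' t -> w t = s t.
Proof.
  intros Hp.
  set (Ext := fun (t : R) (v : C) => exists (a b : Rbar) w, in_interval a b 0 /\ in_interval a b t /\ w 0 = p /\ sol g a b w /\ w t = v).
  assert (Uniq : forall a b w a' b' w' t, in_interval a b 0 -> in_interval a' b' 0 -> in_interval a b t -> in_interval a' b' t ->
     w 0 = p -> w' 0 = p -> sol g a b w -> sol g a' b' w' -> w t = w' t).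
  { intros a b w a' b' w' t I1 I2 I3 I4 E1 E2 S1 S2.
    apply (ode_unique_overlap g a b a' b' w w' 0 t); try assumption. rewrite E1, E2. reflexivity. }
  assert (Sel : forall t, exists v, (exists v', Ext t v') -> Ext t v).
  { intros t. destruct (classic (exists v', Ext t v')) as [[v' H]|H].
    - exists v'. intros _. exact H.
    - exists p. intros H'. contradiction. }
  destruct (choice _ Sel) as [s Hs].
  set (D := fun t : R => exists v, Ext t v).
  assert (Agree : forall a b w t, in_interval a b 0 -> w 0 = p -> sol g a b w -> in_interval a b t -> w t = s t).
  { intros a b w t I E S It. destruct (Hs t) as [a' [b' [w' [J1 [J2 [J3 [J4 J5]]]]]]].
    - exists (w t), a, b, w. exact (conj I (conj It (conj E (conj S eq_refl)))).
    - rewrite <- J5. apply (Uniq a b w a' b' w' t); assumption. }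
  destruct (hol_bounded _ _ Hp) as [rho [M [Hrho [HM [Hg HgM]]]]].
  destruct (local_solution g p rho M 0 Hrho HM Hg HgM) as [w0 [W0 Sw0]].
  set (r0 := rho / (16 * M)) in *. assert (Hr0 : 0 < r0) by (apply Rdiv_lt_0_compat; lra).
  assert (I00 : in_interval (0 - r0) (0 + r0) 0) by (split; simpl; lra).
  pose proof (Glb_Rbar_correct D) as [Gl1 Gl2]. pose proof (Lub_Rbar_correct D) as [Lu1 Lu2].
  set (alpha := Glb_Rbar D) in *. set (beta := Lub_Rbar D) in *.
  assert (Dt : forall t, Rabs t < r0 -> D t).
  { intros t Ht. exists (w0 t), (0 - r0), (0 + r0), w0. apply Rabs_def2 in Ht.
    refine (conj I00 (conj _ (conj W0 (conj Sw0 eq_refl)))). split; simpl; lra. }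
  assert (I0 : in_interval alpha beta 0).
  { split.
    - apply Rbar_le_lt_trans with (Finite (- r0 / 2)); [|simpl; lra]. apply Gl1, Dt. rewrite Rabs_left; lra.
    - apply Rbar_lt_le_trans with (Finite (r0 / 2)); [simpl; lra|]. apply Lu1, Dt. rewrite Rabs_pos_eq; lra. }
  assert (Cover : forall t, in_interval alpha beta t -> D t).
  { intros t [T1 T2]. destruct (Rle_lt_dec 0 t) as [L|L].
    - assert (X : exists t', D t' /\ t < t').
      { apply NNPP. intros N. assert (Rbar_le beta t); [|apply (Rbar_lt_not_le _ _ T2); assumption].
        apply Lu2. intros u Du. simpl. apply Rnot_lt_le. intros Lt. apply N. exists u. auto. }
      destruct X as [t' [[v [a [b [w [J1 [J2 [J3 [J4 J5]]]]]]]] Lt]].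
      exists (w t), a, b, w. refine (conj J1 (conj _ (conj J3 (conj J4 eq_refl)))).
      apply in_interval_between with 0 t'; try assumption; lra.
    - assert (X : exists t', D t' /\ t' < t).
      { apply NNPP. intros N. assert (Rbar_le t alpha); [|apply (Rbar_lt_not_le _ _ T1); assumption].
        apply Gl2. intros u Du. simpl. apply Rnot_lt_le. intros Lt. apply N. exists u. auto. }
      destruct X as [t' [[v [a [b [w [J1 [J2 [J3 [J4 J5]]]]]]]] Lt]].
      exists (w t), a, b, w. refine (conj J1 (conj _ (conj J3 (conj J4 eq_refl)))).
      apply in_interval_between with t' 0; try assumption; lra. }
  exists alpha, beta, s. split; [exact I0|]. split; [|split].
  - rewrite <- W0. symmetry. apply (Agree _ _ w0 0 I00 W0 Sw0 I00).
  - intros t It. destruct (Cover t It) as [v [a [b [w [J1 [J2 [J3 [J4 J5]]]]]]]].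
    destruct (in_interval_near _ _ _ J2) as [d [Hd Hn]].
    apply (sol_rder_ext g s w t d Hd); [|apply J4, J2].
    intros u Hu. apply (Agree a b w u J1 J3 J4), Hn, Hu.
  - intros a b w I E S.
    assert (DD : forall t, in_interval a b t -> D t).
    { intros t It. exists (w t), a, b, w. split; [exact I|]. split; [exact It|]. split; [exact E|]. split; [exact S|reflexivity]. }
    split; [|split].
    + destruct I as [I1 I2]. apply Rbar_not_lt_le. intros L.
      assert (X : exists t : R, Rbar_lt a t /\ Rbar_lt t alpha).
      { destruct a as [a| |], alpha as [al| |]; simpl in *; try contradiction.
        - exists ((a + al) / 2). lra.
        - exists (a + 1). split; [lra|trivial].
        - exists (al - 1). split; [trivial|lra].
        - exists 0. split; trivial. }
      destruct X as [t [T1 T2]].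
      assert (Rbar_le alpha t).
      { apply Gl1, DD. split; [exact T1|].
        apply Rbar_lt_trans with (1 := T2). apply Rbar_lt_trans with (2 := I2). apply I0. }
      apply (Rbar_lt_not_le _ _ T2); assumption.
    + destruct I as [I1 I2]. apply Rbar_not_lt_le. intros L.
      assert (X : exists t : R, Rbar_lt beta t /\ Rbar_lt t b).
      { destruct b as [b| |], beta as [be| |]; simpl in *; try contradiction.
        - exists ((b + be) / 2). lra.
        - exists (b - 1). split; [trivial|lra].
        - exists (be + 1). split; [lra|trivial].
        - exists 0. split; trivial. }
      destruct X as [t [T1 T2]].
      assert (Rbar_le t beta).
      { apply Lu1, DD. split; [|exact T2].
        apply Rbar_lt_trans with (1 := I1). apply Rbar_lt_trans with (2 := T1). apply I0. }
      apply (Rbar_lt_not_le _ _ T1); assumption.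
    + intros t It. apply (Agree a b w t I E S It).
Qed.

(** The length of the continuation depends only on [rho] and [M], and not on the distance of [t0]
    from [beta]. This later shows that a finite life can end only where such bounds fail. *)
Lemma solution_extends (g : C -> C) (alpha beta : Rbar) (s : R -> C) (t0 rho M : R) :
  in_interval alpha beta t0 -> sol g alpha beta s -> 0 < rho -> 0 < M ->
  (forall z, Cmod (z - s t0)%C < rho -> exists l, cder g z l) ->
  (forall z, Cmod (z - s t0)%C < rho -> Cmod (g z) <= M) ->
  exists w, sol g alpha (t0 + rho / (16 * M)) w /\ (forall t, t <= t0 -> w t = s t).
Proof.
  intros I0 S Hrho HM Hg HgM.
  destruct (local_solution g (s t0) rho M t0 Hrho HM Hg HgM) as [w [W0 Sw]].
  set (r := rho / (16 * M)) in *. assert (Hr : 0 < r) by (apply Rdiv_lt_0_compat; lra).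
  destruct (in_interval_near _ _ _ I0) as [d1 [Hd1 Hn]].
  destruct (ode_local_unique g s w t0 (Rmin d1 r)) as [d2 [Hd2 Eq]].
  - apply Rmin_glb_lt; assumption.
  - apply S, I0.
  - symmetry; exact W0.
  - intros t Ht. split; [apply S, Hn; apply Rlt_le_trans with (1 := Ht), Rmin_l|].
    apply Sw. assert (H := Rlt_le_trans _ _ _ Ht (Rmin_r _ _)). apply Rabs_def2 in H. split; simpl; lra.
  (* The two pieces agree in a neighbourhood of [t0], so [u] is differentiable at the joint. *)
  - set (u := fun t => if Rle_dec t t0 then s t else w t).
    assert (U1 : forall t, t <= t0 -> u t = s t) by (intros t Ht; unfold u; destruct (Rle_dec t t0); [reflexivity|lra]).
    assert (U2 : forall t, t0 < t -> u t = w t) by (intros t Ht; unfold u; destruct (Rle_dec t t0); [lra|reflexivity]).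
    exists u. split; [|exact U1]. intros t [T1 T2]. simpl in T2.
    destruct (Rtotal_order t t0) as [L|[L|L]].
    + assert (It : in_interval alpha beta t).
      { split; [exact T1|]. apply Rbar_lt_trans with (Finite t0); [exact L|apply I0]. }
      apply (sol_rder_ext g u s t (t0 - t)); [lra| |apply S, It].
      intros v Hv. apply Rabs_def2 in Hv. symmetry. apply U1. lra.
    + subst t. apply (sol_rder_ext g u s t0 d2 Hd2); [|apply S, I0].
      intros v Hv. destruct (Rle_lt_dec v t0) as [L|L]; [symmetry; apply U1, L|].
      rewrite U2 by exact L. apply Eq, Hv.
    + apply (sol_rder_ext g u w t (t - t0)); [lra| |].
      * intros v Hv. apply Rabs_def2 in Hv. symmetry. apply U2. lra.
      * apply Sw. split; simpl; lra.
Qed.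

(** * Fields close to the exponential *)

Lemma hol_scale (g : C -> C) (d p : C) : hol g p -> hol (fun z => d * g z)%C p.
Proof.
  intros [r [Hr H]]. exists r. split; [exact Hr|]. intros w Hw. destruct (H w Hw) as [l Hl].
  eexists. apply (cder_mult (fun _ => d) g); [apply cder_const|exact Hl].
Qed.

Lemma max_principle_hol (g : C -> C) (c : C) (r R0 M : R) : 0 < r < R0 ->
  (forall z, Cmod (z - c)%C < R0 -> exists l, cder g z l) ->
  (forall z, Cmod (z - c)%C = r -> Cmod (g z) <= M) ->
  forall z, Cmod (z - c)%C <= r -> Cmod (g z) <= M.
Proof.
  intros Hr Hg HM. apply max_principle; [lra| | |exact HM].
  - intros z Hz. destruct (Hg z ltac:(lra)) as [l Hl]. exact (cder_pcont _ _ _ Hl).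
  - intros z Hz. exists (R0 - r). split; [lra|]. intros w Hw. apply Hg.
    pose proof (Cmod_tri w z c). lra.
Qed.

Lemma sol_horizontal (V G : C -> C) (x y r : R) :
  (forall z, Cmod (z - (x, y))%C < r -> hol V (G z) /\ cder G z (V (G z))) ->
  forall v, Rabs (v - y) < r / 2 -> sol V (x - r / 2) (x + r / 2) (fun t => G (t, v)).
Proof.
  intros H v Hv t [T1 T2]. simpl in T1, T2.
  destruct (H (t, v)) as [H1 H2].
  - eapply Rle_lt_trans; [apply Cmod_le_abs|]. simpl.
    assert (Rabs (t - x) < r / 2) by (apply Rabs_def1; lra). unfold Rminus in *. lra.
  - split; [exact H1|]. apply (rder_ext_loc (fun t => G (RtoC v * Ci + RtoC t * 1)%C) _ t _ 1); [lra| |].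
    + intros u _. rewrite horizontal_point. reflexivity.
    + apply rder_eq with (V (G (t, v)) * 1)%C; [|ring].
      apply (rder_line G). rewrite horizontal_point. exact H2.
Qed.

(** In the imaginary direction a complex time solution flows along [Ci * V], the field that also
    generates the starting curve; uniqueness for this field glues neighbouring boxes. *)
Lemma rder_vertical (V G : C -> C) (x y r : R) :
  (forall z, Cmod (z - (x, y))%C < r -> hol V (G z) /\ cder G z (V (G z))) ->
  forall u, Rabs (u - x) < r / 2 -> forall v, Rabs (v - y) < r / 2 -> rder (fun t => G (u, t)) v (Ci * V (G (u, v)))%C.
Proof.
  intros H u Hu v Hv.
  destruct (H (u, v)) as [H1 H2].
  - eapply Rle_lt_trans; [apply Cmod_le_abs|]. simpl. unfold Rminus in *. lra.
  - apply (rder_ext_loc (fun t => G (RtoC u + RtoC t * Ci)%C) _ v _ 1); [lra| |].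
    + intros t _. rewrite vertical_point. reflexivity.
    + apply rder_eq with (V (G (u, v)) * Ci)%C; [|ring].
      apply (rder_line G). rewrite vertical_point. exact H2.
Qed.

(* Starting from a curve [phi] that flows along [i * V], the real-time flow is a holomorphic function of
   time + i * (curve parameter): it agrees locally with complex-time solutions. *)
Lemma flow_box (V S : C -> C) (phi : R -> C) (X Y : R) : 0 <= X ->
  (forall y, Rabs y < Y -> hol V (phi y) /\ rder phi y (Ci * V (phi y))%C) ->
  (forall y, Rabs y < Y -> S (0, y) = phi y /\
     exists a b, in_interval a b 0 /\ in_interval a b X /\ sol V a b (fun t => S (t, y))) ->
  forall y0, Rabs y0 < Y -> forall x0, 0 <= x0 <= X ->
    exists (G : C -> C) (r : R), 0 < r /\
      (forall z, Cmod (z - (x0, y0))%C < r -> hol V (G z) /\ cder G z (V (G z))) /\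
      (forall x y, Rabs (x - x0) < r -> Rabs (y - y0) < r -> 0 <= x <= X -> S (x, y) = G (x, y)).
Proof.
  intros HX Hphi HS y0 Hy0.
  apply (real_induction (fun x0 => exists (G : C -> C) (r : R), 0 < r /\
      (forall z, Cmod (z - (x0, y0))%C < r -> hol V (G z) /\ cder G z (V (G z))) /\
      (forall x y, Rabs (x - x0) < r -> Rabs (y - y0) < r -> 0 <= x <= X -> S (x, y) = G (x, y))) 0 X HX).
  intros x Hx IH.
  destruct (HS y0 Hy0) as [S0 [a0 [b0 [A1 [A2 A3]]]]].
  assert (Ix : in_interval a0 b0 x) by (apply in_interval_between with 0 X; assumption).
  destruct (hol_bounded V (S (x, y0)) (proj1 (A3 x Ix))) as [rho [M [Hrho [HM [Hg HgM]]]]].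
  destruct (complex_ode V (S (x, y0)) rho M Hrho HM Hg HgM ((x, y0) : C)) as [G [G0 HG]].
  set (r := rho / (16 * M)) in *. assert (Hr : 0 < r) by (apply Rdiv_lt_0_compat; lra).
  assert (HG' : forall z, Cmod (z - (x, y0))%C < r -> hol V (G z) /\ cder G z (V (G z))).
  { intros z Hz. destruct (HG z Hz) as [H1 H2]. split; [|exact H2].
    exists (rho / 2). split; [lra|]. intros w Hw. apply Hg. pose proof (Cmod_tri w (G z) (S (x, y0))). lra. }
  pose proof (sol_horizontal V G x y0 r HG') as Hor.
  pose proof (rder_vertical V G x y0 r HG') as Ver.
  assert (Line : forall t, Rabs (t - x) < r / 2 -> in_interval a0 b0 t -> S (t, y0) = G (t, y0)).
  { intros t Ht It.
    apply (ode_unique_overlap V a0 b0 (x - r / 2) (x + r / 2) (fun t => S (t, y0)) (fun t => G (t, y0)) x t);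
      [exact Ix|split; simpl; lra|exact It| |exact A3| |symmetry; exact G0].
    - apply Rabs_def2 in Ht. split; simpl; lra.
    - apply Hor. rewrite Rminus_diag, Rabs_R0. lra. }
  (* At a time [x1] equal to or slightly before [x], the flow [S] and the new local solution [G]
     agree for all nearby [y]: both are curves along [Ci * V] with a common point. The first one is
     [phi] when [x = 0], and otherwise a vertical line of the solution [G1] found at an earlier
     time. *)
  assert (Start : exists x1 d, 0 <= x1 <= x /\ x - x1 < r / 2 /\ 0 < d /\
     forall y, Rabs (y - y0) < d -> S (x1, y) = G (x1, y)).
  { destruct (Rle_lt_or_eq_dec 0 x (proj1 Hx)) as [L|L].
    - set (x1 := Rmax 0 (x - r / 4)).
      assert (Hx1 : 0 <= x1 < x /\ x - x1 < r / 2).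
      { unfold x1. pose proof (Rmax_l 0 (x - r / 4)). pose proof (Rmax_r 0 (x - r / 4)).
        assert (Rmax 0 (x - r / 4) < x) by (apply Rmax_lub_lt; lra). lra. }
      destruct (IH x1 (proj1 Hx1)) as [G1 [r1 [Hr1 [HG1 HS1]]]].
      pose proof (rder_vertical V G1 x1 y0 r1 HG1) as Ver1.
      assert (N1 : Rabs (x1 - x1) < r1 / 2) by (rewrite Rminus_diag, Rabs_R0; lra).
      assert (N2 : Rabs (x1 - x) < r / 2) by (rewrite Rabs_left; lra).
      assert (N3 : Rabs (y0 - y0) < r1) by (rewrite Rminus_diag, Rabs_R0; lra).
      assert (E1 : S (x1, y0) = G1 (x1, y0)) by (apply HS1; lra).
      assert (E2 : S (x1, y0) = G (x1, y0)).
      { apply Line; [exact N2|]. apply in_interval_between with 0 X; try assumption; lra. }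
      destruct (ode_local_unique (fun z => Ci * V z)%C (fun y => G1 (x1, y)) (fun y => G (x1, y)) y0 (Rmin (r1 / 2) (r / 2)))
        as [d [Hd Hu]].
      + apply Rmin_glb_lt; lra.
      + apply hol_scale. apply HG1. rewrite Cmod_sub_self. exact Hr1.
      + rewrite <- E1. exact E2.
      + intros t Ht. split.
        * apply Ver1; [exact N1|]. apply Rlt_le_trans with (1 := Ht), Rmin_l.
        * apply Ver; [exact N2|]. apply Rlt_le_trans with (1 := Ht), Rmin_r.
      + exists x1, (Rmin d r1). split; [lra|]. split; [lra|]. split; [apply Rmin_glb_lt; lra|].
        intros y Hy. rewrite <- Hu by (apply Rlt_le_trans with (1 := Hy), Rmin_l).
        apply HS1; [lra| |lra]. apply Rlt_le_trans with (1 := Hy), Rmin_r.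
    - subst x.
      assert (N2 : Rabs (0 - 0) < r / 2) by (rewrite Rminus_diag, Rabs_R0; lra).
      destruct (ode_local_unique (fun z => Ci * V z)%C phi (fun y => G (0, y)) y0 (Rmin (Y - Rabs y0) (r / 2)))
        as [d [Hd Hu]].
      + apply Rmin_glb_lt; lra.
      + apply hol_scale. apply Hphi, Hy0.
      + rewrite G0. symmetry. exact S0.
      + intros t Ht. split.
        * apply Hphi. assert (H := Rlt_le_trans _ _ _ Ht (Rmin_l _ _)).
          pose proof (Rabs_triang (t - y0) y0). replace (t - y0 + y0) with t in H0 by ring. lra.
        * apply Ver; [exact N2|]. apply Rlt_le_trans with (1 := Ht), Rmin_r.
      + exists 0, (Rmin d (Y - Rabs y0)). split; [lra|]. split; [lra|]. split; [apply Rmin_glb_lt; lra|].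
        intros y Hy. rewrite <- Hu by (apply Rlt_le_trans with (1 := Hy), Rmin_l).
        apply HS. assert (H := Rlt_le_trans _ _ _ Hy (Rmin_r _ _)).
        pose proof (Rabs_triang (y - y0) y0). replace (y - y0 + y0) with y in H0 by ring. lra. }
  destruct Start as [x1 [d [X1 [X2 [Hd Hst]]]]].
  set (r' := Rmin (Rmin d (r / 2)) (Y - Rabs y0)).
  assert (Hr' : 0 < r') by (repeat apply Rmin_glb_lt; lra).
  assert (Rb : r' <= d /\ r' <= r / 2 /\ r' <= Y - Rabs y0).
  { unfold r'. pose proof (Rmin_l (Rmin d (r / 2)) (Y - Rabs y0)). pose proof (Rmin_r (Rmin d (r / 2)) (Y - Rabs y0)).
    pose proof (Rmin_l d (r / 2)). pose proof (Rmin_r d (r / 2)). lra. }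
  (* From the vertical line at [x1] the agreement spreads in real time, again by uniqueness. *)
  assert (Agree : forall t y, Rabs (t - x) < r' -> Rabs (y - y0) < r' -> 0 <= t <= X -> S (t, y) = G (t, y)).
  { intros t y Ht Hy Htx.
    assert (Hy' : Rabs y < Y).
    { pose proof (Rabs_triang (y - y0) y0). replace (y - y0 + y0) with y in H by ring. lra. }
    destruct (HS y Hy') as [_ [a [b [B1 [B2 B3]]]]].
    apply (ode_unique_overlap V a b (x - r / 2) (x + r / 2) (fun t => S (t, y)) (fun t => G (t, y)) x1 t).
    - apply in_interval_between with 0 X; try assumption; lra.
    - split; simpl; lra.
    - apply in_interval_between with 0 X; try assumption; lra.
    - apply Rabs_def2 in Ht. split; simpl; lra.
    - exact B3.
    - apply Hor. lra.
    - apply Hst. lra. }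
  exists (r' / 2). split; [lra|]. intros x' Hx' Hx'X.
  assert (Nx : Cmod ((x', y0) - (x, y0))%C < r' / 2).
  { eapply Rle_lt_trans; [apply Cmod_le_abs|]. simpl.
    replace (y0 + - y0) with 0 by ring. rewrite Rabs_R0, Rplus_0_r. apply Rabs_def1; lra. }
  exists G, (r' / 2). split; [lra|]. split.
  - intros z Hz. apply HG'. pose proof (Cmod_tri z (x', y0) (x, y0)). lra.
  - intros t y Ht Hy Htx. apply Agree; [|lra|exact Htx].
    apply Rabs_def2 in Ht. apply Rabs_def1; lra.
Qed.

(** Source of numerical lower bounds such as [exp 5 >= (9 / 4) ^ 4 > 20] and
    [exp (3 / 2) >= (5 / 4) ^ 6 > 57 / 20]. *)
Lemma exp_ge_pow (x : R) (n : nat) : 0 <= x -> (1 + x) ^ n <= exp (INR n * x).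
Proof.
  intros Hx. induction n as [|n IH].
  - simpl. rewrite Rmult_0_l, exp_0. lra.
  - rewrite S_INR, Rmult_plus_distr_r, Rmult_1_l, exp_plus. simpl.
    pose proof (exp_ineq1_le x). assert (0 <= (1 + x) ^ n) by (apply pow_le; lra). nra.
Qed.

Lemma cos_pos_confined (x : R) : Rabs x <= PI / 2 -> 0 < cos x -> Rabs x < PI / 2.
Proof.
  intros H1 H2. destruct (Rle_lt_or_eq_dec _ _ H1) as [L|L]; [exact L|exfalso].
  assert (E : cos x = 0); [|lra].
  destruct (Rle_lt_dec 0 x) as [P|P].
  - rewrite Rabs_pos_eq in L by exact P. rewrite L. apply cos_PI2.
  - rewrite Rabs_left in L by exact P. rewrite <- cos_neg, L. apply cos_PI2.
Qed.

Lemma cder_Cexp_neg (z : C) : cder (fun w => Cexp (- w)%C) z (- Cexp (- z))%C.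
Proof.
  apply (cder_ext_loc (fun w => Cexp (0 - w)%C) _ z _ 1); [lra| |].
  - intros w _. replace (0 - w)%C with (- w)%C by ring. reflexivity.
  - apply cder_eq with (Cexp (0 - z)%C * (0 - 1))%C.
    + apply (cder_comp Cexp (fun w => 0 - w)%C); [apply cder_Cexp|].
      apply (cder_minus (fun _ => 0%C) (fun z => z)); [apply (cder_const 0%C)|apply cder_id].
    + replace (0 - z)%C with (- z)%C by ring. ring.
Qed.

Lemma rder_Cexp_neg (s : R -> C) (t : R) (l : C) : rder s t l -> rder (fun u => Cexp (- s u)%C) t (- (Cexp (- s t) * l))%C.
Proof.
  intros H. eapply rder_eq; [apply (rder_comp (fun z => Cexp (- z)%C) s); [apply cder_Cexp_neg|exact H]|]. ring.
Qed.

Lemma Re_Cexp (z : C) : Re (Cexp z) = exp (Re z) * cos (Im z).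
Proof. reflexivity. Qed.

Lemma Im_Cexp (z : C) : Im (Cexp z) = exp (Re z) * sin (Im z).
Proof. reflexivity. Qed.

Lemma exp_le (x y : R) : x <= y -> exp x <= exp y.
Proof. intros H. destruct (Rle_lt_or_eq_dec _ _ H) as [L| ->]; [left; apply exp_increasing, L|lra]. Qed.

Lemma exp_le_inv' (x y : R) : exp x <= exp y -> x <= y.
Proof. intros H. apply Rnot_lt_le. intros L. apply exp_increasing in L. lra. Qed.

Lemma Cmod_le_parts (z : C) (a b : R) : Rabs (Re z) <= a -> Rabs (Im z) <= b -> Cmod z <= a + b.
Proof. intros H1 H2. eapply Rle_trans; [apply Cmod_le_abs|lra]. Qed.

(** Small enough for [192 * eta < (1 / 20) ^ 4], which closes the product argument in
    [nonvanishing_not_nearly_linear]; the other uses leave more room. *)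
Definition eta : R := / 100000000.

Section Strip.
Variable V : C -> C.
Hypothesis V_bound : forall w, -2 < Re w <= 0 -> Cmod (V w) <= 21 / 20 * exp (Re w).
Hypothesis V_near : forall w, -2 < Re w -> Cmod w <= 10 -> Cmod (V w - Cexp w)%C <= eta * exp (Re w).

(* In the coordinate [exp (- s)], the equation [s' = d * V s] is nearly [X' = - d]; this traps the argument
   of [X] in the half plane around direction [exp (- i mu)] as long as the straight motion stays there. *)
Lemma confine (s : R -> C) (d x0 : C) (mu T e0 : R) : 0 <= T <= 2 -> Cmod d = 1 -> Rabs mu <= PI / 2 ->
  (forall t, 0 <= t <= T -> rder s t (d * V (s t))%C) ->
  Cmod (Cexp (- s 0%R) - x0)%C <= e0 -> e0 <= / 10000 ->
  (forall t, 0 <= t <= T -> / 10 <= Re (Cexp (RtoC mu * Ci) * (x0 - RtoC t * d))%C /\ Cmod (x0 - RtoC t * d)%C <= 19 / 10) ->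
  Rabs (Im (s 0) - mu) < PI / 2 ->
  forall t, 0 <= t <= T -> Rabs (Im (s t) - mu) < PI / 2 /\ Cmod (s t) < 19 / 2 /\ -1 <= Re (s t) /\
    Cmod (Cexp (- s t) - (x0 - RtoC t * d))%C <= e0 + eta * t.
Proof.
  intros HT Hd Hmu Hs H0 He0 Hx Hmu0.
  pose proof PI_4 as HPI. pose proof PI_RGT_0 as HPI0.
  assert (Heta : eta = / 100000000) by reflexivity.
  (* Near the straight line, [exp (- Re s) * cos (Im s - mu)] is at least [/ 20] and [Cmod X] at
     most [2]. The first keeps [Im s - mu] off [PI / 2] in size and gives [Re s <= 5], the second
     gives [Re s >= -1]. *)
  assert (Fin : forall t, 0 <= t <= T -> Rabs (Im (s t) - mu) <= PI / 2 ->
    Cmod (Cexp (- s t) - (x0 - RtoC t * d))%C <= e0 + eta * t ->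
    Rabs (Im (s t) - mu) < PI / 2 /\ Cmod (s t) <= 9 /\ -1 <= Re (s t)).
  { intros t Ht Hm HX. destruct (Hx t Ht) as [X1 X2].
    set (X := Cexp (- s t)%C) in *. set (Xp := (x0 - RtoC t * d)%C) in *.
    assert (small : e0 + eta * t <= / 1000) by (rewrite Heta; lra).
    assert (Y1 : / 20 <= Re (Cexp (RtoC mu * Ci) * X)%C).
    { assert (B : Rabs (Re (Cexp (RtoC mu * Ci) * (X - Xp))%C) <= / 1000).
      { eapply Rle_trans; [apply re_le_Cmod|]. rewrite Cmod_mult, Cmod_Cexp.
        replace (Re (RtoC mu * Ci)%C) with 0 by (simpl; ring). rewrite exp_0. lra. }
      replace (Cexp (RtoC mu * Ci) * X)%C with (Cexp (RtoC mu * Ci) * Xp + Cexp (RtoC mu * Ci) * (X - Xp))%C by ring.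
      rewrite Re_plus. apply abs_le_between in B. lra. }
    assert (Y2 : Cmod X <= 2) by (pose proof (Cmod_sub_le X Xp); lra).
    assert (EX : Cmod X = exp (- Re (s t))) by (unfold X; rewrite Cmod_Cexp; reflexivity).
    assert (ER : Re (Cexp (RtoC mu * Ci) * X)%C = exp (- Re (s t)) * cos (Im (s t) - mu)).
    { unfold X. rewrite <- Cexp_plus, Re_Cexp.
      replace (Re (RtoC mu * Ci + - s t)%C) with (- Re (s t)) by (unfold Re, RtoC, Ci, Cmult, Cplus, Copp; simpl; ring).
      replace (Im (RtoC mu * Ci + - s t)%C) with (- (Im (s t) - mu)) by (unfold Im, RtoC, Ci, Cmult, Cplus, Copp; simpl; ring).
      rewrite cos_neg. reflexivity. }
    pose proof (exp_pos (- Re (s t))) as Hep.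
    assert (Hc : 0 < cos (Im (s t) - mu)).
    { rewrite ER in Y1. apply Rnot_le_lt. intros L. nra. }
    assert (Hlow : / 20 <= exp (- Re (s t))).
    { rewrite ER in Y1. pose proof (COS_bound (Im (s t) - mu)). nra. }
    assert (R1 : Re (s t) <= 5).
    { apply exp_le_inv'. apply Rle_trans with 20.
      - replace (Re (s t)) with (- (- Re (s t))) by ring. rewrite exp_Ropp.
        replace 20 with (/ / 20) by field. apply Rinv_le_contravar; lra.
      - pose proof (exp_ge_pow (5 / 4) 4 ltac:(lra)) as E. simpl INR in E.
        replace ((1 + 1 + 1 + 1) * (5 / 4)) with 5 in E by field. eapply Rle_trans; [|exact E]. simpl. lra. }
    assert (R2 : -1 <= Re (s t)).
    { assert (- Re (s t) <= 1); [|lra]. apply exp_le_inv'. rewrite <- EX. pose proof (exp_ineq1_le 1). lra. }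
    split; [apply cos_pos_confined; assumption|]. split; [|exact R2].
    replace 9 with (5 + 4) by ring. apply Cmod_le_parts; [apply Rabs_le; lra|].
    apply abs_le_between in Hm. apply abs_le_between in Hmu. apply Rabs_le. lra. }
  (* The derivative of [Cexp (- s)] is [- d] up to [eta], as the factor [exp (- Re s)] cancels the
     weight [exp (Re s)] of [V_near]. *)
  assert (Est : forall t, 0 <= t <= T -> (forall u, 0 <= u <= t -> Cmod (s u) <= 10 /\ -2 < Re (s u)) ->
    Cmod (Cexp (- s t) - (x0 - RtoC t * d))%C <= e0 + eta * t).
  { intros t Ht Hin.
    assert (M : Cmod (Cexp (- s t) - Cexp (- s 0%R) - RtoC (t - 0) * - d)%C <= eta * (t - 0)).
    { apply (rder_mvt (fun u => Cexp (- s u)%C) (fun u => - (Cexp (- s u) * (d * V (s u))))%C); [lra| |].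
      - intros u Hu. apply rder_Cexp_neg, Hs. lra.
      - intros u Hu. destruct (Hin u Hu) as [I1 I2].
        assert (E1 : (Cexp (- s u) * Cexp (s u) = 1)%C).
        { rewrite <- Cexp_plus. replace (- s u + s u)%C with (0 : C) by ring. apply Cexp_0. }
        replace (- (Cexp (- s u) * (d * V (s u))) - - d)%C with (- (d * (Cexp (- s u) * (V (s u) - Cexp (s u)))))%C.
        + rewrite Cmod_opp, !Cmod_mult, Hd, Rmult_1_l, Cmod_Cexp.
          apply Rle_trans with (exp (Re (- s u)%C) * (eta * exp (Re (s u)))).
          * apply Rmult_le_compat_l; [left; apply exp_pos|]. apply V_near; assumption.
          * replace (exp (Re (- s u)%C) * (eta * exp (Re (s u)))) with (eta * (exp (Re (- s u)%C) * exp (Re (s u)))) by ring.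
            rewrite <- exp_plus. replace (Re (- s u)%C + Re (s u)) with 0 by (simpl; unfold Re; ring). rewrite exp_0. lra.
        + transitivity (- (Cexp (- s u) * (d * V (s u))) + d * (Cexp (- s u) * Cexp (s u)))%C; [ring|].
          rewrite E1. ring. }
    replace (Cexp (- s t) - (x0 - RtoC t * d))%C with
      ((Cexp (- s 0%R) - x0) + (Cexp (- s t) - Cexp (- s 0%R) - RtoC (t - 0) * - d))%C
      by (rewrite Rminus_0_r; ring).
    eapply Rle_trans; [apply Cmod_triangle|]. lra. }
  (* Continuous induction: the bounds [19 / 2] and [-3/2] are weaker than the [9] and [-1] returned
     by [Fin], which leaves room to continue beyond [t]. *)
  assert (Q : forall t, 0 <= t <= T -> Rabs (Im (s t) - mu) < PI / 2 /\ Cmod (s t) < 19 / 2 /\ -3/2 < Re (s t)).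
  { apply (real_induction (fun t => Rabs (Im (s t) - mu) < PI / 2 /\ Cmod (s t) < 19 / 2 /\ -3/2 < Re (s t))); [lra|].
    intros t Ht IH.
    assert (Cont : forall e, 0 < e -> exists dl, 0 < dl /\ forall u, Rabs (u - t) < dl -> Cmod (s u - s t)%C < e).
    { intros e He. exact (rder_cont _ _ _ (Hs t Ht) e He). }
    assert (ReIm : forall u, Rabs (Re (s u) - Re (s t)) <= Cmod (s u - s t)%C /\ Rabs (Im (s u) - Im (s t)) <= Cmod (s u - s t)%C).
    { intros u. split; [apply (re_le_Cmod (s u - s t)%C)|apply (Im_le_Cmod (s u - s t)%C)]. }
    assert (Weak : (t = 0 \/ (Rabs (Im (s t) - mu) <= PI / 2 /\ Cmod (s t) <= 19 / 2 /\ -3/2 <= Re (s t)))).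
    { destruct (Rle_lt_or_eq_dec 0 t (proj1 Ht)) as [L|L]; [right|left; auto].
      assert (W : forall e, 0 < e -> Rabs (Im (s t) - mu) <= PI / 2 + e /\ Cmod (s t) <= 19 / 2 + e /\ -3/2 <= Re (s t) + e).
      { intros e He. destruct (Cont e He) as [dl [Hdl Hc]].
        set (u := Rmax 0 (t - dl / 2)). pose proof (Rmax_l 0 (t - dl / 2)). pose proof (Rmax_r 0 (t - dl / 2)).
        assert (u < t) by (apply Rmax_lub_lt; lra). fold u in H, H1.
        specialize (Hc u ltac:(apply Rabs_def1; lra)).
        destruct (IH u ltac:(lra)) as [I1 [I2 I3]]. destruct (ReIm u) as [J1 J2].
        pose proof (Cmod_sub_le (s t) (s u)) as J3. rewrite Cmod_sub_comm in J3.
        apply abs_le_between in J1. apply abs_le_between in J2. apply Rabs_def2 in I1.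
        split; [apply Rabs_le; lra|]. lra. }
      split; [|split]; apply le_epsilon; intros e He; destruct (W e He) as [W1 [W2 W3]]; lra. }
    assert (Strong : Rabs (Im (s t) - mu) < PI / 2 /\ Cmod (s t) <= 9 /\ -1 <= Re (s t)).
    { destruct Weak as [->|[W1 [W2 W3]]].
      - apply Fin; [lra|lra|]. replace (x0 - RtoC 0 * d)%C with x0 by ring. rewrite Rmult_0_r, Rplus_0_r. exact H0.
      - apply Fin; [exact Ht|exact W1|]. apply Est; [exact Ht|]. intros u Hu.
        destruct (Rle_lt_or_eq_dec u t (proj2 Hu)) as [L| ->]; [|lra].
        destruct (IH u ltac:(lra)) as [I1 [I2 I3]]. lra. }
    destruct Strong as [S1 [S2 S3]].
    set (e := Rmin (1 / 4) ((PI / 2 - Rabs (Im (s t) - mu)) / 2)).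
    assert (He : 0 < e) by (apply Rmin_glb_lt; lra).
    destruct (Cont e He) as [dl [Hdl Hc]]. exists dl. split; [exact Hdl|].
    intros u Hu _. specialize (Hc u ltac:(apply Rabs_def1; lra)). destruct (ReIm u) as [J1 J2].
    assert (e <= 1 / 4) by apply Rmin_l. assert (e <= (PI / 2 - Rabs (Im (s t) - mu)) / 2) by apply Rmin_r.
    pose proof (Cmod_sub_le (s u) (s t)) as J3.
    pose proof (Rabs_triang (Im (s u) - Im (s t)) (Im (s t) - mu)) as J4.
    replace (Im (s u) - Im (s t) + (Im (s t) - mu)) with (Im (s u) - mu) in J4 by ring.
    apply abs_le_between in J1. lra. }
  intros t Ht.
  assert (E : Cmod (Cexp (- s t) - (x0 - RtoC t * d))%C <= e0 + eta * t).
  { apply Est; [exact Ht|]. intros u Hu. destruct (Q u ltac:(lra)) as [_ [Q2 Q3]]. lra. }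
  destruct (Q t Ht) as [Q1 [Q2 Q3]]. destruct (Fin t Ht ltac:(lra) E) as [F1 [F2 F3]].
  repeat split; assumption.
Qed.

(** A trajectory may leave the disc of [V_near], and then only [V_bound] is left, for [Re s <= 0],
    that is, where [X = exp (- s)] is outside the unit disc. This suffices: at a time of equality
    [Cmod X] is at least [6 / 5], and there it grows at a rate of at most [21 / 20 < 11 / 10]. So
    the edge [Re s = -2] is never reached. *)
Lemma growth_bound (s : R -> C) (T : R) : 0 <= T <= 3 / 2 ->
  (forall t, 0 <= t <= T -> rder s t (V (s t))) -> Cmod (Cexp (- s 0%R)%C) <= 6 / 5 ->
  forall t, 0 <= t <= T -> Cmod (Cexp (- s t)%C) <= 6 / 5 + 11 / 10 * t.
Proof.
  intros HT Hs H0.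
  apply (real_induction (fun t => Cmod (Cexp (- s t)%C) <= 6 / 5 + 11 / 10 * t)); [lra|].
  intros t Ht IH.
  set (X := fun t => Cexp (- s t)%C).
  assert (DX : rder X t (- (Cexp (- s t) * V (s t)))%C) by (apply rder_Cexp_neg, Hs, Ht).
  assert (Now : Cmod (X t) <= 6 / 5 + 11 / 10 * t).
  { destruct (Rle_lt_or_eq_dec 0 t (proj1 Ht)) as [L|L].
    - apply le_epsilon. intros e He. destruct (rder_cont _ _ _ DX e He) as [dl [Hdl Hc]].
      set (u := Rmax 0 (t - dl / 2)). pose proof (Rmax_l 0 (t - dl / 2)). pose proof (Rmax_r 0 (t - dl / 2)).
      assert (u < t) by (apply Rmax_lub_lt; lra). fold u in H, H1.
      specialize (Hc u ltac:(apply Rabs_def1; lra)). specialize (IH u ltac:(lra)). fold (X u) in IH.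
      pose proof (Cmod_sub_le (X t) (X u)) as J. rewrite (Cmod_sub_comm (X t)) in J. lra.
    - subst t. unfold X. lra. }
  destruct (Rle_lt_or_eq_dec _ _ Now) as [L|L].
  - destruct (rder_cont _ _ _ DX (6 / 5 + 11 / 10 * t - Cmod (X t))) as [dl [Hdl Hc]]; [lra|].
    exists dl. split; [exact Hdl|]. intros u Hu _. specialize (Hc u ltac:(apply Rabs_def1; lra)).
    pose proof (Cmod_sub_le (X u) (X t)) as J. fold (X u). lra.
  - assert (EX : Cmod (X t) = exp (- Re (s t))) by (unfold X; rewrite Cmod_Cexp; reflexivity).
    assert (R1 : Re (s t) <= 0).
    { assert (0 <= - Re (s t)); [|lra]. apply exp_le_inv'. rewrite exp_0. lra. }
    assert (R2 : -2 < Re (s t)).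
    { assert (- Re (s t) <= 3 / 2); [|lra]. apply exp_le_inv'.
      pose proof (exp_ge_pow (1 / 4) 6 ltac:(lra)) as E. simpl INR in E.
      replace ((1 + 1 + 1 + 1 + 1 + 1) * (1 / 4)) with (3 / 2) in E by field.
      eapply Rle_trans; [|exact E]. simpl. lra. }
    assert (B : Cmod (- (Cexp (- s t) * V (s t)))%C <= 21 / 20).
    { rewrite Cmod_opp, Cmod_mult. fold (X t). rewrite EX.
      apply Rle_trans with (exp (- Re (s t)) * (21 / 20 * exp (Re (s t)))).
      - apply Rmult_le_compat_l; [left; apply exp_pos|]. apply V_bound. lra.
      - replace (exp (- Re (s t)) * (21 / 20 * exp (Re (s t)))) with (21 / 20 * exp (- Re (s t) + Re (s t)))
          by (rewrite exp_plus; ring).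
        replace (- Re (s t) + Re (s t)) with 0 by ring. rewrite exp_0. lra. }
    destruct (DX (1 / 20) ltac:(lra)) as [dl [Hdl Hc]]. exists dl. split; [exact Hdl|].
    intros u Hu _. specialize (Hc u ltac:(apply Rabs_def1; lra)). rewrite Rabs_pos_eq in Hc by lra.
    fold (X u). replace (X u) with (X t + ((X u - X t - RtoC (u - t) * (- (Cexp (- s t) * V (s t)))) + RtoC (u - t) * (- (Cexp (- s t) * V (s t)))))%C by ring.
    eapply Rle_trans; [apply Cmod_triangle|].
    pose proof (Cmod_triangle (X u - X t - RtoC (u - t) * (- (Cexp (- s t) * V (s t))))%C (RtoC (u - t) * (- (Cexp (- s t) * V (s t))))%C) as T1.
    rewrite Cmod_mult, Cmod_R, Rabs_pos_eq in T1 by lra.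
    assert ((u - t) * Cmod (- (Cexp (- s t) * V (s t)))%C <= (u - t) * (21 / 20)) by (apply Rmult_le_compat_l; lra).
    lra.
Qed.

Lemma growth_bound_Re (s : R -> C) (T : R) : 0 <= T <= 3 / 2 ->
  (forall t, 0 <= t <= T -> rder s t (V (s t))) -> Cmod (Cexp (- s 0%R)%C) <= 6 / 5 ->
  forall t, 0 <= t <= T -> -3/2 <= Re (s t).
Proof.
  intros HT Hs H0 t Ht. pose proof (growth_bound s T HT Hs H0 t Ht) as G. rewrite Cmod_Cexp in G.
  assert (- Re (s t) <= 3 / 2); [|lra]. apply exp_le_inv'.
  replace (- Re (s t)) with (Re (- s t)%C) by reflexivity.
  pose proof (exp_ge_pow (1 / 4) 6 ltac:(lra)) as E. simpl INR in E.
  replace ((1 + 1 + 1 + 1 + 1 + 1) * (1 / 4)) with (3 / 2) in E by field.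
  eapply Rle_trans; [|exact E]. simpl. simpl in G. lra.
Qed.
End Strip.

(** * Periodic functions on vertical strips *)

Lemma period_reduce (P y : R) : 0 < P ->
  exists (n : nat) (y' : R), 0 <= y' <= P /\ (y = y' + INR n * P \/ y' = y + INR n * P).
Proof.
  intros HP. destruct (base_Int_part (y / P)) as [B1 B2]. set (k := Int_part (y / P)) in *.
  set (y' := y - IZR k * P).
  assert (Ey : y = y / P * P) by (field; lra).
  assert (Hy' : 0 <= y' <= P).
  { unfold y'. rewrite Ey. split; nra. }
  destruct (Z.le_gt_cases 0 k) as [L|L].
  - exists (Z.to_nat k), y'. split; [exact Hy'|]. left.
    rewrite INR_IZR_INZ, Z2Nat.id by exact L. unfold y'. ring.
  - exists (Z.to_nat (- k)), y'. split; [exact Hy'|]. right.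
    rewrite INR_IZR_INZ, Z2Nat.id, opp_IZR by lia. unfold y'. ring.
Qed.

Lemma periodic_n (A : Type) (psi : C -> A) (P a b : R) :
  (forall z, a <= Re z <= b -> psi (z + RtoC P * Ci)%C = psi z) ->
  forall (n : nat) z, a <= Re z <= b -> psi (z + RtoC (INR n * P) * Ci)%C = psi z.
Proof.
  intros H n z Hz. induction n as [|n IH].
  - f_equal. simpl INR. rewrite Rmult_0_l. ring.
  - rewrite <- IH, S_INR.
    replace (z + RtoC ((INR n + 1) * P) * Ci)%C with ((z + RtoC (INR n * P) * Ci) + RtoC P * Ci)%C.
    + apply H. rewrite Re_plus. replace (Re (RtoC (INR n * P) * Ci)%C) with 0 by (simpl; ring). lra.
    + rewrite Rmult_plus_distr_r, RtoC_plus, Rmult_1_l. ring.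
Qed.

(** Modulo the period a closed vertical strip is a compact rectangle, so [compact_max] applies. *)
Lemma periodic_strip_max (psi : C -> R) (P a b : R) : 0 < P -> a <= b ->
  (forall z, a <= Re z <= b -> psi (z + RtoC P * Ci)%C = psi z) ->
  (forall z, a <= Re z <= b -> forall eps, 0 < eps -> exists e, 0 < e /\
     forall w, a <= Re w <= b -> Cmod (w - z)%C < e -> psi w < psi z + eps) ->
  exists z, a <= Re z <= b /\ forall w, a <= Re w <= b -> psi w <= psi z.
Proof.
  intros HP Hab Hper Hcont.
  destruct (compact_max (fun w => a <= Re w <= b /\ 0 <= Im w <= P) psi a b 0 P)
    as [z0 [K0 Hmax]]; [lra|lra|auto| | | |].
  - intros z Hz.
    assert (ReIm : forall w, Rabs (Re w - Re z) <= Cmod (w - z)%C /\ Rabs (Im w - Im z) <= Cmod (w - z)%C).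
    { intros u. split; [apply (re_le_Cmod (u - z)%C)|apply (Im_le_Cmod (u - z)%C)]. }
    assert (Hz' : Re z < a \/ b < Re z \/ Im z < 0 \/ P < Im z).
    { destruct (Rlt_le_dec (Re z) a); [auto|]. destruct (Rlt_le_dec b (Re z)); [auto|].
      destruct (Rlt_le_dec (Im z) 0); [auto|]. destruct (Rlt_le_dec P (Im z)); [auto|]. exfalso. apply Hz. lra. }
    destruct Hz' as [H|[H|[H|H]]];
    [exists (a - Re z)|exists (Re z - b)|exists (- Im z)|exists (Im z - P)]; (split; [lra|]);
    intros w Hw Kw; destruct (ReIm w) as [J1 J2]; apply abs_le_between in J1; apply abs_le_between in J2; lra.
  - intros z Kz e He. destruct (Hcont z (proj1 Kz) e He) as [d [Hd Hc]]. exists d. split; [exact Hd|].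
    intros w Kw Hw. apply Hc; [apply Kw|exact Hw].
  - exists ((a, 0) : C). simpl. lra.
  - exists z0. split; [apply K0|]. intros w Hw.
    destruct (period_reduce P (Im w) HP) as [n [y' [Hy' E]]].
    assert (K : psi (Re w, y') <= psi z0) by (apply Hmax; simpl; lra).
    assert (Ew : psi w = psi (Re w, y')).
    { destruct E as [E|E].
      - rewrite <- (periodic_n _ psi P a b Hper n (Re w, y')) by (simpl; lra). f_equal. rewrite pair_C.
        transitivity ((Re w, Im w) : C); [destruct w; reflexivity|]. rewrite pair_C, E, RtoC_plus. ring.
      - rewrite <- (periodic_n _ psi P a b Hper n w Hw). f_equal. rewrite pair_C, E, RtoC_plus.
        transitivity (RtoC (Re w) + RtoC (Im w) * Ci + RtoC (INR n * P) * Ci)%C; [|ring].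
        f_equal. rewrite <- pair_C. destruct w; reflexivity. }
    rewrite Ew. exact K.
Qed.

Definition maximal (g : C -> C) (p : C) (alpha beta : Rbar) (s : R -> C) : Prop :=
  in_interval alpha beta 0 /\ s 0 = p /\ sol g alpha beta s /\
    forall alpha' beta' w, in_interval alpha' beta' 0 -> w 0 = p -> sol g alpha' beta' w ->
      Rbar_le alpha alpha' /\ Rbar_le beta' beta /\ forall t, in_interval alpha' beta' t -> w t = s t.

Lemma maximal_extension_le (g : C -> C) (p : C) (alpha : Rbar) (b : R) (s : R -> C) (t0 rho M : R) :
  maximal g p alpha b s -> 0 <= t0 < b -> 0 < rho -> 0 < M ->
  (forall z, Cmod (z - s t0)%C < rho -> exists l, cder g z l) ->
  (forall z, Cmod (z - s t0)%C < rho -> Cmod (g z) <= M) -> t0 + rho / (16 * M) <= b.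
Proof.
  intros [I0 [S0 [S Max]]] Ht Hrho HM Hg HgM.
  assert (It : in_interval alpha b t0).
  { split; [|simpl; lra]. apply Rbar_lt_le_trans with (Finite 0); [apply I0|simpl; lra]. }
  destruct (solution_extends g alpha b s t0 rho M It S Hrho HM Hg HgM) as [w [Sw Ew]].
  destruct (Max alpha (Finite (t0 + rho / (16 * M))) w) as [_ [H _]].
  - split; [apply I0|]. simpl. assert (0 < rho / (16 * M)) by (apply Rdiv_lt_0_compat; lra). lra.
  - rewrite Ew by lra. exact S0.
  - exact Sw.
  - exact H.
Qed.

(** * Life and escape of trajectories of a periodic field close to the exponential *)

Section Strip.
Variables (V : C -> C) (P : R).
Hypothesis HP : 0 < P.
Hypothesis V_hol : forall w, -2 < Re w -> hol V w.
Hypothesis V_period : forall w, -2 < Re w -> V (w + RtoC P * Ci)%C = V w.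
Hypothesis V_bound : forall w, -2 < Re w <= 0 -> Cmod (V w) <= 21 / 20 * exp (Re w).
Hypothesis V_near : forall w, -2 < Re w -> Cmod w <= 10 -> Cmod (V w - Cexp w)%C <= eta * exp (Re w).

(** By periodicity the bound is uniform in [Im w], so a solution of bounded real part remains
    extendable. The edge [-7/4] leaves discs of radius [1 / 4] around the points with
    [Re z >= -3/2]. *)
Lemma V_strip_bounded (R0 : R) : exists M, 0 < M /\ forall w, -7/4 <= Re w <= R0 -> Cmod (V w) <= M.
Proof.
  destruct (Rlt_le_dec R0 (-7/4)) as [L|L].
  { exists 1. split; [lra|]. intros w Hw. lra. }
  destruct (periodic_strip_max (fun w => Cmod (V w)) P (-7/4) R0 HP L) as [z0 [_ Hmax]].
  - intros z Hz. rewrite V_period by lra. reflexivity.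
  - intros z Hz e He. destruct (hol_cder V z) as [l Hl]; [apply V_hol; lra|].
    destruct (cder_cont _ _ _ Hl e He) as [d [Hd Hc]]. exists d. split; [exact Hd|].
    intros w _ Hw. specialize (Hc w Hw). pose proof (Cmod_sub_le (V w) (V z)). lra.
  - exists (Cmod (V z0) + 1). pose proof (Cmod_ge_0 (V z0)). split; [lra|].
    intros w Hw. specialize (Hmax w Hw). lra.
Qed.

Lemma V_cder_near (z : C) (w : C) : -3/2 <= Re z -> Cmod (w - z)%C < 1 / 4 -> -7/4 <= Re w /\ exists l, cder V w l.
Proof.
  intros Hz Hw. pose proof (re_le_Cmod (w - z)%C) as J. rewrite Re_minus in J.
  assert (J2 := abs_le_between _ _ J). split; [lra|]. apply hol_cder, V_hol. lra.
Qed.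

(** While [Re (s t) <= R0], the bound for [V] guarantees a continuation of fixed length; within half
    that length of [b] this contradicts maximality. [growth_bound_Re] keeps the left edge out of
    reach. *)
Lemma blow_up (p : C) (alpha : Rbar) (b : R) (s : R -> C) : maximal V p alpha b s -> b <= 3 / 2 ->
  Cmod (Cexp (- p)%C) <= 6 / 5 ->
  forall R0, exists t1, t1 < b /\ forall t, t1 < t < b -> R0 < Re (s t).
Proof.
  intros Hmax Hb Hp R0. pose proof Hmax as [I0 [S0 [S Max]]].
  assert (Hb0 : 0 < b) by apply I0.
  assert (In : forall t, 0 <= t < b -> in_interval alpha b t).
  { intros t Ht. split; [|simpl; lra]. apply Rbar_lt_le_trans with (Finite 0); [apply I0|simpl; lra]. }
  assert (Low : forall t, 0 <= t < b -> -3/2 <= Re (s t)).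
  { intros t Ht. apply (growth_bound_Re V V_bound s t); [lra| | |lra].
    - intros u Hu. apply S, In. lra.
    - rewrite S0. exact Hp. }
  destruct (V_strip_bounded (R0 + 1)) as [M [HM HB]].
  exists (Rmax 0 (b - (1 / 4) / (16 * M) / 2)).
  assert (Hr : 0 < (1 / 4) / (16 * M)) by (apply Rdiv_lt_0_compat; lra).
  split; [apply Rmax_lub_lt; lra|]. intros t [Ht1 Ht2].
  assert (T0 := Rle_lt_trans _ _ _ (Rmax_l _ _) Ht1). assert (T1 := Rle_lt_trans _ _ _ (Rmax_r _ _) Ht1).
  apply Rnot_le_lt. intros L.
  assert (E : t + (1 / 4) / (16 * M) <= b); [|lra].
  apply (maximal_extension_le V p alpha b s t (1 / 4) M Hmax); [lra|lra|exact HM| |].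
  - intros z Hz. apply (V_cder_near (s t)); [apply Low; lra|exact Hz].
  - intros z Hz. destruct (V_cder_near (s t) z) as [H1 _]; [apply Low; lra|exact Hz|].
    apply HB. split; [exact H1|]. pose proof (re_le_Cmod (z - s t)%C) as J. rewrite Re_minus in J.
    apply abs_le_between in J. lra.
Qed.

(** For imaginary [d] the point [X = exp (- s)] moves along the vertical line [1 - t * d], inside
    the right half plane, so [confine] applies with [mu = 0]. *)
Lemma transverse_line (d : C) : Cmod d = 1 -> Re d = 0 ->
  exists alpha beta s, maximal (fun z => d * V z)%C 0%C alpha beta s /\ Rbar_lt (1 / 2) beta /\
    forall t, 0 <= t <= 1 / 2 -> Rabs (Im (s t)) < PI / 2 /\ Cmod (s t) < 19 / 2 /\ -1 <= Re (s t) /\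
      Cmod (Cexp (- s t) - (1 - RtoC t * d))%C <= eta.
Proof.
  intros Hd Hre.
  destruct (maximal_solution (fun z => d * V z)%C 0%C) as [alpha [beta [s Hmax]]].
  { apply hol_scale, V_hol. simpl. lra. }
  exists alpha, beta, s. split; [exact Hmax|].
  pose proof Hmax as [I0 [S0 [S Max]]].
  assert (Conf : forall T, 0 <= T <= 1 / 2 -> Rbar_lt T beta -> forall t, 0 <= t <= T ->
    Rabs (Im (s t)) < PI / 2 /\ Cmod (s t) < 19 / 2 /\ -1 <= Re (s t) /\
      Cmod (Cexp (- s t) - (1 - RtoC t * d))%C <= eta).
  { intros T HT LT t Ht.
    destruct (confine V V_near s d 1%C 0 T 0) with (t := t) as [C1 [C2 [C3 C4]]].
    - lra.
    - exact Hd.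
    - rewrite Rabs_R0. pose proof PI_RGT_0. lra.
    - intros u Hu. apply S. split.
      + apply Rbar_lt_le_trans with (Finite 0); [apply I0|simpl; lra].
      + apply Rbar_le_lt_trans with (Finite T); [simpl; lra|exact LT].
    - rewrite S0. replace (- 0)%C with (0 : C) by ring. rewrite Cexp_0, Cmod_sub_self. lra.
    - lra.
    - intros u Hu. replace (RtoC 0 * Ci)%C with (0 : C) by ring. rewrite Cexp_0, Cmult_1_l.
      rewrite Re_minus, Re_scal, Hre. split; [simpl; lra|].
      eapply Rle_trans; [apply Cmod_minus_le|]. rewrite Cmod_1, Cmod_mult, Hd, Cmod_R, Rabs_pos_eq by lra. lra.
    - rewrite S0. simpl. rewrite Rminus_0_r, Rabs_R0. pose proof PI_RGT_0. lra.
    - exact Ht.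
    - rewrite Rminus_0_r in C1. repeat split; try assumption.
      eapply Rle_trans; [exact C4|]. unfold eta. lra. }
  assert (LT : Rbar_lt (1 / 2) beta).
  { apply Rbar_not_le_lt. intros L. destruct beta as [b| |]; [|exact L|destruct (proj2 I0)].
    simpl in L. assert (Hb0 : 0 < b) by apply I0.
    (* [Cmod (s t) < 19 / 2] keeps the disc of radius [1 / 4] around [s t] within [Cmod z <= 10],
       where [V_near] bounds [V] by [(1 + eta) * exp 10]. *)
    set (M := 2 * exp 10). assert (HM : 0 < M) by (unfold M; pose proof (exp_pos 10); lra).
    set (r := (1 / 4) / (16 * M)). assert (Hr : 0 < r) by (apply Rdiv_lt_0_compat; lra).
    set (t := Rmax 0 (b - r / 2)).
    assert (Ht : 0 <= t < b) by (split; [apply Rmax_l|apply Rmax_lub_lt; lra]).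
    assert (Ht2 : b - r / 2 <= t) by apply Rmax_r.
    destruct (Conf t ltac:(lra) ltac:(simpl; lra) t ltac:(lra)) as [C1 [C2 [C3 C4]]].
    assert (E : t + r <= b); [|lra].
    apply (maximal_extension_le _ _ alpha b s t (1 / 4) M Hmax Ht ltac:(lra) HM).
    - intros z Hz. destruct (V_cder_near (s t) z) as [_ [l Hl]]; [lra|exact Hz|].
      eexists. apply (cder_mult (fun _ => d) V); [apply cder_const|exact Hl].
    - intros z Hz. rewrite Cmod_mult, Hd, Rmult_1_l.
      destruct (V_cder_near (s t) z) as [Hz2 _]; [lra|exact Hz|].
      pose proof (Cmod_sub_le z (s t)) as Hz3.
      pose proof (V_near z ltac:(lra) ltac:(lra)) as N. pose proof (Cmod_sub_le (V z) (Cexp z)) as N2.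
      rewrite Cmod_Cexp in N2.
      assert (exp (Re z) <= exp 10).
      { apply exp_le. pose proof (re_le_Cmod z) as J. apply abs_le_between in J. lra. }
      unfold M. unfold eta in N. pose proof (exp_pos (Re z)). lra. }
  split; [exact LT|]. intros t Ht. apply (Conf (1 / 2)); [lra|exact LT|exact Ht].
Qed.

(** The flow along [Ci * V] and the reversed flow along [- Ci * V] form one curve: by maximality the
    first solution already contains the reversed second one. [Y] exceeds [1 / 2] so that the closed
    parameter interval fits inside. *)
Lemma start_curve : exists (Y : R) (phi : R -> C), 1 / 2 < Y /\
  (forall y, Rabs y < Y -> hol V (phi y) /\ rder phi y (Ci * V (phi y))%C) /\
  (forall y, Rabs y <= 1 / 2 -> Rabs (Im (phi y)) < PI / 2 /\ Cmod (phi y) < 19 / 2 /\ -1 <= Re (phi y) /\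
     Cmod (Cexp (- phi y) - (1 - RtoC y * Ci))%C <= eta).
Proof.
  destruct (transverse_line Ci) as [a1 [b1 [s1 [[I1 [Z1 [S1 M1]]] [L1 C1]]]]]; [apply Cmod_Ci|reflexivity|].
  destruct (transverse_line (- Ci)%C) as [a2 [b2 [s2 [[I2 [Z2 [S2 M2]]] [L2 C2]]]]];
    [rewrite Cmod_opp; apply Cmod_Ci|simpl; unfold Re; simpl; ring|].
  assert (HY : exists Y : R, 1 / 2 < Y /\ Rbar_lt Y b1 /\ Rbar_lt Y b2).
  { destruct b1 as [u| |], b2 as [v| |]; simpl in *; try contradiction.
    - exists ((1 / 2 + Rmin u v) / 2). pose proof (Rmin_l u v). pose proof (Rmin_r u v).
      assert (1 / 2 < Rmin u v) by (apply Rmin_glb_lt; assumption). lra.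
    - exists ((1 / 2 + u) / 2). split; [lra|split; [lra|trivial]].
    - exists ((1 / 2 + v) / 2). split; [lra|split; [trivial|lra]].
    - exists 1. split; [lra|split; trivial]. }
  destruct HY as [Y [HY [Y1 Y2]]].
  destruct (in_interval_near _ _ _ I2) as [e [He Hn]].
  set (w := fun t => s2 (0 - t)).
  assert (Sw : sol (fun z => Ci * V z)%C (- Y) (e / 2) w).
  { intros t [T1 T2]. simpl in T1, T2.
    assert (It : in_interval a2 b2 (0 - t)).
    { destruct (Rle_lt_dec t 0).
      - apply in_interval_between with 0 Y; [exact I2| |lra]. split; [|exact Y2].
        apply Rbar_lt_le_trans with (Finite 0); [apply I2|simpl; lra].
      - apply Hn. rewrite Rabs_left; lra. }
    destruct (S2 _ It) as [H1 H2]. split.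
    - apply (hol_scale (fun z => - Ci * V z)%C (- (1))%C) in H1.
      destruct H1 as [r [Hr H1]]. exists r. split; [exact Hr|]. intros z Hz. destruct (H1 z Hz) as [l Hl].
      exists l. apply (cder_ext_loc (fun z => - (1) * (- Ci * V z))%C _ z l 1); [lra| |exact Hl]. intros; ring.
    - eapply rder_eq; [apply rder_neg_arg, H2|]. unfold w. ring. }
  assert (Iw : in_interval (- Y) (e / 2) 0) by (split; simpl; lra).
  destruct (M1 _ _ w Iw) as [A1 [_ A2]]; [unfold w; rewrite Rminus_0_r; exact Z2|exact Sw|].
  exists Y, s1. split; [exact HY|]. split.
  - intros y Hy. apply Rabs_def2 in Hy.
    destruct (S1 y) as [H1 H2].
    + split; [apply Rbar_le_lt_trans with (1 := A1); simpl; lra|apply Rbar_lt_trans with (2 := Y1); simpl; lra].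
    + split; [|exact H2]. apply (hol_scale (fun z => Ci * V z)%C (- Ci)%C) in H1.
      destruct H1 as [r [Hr H1]]. exists r. split; [exact Hr|]. intros z Hz. destruct (H1 z Hz) as [l Hl].
      exists l. apply (cder_ext_loc (fun z => - Ci * (Ci * V z))%C _ z l 1); [lra| |exact Hl].
      intros u _. transitivity (- (Ci * Ci) * V u)%C; [ring|]. replace (Ci * Ci)%C with (- (1))%C; [ring|].
      apply injective_projections; simpl; ring.
  - intros y Hy. apply abs_le_between in Hy. destruct (Rle_lt_dec 0 y) as [L|L]; [apply C1; lra|].
    rewrite <- A2 by (split; simpl; lra). unfold w.
    destruct (C2 (0 - y) ltac:(lra)) as [D1 [D2 [D3 D4]]]. repeat split; try assumption.
    replace (1 - RtoC (0 - y) * - Ci)%C with (1 - RtoC y * Ci)%C in D4; [exact D4|].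
    rewrite RtoC_minus. ring.
Qed.

(** Here [X] follows [1 - i y - t]. For [T <= 9 / 10] its real part stays at least about [/ 10], and
    [mu = 0] serves; for [Rabs y >= / 10] it passes [0] on the side of [- i y], and [mu] is [PI / 2]
    with the sign of [y]. *)
Lemma straight_trajectory (p : C) (alpha beta : Rbar) (s : R -> C) (y T : R) :
  maximal V p alpha beta s -> Rabs y <= 1 / 2 -> 0 <= T <= 3 / 2 -> (/ 10 <= Rabs y \/ T <= 9 / 10) ->
  Rabs (Im p) < PI / 2 -> -1 <= Re p -> Cmod (Cexp (- p) - (1 - RtoC y * Ci))%C <= eta ->
  Rbar_lt T beta /\ forall t, 0 <= t <= T -> Cmod (s t) < 19 / 2 /\ (T <= 9 / 10 -> Rabs (Im (s t)) < PI / 2) /\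
    Cmod (Cexp (- s t) - (1 - RtoC y * Ci - RtoC t))%C <= 3 * eta.
Proof.
  intros Hmax Hy HT Hcase Him Hre Hp. pose proof Hmax as [I0 [S0 [S Max]]].
  pose proof PI_RGT_0 as HPI.
  assert (Hy' := abs_le_between _ _ Hy).
  assert (Conf : forall T', 0 <= T' <= T -> Rbar_lt T' beta -> forall t, 0 <= t <= T' ->
    Cmod (s t) < 19 / 2 /\ (T <= 9 / 10 -> Rabs (Im (s t)) < PI / 2) /\
    Cmod (Cexp (- s t) - (1 - RtoC y * Ci - RtoC t))%C <= 3 * eta).
  { intros T' HT' LT.
    assert (Go : forall mu, Rabs mu <= PI / 2 -> (T <= 9 / 10 -> mu = 0) ->
      (forall t, 0 <= t <= T' -> / 10 <= Re (Cexp (RtoC mu * Ci) * ((1 - RtoC y * Ci) - RtoC t * 1))%C) ->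
      Rabs (Im p - mu) < PI / 2 -> forall t, 0 <= t <= T' ->
      Cmod (s t) < 19 / 2 /\ (T <= 9 / 10 -> Rabs (Im (s t)) < PI / 2) /\
      Cmod (Cexp (- s t) - (1 - RtoC y * Ci - RtoC t))%C <= 3 * eta).
    { intros mu Hmu Hmu0 Hpos Hmup t Ht.
      destruct (confine V V_near s 1%C (1 - RtoC y * Ci)%C mu T' eta) with (t := t) as [D1 [D2 [D3 D4]]].
      - lra.
      - apply Cmod_1.
      - exact Hmu.
      - intros u Hu. rewrite Cmult_1_l. apply S. split.
        + apply Rbar_lt_le_trans with (Finite 0); [apply I0|simpl; lra].
        + apply Rbar_le_lt_trans with (Finite T'); [simpl; lra|exact LT].
      - rewrite S0. exact Hp.
      - unfold eta. lra.
      - intros u Hu. split; [apply Hpos, Hu|].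
        eapply Rle_trans; [apply Cmod_le_abs|].
        replace (Re (1 - RtoC y * Ci - RtoC u * 1)%C) with (1 - u) by (simpl; ring).
        replace (Im (1 - RtoC y * Ci - RtoC u * 1)%C) with (- y) by (simpl; ring).
        rewrite Rabs_Ropp. assert (Rabs (1 - u) <= 1) by (apply Rabs_le; lra). lra.
      - rewrite S0. exact Hmup.
      - exact Ht.
      - split; [exact D2|]. split.
        + intros HT9. rewrite (Hmu0 HT9), Rminus_0_r in D1. exact D1.
        + rewrite Cmult_1_r in D4. eapply Rle_trans; [exact D4|]. unfold eta. lra. }
    assert (ImX : Im (Cexp (- p))%C = - (exp (- Re p) * sin (Im p))).
    { rewrite Im_Cexp. change (Re (- p)%C) with (- Re p). change (Im (- p)%C) with (- Im p). rewrite sin_neg. ring. }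
    assert (ImB : Rabs (Im (Cexp (- p))%C + y) <= eta).
    { replace (Im (Cexp (- p))%C + y) with (Im (Cexp (- p) - (1 - RtoC y * Ci))%C) by (simpl; ring).
      eapply Rle_trans; [apply Im_le_Cmod|exact Hp]. }
    apply abs_le_between in ImB. assert (Him' := Rabs_def2 _ _ Him). pose proof (exp_pos (- Re p)) as Hep.
    destruct (Rle_lt_dec T (9 / 10)) as [L9|L9].
    - apply (Go 0).
      + rewrite Rabs_R0. lra.
      + reflexivity.
      + intros t Ht. replace (RtoC 0 * Ci)%C with (0 : C) by ring. rewrite Cexp_0, Cmult_1_l.
        replace (Re (1 - RtoC y * Ci - RtoC t * 1)%C) with (1 - t) by (simpl; ring). lra.
      + rewrite Rminus_0_r. exact Him.
    - destruct Hcase as [Hcase|Hcase]; [|lra].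
      destruct (Rle_lt_dec 0 y) as [Ly|Ly].
      + rewrite Rabs_pos_eq in Hcase by exact Ly.
        apply (Go (PI / 2)).
        * rewrite Rabs_pos_eq; lra.
        * intros; lra.
        * intros t Ht.
          replace (Cexp (RtoC (PI / 2) * Ci)%C) with Ci.
          -- replace (Re (Ci * (1 - RtoC y * Ci - RtoC t * 1))%C) with y by (simpl; ring). lra.
          -- unfold Cexp; simpl. replace (PI / 2 * 0 - 0 * 1) with 0 by ring.
             replace (PI / 2 * 1 + 0 * 0) with (PI / 2) by ring. rewrite exp_0, cos_PI2, sin_PI2.
             apply injective_projections; simpl; ring.
        (* The imaginary part of [Cexp (- p)] is close to [- y], which determines the sign of
           [Im p]. *)
        * assert (0 < Im p).
          { apply Rnot_le_lt. intros N.
            assert (sin (Im p) <= 0).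
            { replace (Im p) with (- (- Im p)) by ring. rewrite sin_neg.
              assert (0 <= sin (- Im p)) by (apply sin_ge_0; lra). lra. }
            unfold eta in *. nra. }
          apply Rabs_def1; lra.
      + rewrite Rabs_left in Hcase by exact Ly.
        apply (Go (- (PI / 2))).
        * rewrite Rabs_left; lra.
        * intros; lra.
        * intros t Ht.
          replace (Cexp (RtoC (- (PI / 2)) * Ci)%C) with (- Ci)%C.
          -- replace (Re (- Ci * (1 - RtoC y * Ci - RtoC t * 1))%C) with (- y) by (simpl; ring). lra.
          -- unfold Cexp; simpl. replace (- (PI / 2) * 0 - 0 * 1) with 0 by ring.
             replace (- (PI / 2) * 1 + 0 * 0) with (- (PI / 2)) by ring. rewrite exp_0, cos_neg, sin_neg, cos_PI2, sin_PI2.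
             apply injective_projections; simpl; ring.
        * assert (Im p < 0).
          { apply Rnot_le_lt. intros N. assert (0 <= sin (Im p)) by (apply sin_ge_0; lra).
            unfold eta in *. nra. }
          apply Rabs_def1; lra. }
  (* If life ended by time [T], [blow_up] would push [Re (s t)] beyond [10], against the bound
     [19 / 2] of the confinement. *)
  assert (LT : Rbar_lt T beta).
  { apply Rbar_not_le_lt. intros L. destruct beta as [b| |]; [|exact L|destruct (proj2 I0)].
    simpl in L. assert (Hb0 : 0 < b) by apply I0.
    assert (Hp2 : Cmod (Cexp (- p)%C) <= 6 / 5).
    { assert (N : Cmod (1 - RtoC y * Ci)%C <= 118 / 100).
      { apply Rsqr_incr_0; [|apply Cmod_ge_0|lra]. unfold Rsqr.
        replace (Cmod (1 - RtoC y * Ci)%C * Cmod (1 - RtoC y * Ci)%C) with (Cmod (1 - RtoC y * Ci)%C ^ 2) by ring.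
        rewrite Cmod2_alt. replace (Re (1 - RtoC y * Ci)%C) with 1 by (simpl; ring).
        replace (Im (1 - RtoC y * Ci)%C) with (- y) by (simpl; ring). nra. }
      pose proof (Cmod_sub_le (Cexp (- p)) (1 - RtoC y * Ci)%C). unfold eta in Hp. lra. }
    destruct (blow_up p alpha b s Hmax ltac:(lra) Hp2 10) as [t1 [Ht1 Hbig]].
    set (t := (Rmax 0 t1 + b) / 2).
    assert (Rmax 0 t1 < b) by (apply Rmax_lub_lt; lra). pose proof (Rmax_l 0 t1). pose proof (Rmax_r 0 t1).
    assert (Ht : t1 < t < b /\ 0 <= t) by (unfold t; lra).
    specialize (Hbig t ltac:(lra)). destruct (Conf t ltac:(lra) ltac:(simpl; lra) t ltac:(lra)) as [D _].
    pose proof (re_le_Cmod (s t)) as J. apply abs_le_between in J. lra. }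
  split; [exact LT|]. apply Conf; [lra|exact LT].
Qed.
End Strip.

(* A nonvanishing holomorphic [E] cannot be close to [1 - z] off a thin horizontal strip around [z = 1]:
   the maximum principle for a product of four rotated copies removes the exceptional strip. *)
Lemma nonvanishing_not_nearly_linear (E : C -> C) :
  (forall z, Cmod (z - 1)%C < 9 / 20 -> exists l, cder E z l) ->
  (forall z, Cmod (z - 1)%C < 9 / 20 -> E z <> 0%C) ->
  (forall z, Cmod (z - 1)%C < 9 / 20 -> Cmod (E z + z - 1)%C <= 4) ->
  (forall z, Cmod (z - 1)%C < 9 / 20 -> / 10 <= Rabs (Im z) -> Cmod (E z + z - 1)%C <= 3 * eta) -> False.
Proof.
  intros HE Hnz H4 Hsmall.
  set (g := fun z => (E z + z - 1)%C).
  assert (Dg : forall z, Cmod (z - 1)%C < 9 / 20 -> exists l, cder g z l).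
  { intros z Hz. destruct (HE z Hz) as [l Hl]. eexists.
    apply (cder_minus (fun z => E z + z)%C (fun _ => 1%C)); [|apply (cder_const 1%C)].
    apply (cder_plus E (fun z => z)); [exact Hl|apply cder_id]. }
  assert (Heta : eta = / 100000000) by reflexivity.
  assert (Close : forall z, Cmod (z - 1)%C <= 1 / 5 -> Cmod (g z) <= 1 / 20).
  { intros z Hz.
    (* At [u = 0] this is the fourth power of [g z]; on the circle [Cmod u = 1 / 5] some factor is
       evaluated off the strip. The radius [9 / 20 = 1 / 5 + 1 / 4] of the domain accommodates all
       four arguments. *)
    set (F := fun u => (g (z + u) * g (z + Ci * u) * (g (z - u) * g (z - Ci * u)))%C).
    assert (InD : forall k u, Cmod k = 1 -> Cmod u < 1 / 4 -> Cmod (z + k * u - 1)%C < 9 / 20).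
    { intros k u Hk Hu. replace (z + k * u - 1)%C with ((z - 1) + k * u)%C by ring.
      eapply Rle_lt_trans; [apply Cmod_triangle|]. rewrite Cmod_mult, Hk. lra. }
    assert (Ci1 : Cmod (- Ci)%C = 1) by (rewrite Cmod_opp; apply Cmod_Ci).
    assert (m1 : Cmod (- (1))%C = 1) by apply Cmod_m1.
    assert (A1 : forall u, (z + u)%C = (z + 1 * u)%C) by (intros; ring).
    assert (A3 : forall u, (z - u)%C = (z + - (1) * u)%C) by (intros; ring).
    assert (A4 : forall u, (z - Ci * u)%C = (z + - Ci * u)%C) by (intros; ring).
    assert (Fac : forall k u, Cmod k = 1 -> Cmod u < 1 / 4 -> exists l, cder (fun u => g (z + k * u)%C) u l).
    { intros k u Hk Hu. destruct (Dg _ (InD k u Hk Hu)) as [l Hl]. eexists.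
      apply (cder_comp g (fun u => z + k * u)%C); [exact Hl|].
      apply (cder_plus (fun _ => z) (fun u => k * u)%C); [apply cder_const|].
      apply (cder_mult (fun _ => k) (fun u => u)); [apply cder_const|apply cder_id]. }
    (* One factor is at most [3 * eta], the other three at most [4]. *)
    assert (B : Cmod (F 0%C) <= 192 * eta).
    { apply (max_principle_hol F 0%C (1 / 5) (1 / 4)); [lra| | |rewrite Cmod_sub_self; lra].
      - intros u Hu. replace (u - 0)%C with u in Hu by ring.
        destruct (Fac 1%C u Cmod_1 Hu) as [l1 F1]. destruct (Fac Ci u Cmod_Ci Hu) as [l2 F2].
        destruct (Fac (- (1))%C u m1 Hu) as [l3 F3]. destruct (Fac (- Ci)%C u Ci1 Hu) as [l4 F4].
        eexists. apply (cder_ext_loc (fun u => g (z + 1 * u) * g (z + Ci * u) * (g (z + - (1) * u) * g (z + - Ci * u)))%C _ u _ 1);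
          [lra| |].
        + intros w _. unfold F. rewrite <- A1, <- A3, <- A4. reflexivity.
        + apply (cder_mult (fun u => g (z + 1 * u) * g (z + Ci * u))%C (fun u => g (z + - (1) * u) * g (z + - Ci * u))%C).
          * apply (cder_mult (fun u => g (z + 1 * u))%C (fun u => g (z + Ci * u))%C); eassumption.
          * apply (cder_mult (fun u => g (z + - (1) * u))%C (fun u => g (z + - Ci * u))%C); eassumption.
      - intros u Hu. replace (u - 0)%C with u in Hu by ring.
        unfold F. rewrite A1, A3, A4.
        pose proof (InD 1%C u Cmod_1 ltac:(lra)) as I1. pose proof (InD Ci u Cmod_Ci ltac:(lra)) as I2.
        pose proof (InD (- (1))%C u m1 ltac:(lra)) as I3. pose proof (InD (- Ci)%C u Ci1 ltac:(lra)) as I4.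
        pose proof (H4 _ I1) as B1. pose proof (H4 _ I2) as B2. pose proof (H4 _ I3) as B3. pose proof (H4 _ I4) as B4.
        pose proof (Hsmall _ I1) as S1. pose proof (Hsmall _ I2) as S2. pose proof (Hsmall _ I3) as S3. pose proof (Hsmall _ I4) as S4.
        rewrite !Cmod_mult.
        change (Cmod (g (z + 1 * u)%C) <= 4) in B1. change (Cmod (g (z + Ci * u)%C) <= 4) in B2.
        change (Cmod (g (z + - (1) * u)%C) <= 4) in B3. change (Cmod (g (z + - Ci * u)%C) <= 4) in B4.
        change (/ 10 <= Rabs (Im (z + 1 * u)%C) -> Cmod (g (z + 1 * u)%C) <= 3 * eta) in S1.
        change (/ 10 <= Rabs (Im (z + Ci * u)%C) -> Cmod (g (z + Ci * u)%C) <= 3 * eta) in S2.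
        change (/ 10 <= Rabs (Im (z + - (1) * u)%C) -> Cmod (g (z + - (1) * u)%C) <= 3 * eta) in S3.
        change (/ 10 <= Rabs (Im (z + - Ci * u)%C) -> Cmod (g (z + - Ci * u)%C) <= 3 * eta) in S4.
        assert (Hu2 : Re u ^ 2 + Im u ^ 2 = 1 / 25) by (rewrite <- Cmod2_alt, Hu; field).
        assert (J1 : Im (z + 1 * u)%C = Im z + Im u) by (simpl; unfold Im, Re; ring).
        assert (J2 : Im (z + Ci * u)%C = Im z + Re u) by (simpl; unfold Im, Re; ring).
        assert (J3 : Im (z + - (1) * u)%C = Im z - Im u) by (simpl; unfold Im, Re; ring).
        assert (J4 : Im (z + - Ci * u)%C = Im z - Re u) by (simpl; unfold Im, Re; ring).
        rewrite J1 in S1. rewrite J2 in S2. rewrite J3 in S3. rewrite J4 in S4.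
        set (a1 := Cmod (g (z + 1 * u)%C)) in *. set (a2 := Cmod (g (z + Ci * u)%C)) in *.
        set (a3 := Cmod (g (z + - (1) * u)%C)) in *. set (a4 := Cmod (g (z + - Ci * u)%C)) in *.
        assert (P1 : 0 <= a1) by apply Cmod_ge_0. assert (P2 : 0 <= a2) by apply Cmod_ge_0.
        assert (P3 : 0 <= a3) by apply Cmod_ge_0. assert (P4 : 0 <= a4) by apply Cmod_ge_0.
        assert (Prod : forall x y v w, 0 <= x <= 3 * eta -> 0 <= y <= 4 -> 0 <= v <= 4 -> 0 <= w <= 4 -> x * y * (v * w) <= 192 * eta).
        { intros x y v w Hx Hy Hv Hw. assert (0 <= y * v <= 16) by nra. assert (0 <= y * v * w <= 64) by nra.
          replace (x * y * (v * w)) with (x * (y * v * w)) by ring. nra. }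
        (* Otherwise [Re u] and [Im u] would both be smaller than [/ 10] in size, while their
           squares add up to [1 / 25]. *)
        assert (Some : / 10 <= Rabs (Im z + Im u) \/ / 10 <= Rabs (Im z + Re u) \/ / 10 <= Rabs (Im z - Im u) \/ / 10 <= Rabs (Im z - Re u)).
        { destruct (Rle_lt_dec (/ 10) (Rabs (Im z + Im u))) as [Q1|Q1]; [auto|].
          destruct (Rle_lt_dec (/ 10) (Rabs (Im z + Re u))) as [Q2|Q2]; [auto|].
          destruct (Rle_lt_dec (/ 10) (Rabs (Im z - Im u))) as [Q3|Q3]; [auto|].
          destruct (Rle_lt_dec (/ 10) (Rabs (Im z - Re u))) as [Q4|Q4]; [auto|]. exfalso.
          apply Rabs_def2 in Q1. apply Rabs_def2 in Q2. apply Rabs_def2 in Q3. apply Rabs_def2 in Q4.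
          assert (- / 10 < Im u < / 10) by lra. assert (- / 10 < Re u < / 10) by lra. nra. }
        destruct Some as [Q|[Q|[Q|Q]]].
        + specialize (S1 Q). apply Prod; lra.
        + specialize (S2 Q). replace (a1 * a2 * (a3 * a4)) with (a2 * a1 * (a3 * a4)) by ring. apply Prod; lra.
        + specialize (S3 Q). replace (a1 * a2 * (a3 * a4)) with (a3 * a4 * (a1 * a2)) by ring. apply Prod; lra.
        + specialize (S4 Q). replace (a1 * a2 * (a3 * a4)) with (a4 * a3 * (a1 * a2)) by ring. apply Prod; lra. }
    unfold F in B. replace (z + Ci * 0)%C with z in B by ring. replace (z - Ci * 0)%C with z in B by ring.
    replace (z + 0)%C with z in B by ring. replace (z - 0)%C with z in B by ring. rewrite !Cmod_mult in B.
    set (m := Cmod (g z)) in *. assert (0 <= m) by apply Cmod_ge_0.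
    apply Rnot_lt_le. intros L. assert (1 / 400 < m * m) by nra.
    assert (1 / 160000 < m * m * (m * m)) by nra. rewrite Heta in B. lra. }
  (* On the circle of radius [1 / 5] around [1], [Cmod (E z) >= 1 / 5 - 1 / 20 = 3 / 20]. So [1 / E]
     is at most [20 / 3] at the centre, where [Close] makes it at least [20]. *)
  assert (Inv : Cmod (/ E 1)%C <= / (3 / 20)).
  { apply (max_principle_hol (fun z => / E z)%C 1%C (1 / 5) (9 / 20)); [lra| | |rewrite Cmod_sub_self; lra].
    - intros z Hz. destruct (HE z Hz) as [l Hl]. eexists. apply cder_inv; [exact Hl|apply Hnz, Hz].
    - intros z Hz. rewrite Cmod_inv by (apply Hnz; lra). apply Rinv_le_contravar; [lra|].
      specialize (Close z ltac:(lra)). unfold g in Close.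
      replace (E z + z - 1)%C with ((z - 1) - - E z)%C in Close by ring.
      pose proof (Cmod_sub_le (z - 1)%C (- E z)%C) as T. rewrite Cmod_opp in T. lra. }
  assert (E1 : E 1%C <> 0%C) by (apply Hnz; rewrite Cmod_sub_self; lra).
  rewrite Cmod_inv in Inv by exact E1.
  assert (Hp := proj1 (Cmod_gt_0 _) E1).
  assert (C1 : Cmod (E 1%C) <= 1 / 20).
  { specialize (Close 1%C ltac:(rewrite Cmod_sub_self; lra)). unfold g in Close.
    replace (E 1 + 1 - 1)%C with (E 1)%C in Close by ring. exact Close. }
  assert (/ (1 / 20) <= / Cmod (E 1%C)) by (apply Rinv_le_contravar; lra). lra.
Qed.

(** Until time [9 / 10] every trajectory of the bundle stays close to its straight line; one with
    life at most [3 / 2] exists by contradiction, so neither its starting point nor [b] is known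
    more precisely than stated. *)
Lemma strip_escape (V : C -> C) (P : R) : 0 < P ->
  (forall w, -2 < Re w -> hol V w) ->
  (forall w, -2 < Re w -> V (w + RtoC P * Ci)%C = V w) ->
  (forall w, -2 < Re w <= 0 -> Cmod (V w) <= 21 / 20 * exp (Re w)) ->
  (forall w, -2 < Re w -> Cmod w <= 10 -> Cmod (V w - Cexp w)%C <= eta * exp (Re w)) ->
  exists (e b : R) (s : R -> C), 0 < e /\ 9 / 10 < b <= 3 / 2 /\
    (forall t, - e < t < b -> -2 < Re (s t) /\ rder s t (V (s t))) /\
    (forall R0, exists t1, t1 < b /\ forall t, t1 < t < b -> R0 < Re (s t)) /\
    (forall t, 0 <= t <= 9 / 10 -> Rabs (Im (s t)) < PI / 2 /\ Cmod (s t) < 19 / 2).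
Proof.
  intros HP V_hol V_period V_bound V_near.
  destruct (start_curve V V_hol V_near) as [Y [phi [HY [Hphi Cphi]]]].
  assert (Ex : forall y, exists d : (Rbar * Rbar * (R -> C)), Rabs y < Y -> maximal V (phi y) (fst (fst d)) (snd (fst d)) (snd d)).
  { intros y. destruct (Rlt_le_dec (Rabs y) Y) as [L|L].
    - destruct (maximal_solution V (phi y) (proj1 (Hphi y L))) as [a [b [s H]]].
      exists (a, b, s). intros _. exact H.
    - exists (p_infty, p_infty, fun _ => RtoC 0). intros; lra. }
  destruct (choice _ Ex) as [D HD].
  set (al := fun y => fst (fst (D y))). set (be := fun y => snd (fst (D y))). set (sg := fun y => snd (D y)).
  assert (HM : forall y, Rabs y < Y -> maximal V (phi y) (al y) (be y) (sg y)) by exact HD.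
  assert (Straight : forall y T, Rabs y <= 1 / 2 -> 0 <= T <= 3 / 2 -> (/ 10 <= Rabs y \/ T <= 9 / 10) ->
    Rbar_lt T (be y) /\ forall t, 0 <= t <= T -> Cmod (sg y t) < 19 / 2 /\ (T <= 9 / 10 -> Rabs (Im (sg y t)) < PI / 2) /\
    Cmod (Cexp (- sg y t) - (1 - RtoC y * Ci - RtoC t))%C <= 3 * eta).
  { intros y T Hy HT Hc. destruct (Cphi y Hy) as [C1 [C2 [C3 C4]]].
    apply (straight_trajectory V P HP V_hol V_period V_bound V_near (phi y) (al y)); try assumption.
    apply HM. lra. }
  assert (Start : forall y, Rabs y <= 1 / 2 -> Cmod (Cexp (- phi y)%C) <= 6 / 5).
  { intros y Hy. destruct (Cphi y Hy) as [_ [_ [_ C4]]]. assert (Hy' := abs_le_between _ _ Hy).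
    assert (N : Cmod (1 - RtoC y * Ci)%C <= 118 / 100).
    { apply Rsqr_incr_0; [|apply Cmod_ge_0|lra]. unfold Rsqr.
      replace (Cmod (1 - RtoC y * Ci)%C * Cmod (1 - RtoC y * Ci)%C) with (Cmod (1 - RtoC y * Ci)%C ^ 2) by ring.
      rewrite Cmod2_alt. replace (Re (1 - RtoC y * Ci)%C) with 1 by (simpl; ring).
      replace (Im (1 - RtoC y * Ci)%C) with (- y) by (simpl; ring). nra. }
    pose proof (Cmod_sub_le (Cexp (- phi y)) (1 - RtoC y * Ci)%C). unfold eta in C4. lra. }
  assert (Low : forall y t, Rabs y <= 1 / 2 -> 0 <= t <= 3 / 2 -> Rbar_lt t (be y) ->
     -3/2 <= Re (sg y t) /\ Cmod (Cexp (- sg y t)%C) <= 6 / 5 + 11 / 10 * t).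
  { intros y t Hy Ht Hb. destruct (HM y ltac:(lra)) as [I0 [S0 [S _]]].
    assert (Der : forall u, 0 <= u <= t -> rder (sg y) u (V (sg y u))).
    { intros u Hu. apply S. split.
      - apply Rbar_lt_le_trans with (Finite 0); [apply I0|simpl; lra].
      - apply Rbar_le_lt_trans with (Finite t); [simpl; lra|exact Hb]. }
    assert (St : Cmod (Cexp (- sg y 0%R)%C) <= 6 / 5) by (rewrite S0; apply Start, Hy).
    split.
    - apply (growth_bound_Re V V_bound (sg y) t Ht Der St). lra.
    - apply (growth_bound V V_bound (sg y) t Ht Der St). lra. }
  assert (Esc : exists y, Rabs y <= 1 / 2 /\ Rbar_le (be y) (3 / 2)).
  { apply NNPP. intros N.
    assert (Long : forall y, Rabs y <= 1 / 2 -> Rbar_lt (3 / 2) (be y)).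
    { intros y Hy. apply Rbar_not_le_lt. intros L. apply N. exists y. split; assumption. }
    (* The real part of [z] is the time and the imaginary part selects the trajectory; [flow_box]
       makes this holomorphic around [1]. *)
    set (S := fun z : C => sg (Im z) (Re z)).
    assert (Box : forall z, Cmod (z - 1)%C < 9 / 20 -> 0 <= Re z <= 3 / 2 /\ Rabs (Im z) < 1 / 2).
    { intros z Hz. pose proof (re_le_Cmod (z - 1)%C) as J1. pose proof (Im_le_Cmod (z - 1)%C) as J2.
      rewrite Re_minus in J1. replace (Im (z - 1)%C) with (Im z) in J2 by (simpl; unfold Im; ring).
      simpl in J1. apply abs_le_between in J1. split; lra. }
    apply (nonvanishing_not_nearly_linear (fun z => Cexp (- S z)%C)).
    - intros z Hz. destruct (Box z Hz) as [Bx By].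
      destruct (flow_box V S phi (3 / 2) (1 / 2) ltac:(lra)) with (y0 := Im z) (x0 := Re z) as [G [r [Hr [HG HS]]]].
      + intros y Hy. apply Hphi. lra.
      + intros y Hy. destruct (HM y ltac:(lra)) as [I0 [S0 [Sol _]]]. split; [exact S0|].
        exists (al y), (be y). split; [exact I0|]. split; [|exact Sol].
        split; [apply Rbar_lt_le_trans with (Finite 0); [apply I0|simpl; lra]|]. apply Long. lra.
      + exact By.
      + exact Bx.
      + assert (Ez : (Re z, Im z) = z) by (destruct z; reflexivity). rewrite Ez in HG.
        destruct (HG z ltac:(rewrite Cmod_sub_self; exact Hr)) as [_ DG].
        eexists. apply (cder_comp (fun z => Cexp (- z)%C) S); [apply cder_Cexp_neg|].
        apply (cder_ext_loc G S z _ (Rmin r (9 / 20 - Cmod (z - 1)%C))); [apply Rmin_glb_lt; lra| |exact DG].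
        intros w Hw. assert (W1 := Rlt_le_trans _ _ _ Hw (Rmin_l _ _)). assert (W2 := Rlt_le_trans _ _ _ Hw (Rmin_r _ _)).
        assert (Ew : (Re w, Im w) = w) by (destruct w; reflexivity). rewrite <- Ew. symmetry. apply HS.
        * eapply Rle_lt_trans; [|exact W1]. apply (re_le_Cmod (w - z)%C).
        * eapply Rle_lt_trans; [|exact W1]. apply (Im_le_Cmod (w - z)%C).
        * apply Box. pose proof (Cmod_tri w z 1%C). lra.
    - intros z _. apply Cexp_neq_0.
    - intros z Hz. destruct (Box z Hz) as [Bx By].
      destruct (Low (Im z) (Re z)) as [_ L2]; [lra|lra|apply Rbar_le_lt_trans with (Finite (3 / 2)); [simpl; lra|apply Long; lra]|].
      unfold S. replace (Cexp (- sg (Im z) (Re z)) + z - 1)%C with (Cexp (- sg (Im z) (Re z)) + (z - 1))%C by ring.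
      (* [growth_bound] contributes at most [6 / 5 + 11 / 10 * (3 / 2) = 57 / 20], and [z - 1] less
         than [9 / 20]. *)
      eapply Rle_trans; [apply Cmod_triangle|]. lra.
    - intros z Hz Hy. destruct (Box z Hz) as [Bx By].
      destruct (Straight (Im z) (3 / 2) ltac:(lra) ltac:(lra) ltac:(lra)) as [_ St].
      destruct (St (Re z) Bx) as [_ [_ St2]]. unfold S.
      replace (Cexp (- sg (Im z) (Re z)) + z - 1)%C with
        (Cexp (- sg (Im z) (Re z)) - (1 - RtoC (Im z) * Ci - RtoC (Re z)))%C; [exact St2|].
      transitivity (Cexp (- sg (Im z) (Re z)) + (RtoC (Re z) + RtoC (Im z) * Ci) - 1)%C; [ring|].
      rewrite <- pair_C. destruct z; reflexivity. }
  destruct Esc as [y [Hy Hb]].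
  destruct (HM y ltac:(lra)) as [I0 [S0 [Sol Max]]].
  pose proof (HM y ltac:(lra)) as Hmax.
  destruct (Straight y (9 / 10) Hy ltac:(lra) ltac:(right; lra)) as [LT St].
  set (b := real (be y)).
  assert (Eb : be y = Finite b) by (unfold b; destruct (be y); simpl in *; [reflexivity|contradiction|contradiction]).
  rewrite Eb in *. simpl in LT, Hb.
  assert (Fwd : forall t, 0 <= t < b -> -3/2 <= Re (sg y t)).
  { intros t Ht. apply Low; [exact Hy|lra|]. rewrite Eb. simpl. lra. }
  destruct (in_interval_near _ _ _ I0) as [e1 [He1 Hn]].
  destruct (rder_cont _ _ _ (proj2 (Sol 0 I0)) (1 / 4) ltac:(lra)) as [e2 [He2 Hc]].
  (* Before time [0] the real part changes by less than [1 / 4] thanks to [e2], hence stays above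
     [-2]. *)
  exists (Rmin e1 e2), b, (sg y). split; [apply Rmin_glb_lt; assumption|]. split; [lra|]. split; [|split].
  - intros t [T1 T2]. pose proof (Rmin_l e1 e2). pose proof (Rmin_r e1 e2).
    destruct (Rle_lt_dec 0 t) as [L|L].
    + split; [specialize (Fwd t ltac:(lra)); lra|]. apply Sol.
      split; [apply Rbar_lt_le_trans with (Finite 0); [apply I0|simpl; lra]|simpl; lra].
    + assert (Ht : Rabs (t - 0) < e1 /\ Rabs (t - 0) < e2) by (rewrite Rabs_left; lra).
      split; [|apply Sol, Hn, Ht]. specialize (Hc t (proj2 Ht)). specialize (Fwd 0 ltac:(lra)).
      pose proof (re_le_Cmod (sg y t - sg y 0%R)%C) as J. rewrite Re_minus in J. apply abs_le_between in J. lra.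
  - apply (blow_up V P HP V_hol V_period V_bound (phi y) (al y) b (sg y)); [exact Hmax|lra|apply Start, Hy].
  - intros t Ht. destruct (St t Ht) as [D1 [D2 _]]. split; [apply D2; lra|exact D1].
Qed.

(** * Rationality from polynomial growth *)

Lemma punctured_nbhd (p : C) (Q : C -> Prop) : locally' p Q ->
  exists r, 0 < r /\ forall z, 0 < Cmod (z - p)%C < r -> Q z.
Proof.
  intros H. unfold locally', within in H. rewrite (locally_C p) in H. destruct H as [d Hd].
  exists d. split; [apply cond_pos|]. intros z Hz. apply Hd; [apply Hz|]. apply Cmod_sub_pos, Hz.
Qed.

Lemma is_pole_nbhd (f : C -> C) (p : C) (K : R) : is_pole f p ->
  exists r, 0 < r /\ forall z, 0 < Cmod (z - p)%C < r -> (exists l, cder f z l) /\ K < Cmod (f z).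
Proof.
  intros [H1 H2].
  destruct (punctured_nbhd p _ H1) as [r1 [Hr1 G1]].
  destruct (punctured_nbhd p (fun z => K < Cmod (f z))) as [r2 [Hr2 G2]].
  { apply (H2 (fun x => K < x)). exists K. auto. }
  exists (Rmin r1 r2). split; [apply Rmin_glb_lt; assumption|]. intros z [Hz Hz2].
  assert (W1 := Rlt_le_trans _ _ _ Hz2 (Rmin_l _ _)). assert (W2 := Rlt_le_trans _ _ _ Hz2 (Rmin_r _ _)).
  split; [|apply G2; split; assumption].
  destruct (G1 z (conj Hz W1)) as [l Hl]. exists l. apply cder_is_derive', Hl.
Qed.

Lemma not_pole_of_hol (f : C -> C) (p : C) : hol f p -> ~ is_pole f p.
Proof.
  intros Hh Hp. destruct (hol_bounded f p Hh) as [rho [M [Hrho [HM [_ HB]]]]].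
  destruct (is_pole_nbhd f p M Hp) as [r [Hr H]].
  set (e := Rmin rho r / 2). assert (He : 0 < e < Rmin rho r).
  { assert (0 < Rmin rho r) by (apply Rmin_glb_lt; assumption). unfold e. lra. }
  assert (E : Cmod (p + RtoC e - p)%C = e).
  { replace (p + RtoC e - p)%C with (RtoC e) by ring. rewrite Cmod_R, Rabs_pos_eq; lra. }
  pose proof (Rmin_l rho r). pose proof (Rmin_r rho r).
  destruct (H (p + RtoC e)%C) as [_ H']; [rewrite E; lra|].
  specialize (HB (p + RtoC e)%C). rewrite E in HB. specialize (HB ltac:(lra)). lra.
Qed.

Lemma meromorphic_cases (f : C -> C) : meromorphic f -> forall z, hol f z <-> ~ is_pole f z.
Proof.
  intros Hf z. split; [apply not_pole_of_hol|]. intros N. destruct (Hf z) as [H|H]; [|contradiction].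
  apply holomorphic_at_hol, H.
Qed.

Lemma cder_pow_shift (p z : C) (k : nat) : exists l, cder (fun w => (w - p) ^ k)%C z l.
Proof.
  apply (cder_pow (fun w => w - p)%C z (1 - 0)%C).
  apply (cder_minus (fun w => w) (fun _ => p)); [apply cder_id|apply cder_const].
Qed.

Lemma Cpow_neq_0 (z : C) (k : nat) : z <> 0%C -> (z ^ k)%C <> 0%C.
Proof. intros H. apply Cmod_gt_0. rewrite Cmod_pow. apply pow_lt, Cmod_gt_0, H. Qed.

(* If no power of [z - p] tamed [f], then [1 / f] would vanish to infinite order at [p]. *)
Lemma pole_order (f : C -> C) (p : C) : hol f p \/ is_pole f p ->
  exists (k : nat) (r B : R), 0 < r /\ forall z, 0 < Cmod (z - p)%C < r -> Cmod (z - p)%C ^ k * Cmod (f z) <= B.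
Proof.
  intros [Hh|Hp].
  { destruct (hol_bounded f p Hh) as [rho [M [Hrho [HM [_ HB]]]]].
    exists 0%nat, rho, M. split; [exact Hrho|]. intros z Hz. simpl. rewrite Rmult_1_l. apply HB, Hz. }
  destruct (is_pole_nbhd f p 1 Hp) as [r0 [Hr0 H0]].
  apply NNPP. intros Hno.
  set (h := fun (k : nat) z => (/ f z / (z - p) ^ k)%C).
  assert (Nz : forall z, 0 < Cmod (z - p)%C < r0 -> f z <> 0%C).
  { intros z Hz. destruct (H0 z Hz) as [_ L]. apply Cmod_gt_0. lra. }
  assert (Nk : forall z k, 0 < Cmod (z - p)%C -> ((z - p) ^ k)%C <> 0%C).
  { intros z k Hz. apply Cpow_neq_0, Cmod_gt_0, Hz. }
  assert (Dh : forall k z, 0 < Cmod (z - p)%C < r0 -> exists l, cder (h k) z l).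
  { intros k z Hz. destruct (H0 z Hz) as [[l Hl] _]. destruct (cder_pow_shift p z k) as [l' Hl'].
    refine (cder_div (fun z => / f z)%C (fun z => (z - p) ^ k)%C z _ l' (cder_inv f z l Hl (Nz z Hz)) Hl' _).
    apply Nk, Hz. }
  assert (Mh : forall k z, 0 < Cmod (z - p)%C < r0 -> Cmod (h k z) = / Cmod (f z) / Cmod (z - p)%C ^ k).
  { intros k z Hz. unfold h. rewrite Cmod_div by (apply Nk, Hz). rewrite Cmod_inv by (apply Nz, Hz).
    rewrite Cmod_pow. reflexivity. }
  (* A bounded [h k] has a limit at [p]. A nonzero limit would bound
     [Cmod (z - p) ^ k * Cmod (f z)], against [Hno]; with limit [0] the linear rate of
     [removable_singularity] bounds [h (S k)]. *)
  assert (Bd : forall k, exists e B, 0 < e < r0 /\ 0 <= B /\ forall z, 0 < Cmod (z - p)%C < e -> Cmod (h k z) <= B).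
  { induction k as [|k [e [B [He [HB IH]]]]].
    - exists (r0 / 2), 1. split; [lra|]. split; [lra|]. intros z Hz. rewrite Mh by lra. simpl.
      unfold Rdiv. rewrite Rinv_1, Rmult_1_r. destruct (H0 z ltac:(lra)) as [_ L].
      rewrite <- Rinv_1. apply Rinv_le_contravar; lra.
    - destruct (removable_singularity (h k) p (e / 2) B) as [l Hl].
      + lra.
      + intros z Hz. apply Dh. lra.
      + intros z Hz. apply IH. lra.
      + set (c := 4 * B / (e / 2)) in *.
        assert (Hc : 0 <= c) by (apply Rmult_le_pos; [lra|left; apply Rinv_0_lt_compat; lra]).
        destruct (classic (l = 0%C)) as [->|Nl].
        * exists (e / 4), c. split; [lra|]. split; [exact Hc|]. intros z Hz.
          specialize (Hl z ltac:(lra)). replace (h k z - 0)%C with (h k z) in Hl by ring.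
          rewrite Mh in * by lra. simpl.
          assert (P1 : 0 < Cmod (z - p)%C ^ k) by (apply pow_lt; lra).
          assert (P2 : 0 < Cmod (f z)) by (apply Cmod_gt_0, Nz; lra).
          replace (/ Cmod (f z) / (Cmod (z - p)%C * Cmod (z - p)%C ^ k)) with
            (/ Cmod (f z) / Cmod (z - p)%C ^ k / Cmod (z - p)%C) by (field; lra).
          apply Rmult_le_reg_r with (Cmod (z - p)%C); [lra|].
          unfold Rdiv at 1. rewrite Rmult_assoc, Rinv_l by lra. lra.
        * exfalso. apply Hno. assert (Hl0 := proj1 (Cmod_gt_0 l) Nl).
          exists k, (Rmin (e / 4) (Cmod l / 2 / (c + 1))), (2 / Cmod l). split.
          { apply Rmin_glb_lt; [lra|]. apply Rdiv_lt_0_compat; lra. }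
          intros z [Hz0 Hz]. assert (W1 := Rlt_le_trans _ _ _ Hz (Rmin_l _ _)).
          assert (W2 := Rlt_le_trans _ _ _ Hz (Rmin_r _ _)).
          specialize (Hl z ltac:(lra)).
          assert (Hsm : c * Cmod (z - p)%C <= Cmod l / 2).
          { apply Rle_trans with ((c + 1) * (Cmod l / 2 / (c + 1))).
            - apply Rmult_le_compat; lra.
            - right. field. lra. }
          assert (Hh : Cmod l / 2 <= Cmod (h k z)).
          { pose proof (Cmod_sub_le l (h k z)) as T. rewrite (Cmod_sub_comm l) in T. lra. }
          rewrite Mh in Hh by lra.
          assert (P1 : 0 < Cmod (z - p)%C ^ k) by (apply pow_lt; lra).
          assert (P2 : 0 < Cmod (f z)) by (apply Cmod_gt_0, Nz; lra).
          replace (Cmod (z - p)%C ^ k * Cmod (f z)) with (/ (/ Cmod (f z) / Cmod (z - p)%C ^ k)) by (field; lra).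
          replace (2 / Cmod l) with (/ (Cmod l / 2)) by (field; lra).
          apply Rinv_le_contravar; [lra|exact Hh]. }
  set (rho := r0 / 2).
  (* On the circle of radius [rho] one has [Cmod (f w) > 1], so this bound does not involve the [e]
     and [B] of [Bd]. At distance [rho / 2] it gives [/ Cmod (f z) <= 1 / 2 ^ k] for all [k]. *)
  assert (Small : forall k z, 0 < Cmod (z - p)%C <= rho -> Cmod (h k z) <= / rho ^ k).
  { intros k z Hz. destruct (Bd k) as [e [B [He [HB Hb]]]].
    apply (max_principle_punctured (h k) p rho _ B); [unfold rho; lra| | | | |exact Hz].
    - intros w Hw. destruct (Dh k w) as [l Hl]; [unfold rho in Hw; lra|]. exact (cder_pcont _ _ _ Hl).
    - intros w Hw. exists (Rmin (Cmod (w - p)%C) (r0 - Cmod (w - p)%C)).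
      split; [apply Rmin_glb_lt; unfold rho in Hw; lra|]. intros u [_ Hu].
      assert (W1 := Rlt_le_trans _ _ _ Hu (Rmin_l _ _)). assert (W2 := Rlt_le_trans _ _ _ Hu (Rmin_r _ _)).
      apply Dh. pose proof (Cmod_tri u w p). pose proof (Cmod_tri w u p). rewrite (Cmod_sub_comm w u) in H1. lra.
    - exists e. split; [lra|]. intros w Hw. split; [apply Dh; lra|apply Hb, Hw].
    - intros w Hw. rewrite Mh by (rewrite Hw; unfold rho; lra). rewrite Hw.
      destruct (H0 w) as [_ L]; [rewrite Hw; unfold rho; lra|].
      assert (0 < rho ^ k) by (apply pow_lt; unfold rho; lra).
      assert (/ Cmod (f w) <= 1) by (rewrite <- Rinv_1; apply Rinv_le_contravar; lra).
      assert (0 < / rho ^ k) by (apply Rinv_0_lt_compat; assumption).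
      unfold Rdiv. nra. }
  set (z := (p + RtoC (rho / 2))%C).
  assert (Ez : Cmod (z - p)%C = rho / 2).
  { unfold z. replace (p + RtoC (rho / 2) - p)%C with (RtoC (rho / 2)) by ring.
    rewrite Cmod_R, Rabs_pos_eq; unfold rho; lra. }
  assert (P2 : 0 < Cmod (f z)) by (apply Cmod_gt_0, Nz; rewrite Ez; unfold rho; lra).
  assert (P3 : 0 < / Cmod (f z)) by (apply Rinv_0_lt_compat, P2).
  assert (/ Cmod (f z) <= 0); [|lra].
  apply (half_pow_lim 1); [lra|]. intros k.
  pose proof (Small k z ltac:(rewrite Ez; unfold rho; lra)) as Hk.
  rewrite Mh, Ez in Hk by (rewrite Ez; unfold rho; lra).
  assert (Q1 : 0 < rho ^ k) by (apply pow_lt; unfold rho; lra).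
  assert (Q2 : 0 < 2 ^ k) by (apply pow_lt; lra).
  assert (E2 : (rho / 2) ^ k = rho ^ k / 2 ^ k).
  { unfold Rdiv at 1. rewrite Rpow_mult_distr, pow_inv. reflexivity. }
  rewrite E2 in Hk.
  apply Rmult_le_compat_r with (r := rho ^ k / 2 ^ k) in Hk; [|left; apply Rdiv_lt_0_compat; assumption].
  replace (/ Cmod (f z) / (rho ^ k / 2 ^ k) * (rho ^ k / 2 ^ k)) with (/ Cmod (f z)) in Hk by (field; lra).
  replace (/ rho ^ k * (rho ^ k / 2 ^ k)) with (1 / 2 ^ k) in Hk by (field; lra). exact Hk.
Qed.

(** * Polynomials and Liouville's theorem *)

Definition polynomial (g : C -> C) : Prop := exists a, forall z, g z = poly_eval a z.

Lemma polynomial_const (c : C) : polynomial (fun _ => c).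
Proof. exists (c :: nil). intros z. simpl. ring. Qed.

Lemma polynomial_plus (g h : C -> C) : polynomial g -> polynomial h -> polynomial (fun z => g z + h z)%C.
Proof.
  intros [a Ha] [b Hb].
  assert (H : forall a b, exists c, forall z, (poly_eval a z + poly_eval b z)%C = poly_eval c z).
  { clear. induction a as [|x a IH]; intros b.
    - exists b. intros z. simpl. ring.
    - destruct b as [|y b].
      + exists (x :: a). intros z. simpl. ring.
      + destruct (IH b) as [c Hc]. exists ((x + y)%C :: c). intros z. simpl.
        fold (poly_eval a z). fold (poly_eval b z). fold (poly_eval c z). rewrite <- Hc. ring. }
  destruct (H a b) as [c Hc]. exists c. intros z. rewrite Ha, Hb. apply Hc.
Qed.

Lemma polynomial_scal (k : C) (g : C -> C) : polynomial g -> polynomial (fun z => k * g z)%C.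
Proof.
  intros [a Ha]. exists (map (fun x => k * x)%C a). intros z. rewrite Ha.
  clear Ha. induction a as [|x a IH]; simpl; [ring|].
  fold (poly_eval a z). fold (poly_eval (map (fun x => k * x)%C a) z). rewrite <- IH. ring.
Qed.

Lemma polynomial_ext (g h : C -> C) : (forall z, g z = h z) -> polynomial g -> polynomial h.
Proof. intros E [a Ha]. exists a. intros z. rewrite <- E. apply Ha. Qed.

Lemma polynomial_mult_linear (b : C) (g : C -> C) : polynomial g -> polynomial (fun z => (z - b) * g z)%C.
Proof.
  intros Hg. apply (polynomial_ext (fun z => z * g z + - b * g z)%C); [intros; ring|].
  apply polynomial_plus; [|apply polynomial_scal, Hg].
  destruct Hg as [a Ha]. exists (RtoC 0 :: a). intros z. simpl. fold (poly_eval a z). rewrite Ha. ring.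
Qed.

Lemma polynomial_mult_pow (b : C) (k : nat) (g : C -> C) : polynomial g -> polynomial (fun z => (z - b) ^ k * g z)%C.
Proof.
  intros Hg. induction k as [|k IH].
  - apply (polynomial_ext g); [intros; simpl; ring|exact Hg].
  - apply (polynomial_ext (fun z => (z - b) * ((z - b) ^ k * g z))%C); [intros; simpl; ring|].
    apply polynomial_mult_linear, IH.
Qed.

Lemma polynomial_growth (g : C -> C) : polynomial g ->
  exists (A : R) (n : nat), 0 <= A /\ forall z, Cmod (g z) <= A * (1 + Cmod z) ^ n.
Proof.
  intros [a Ha].
  assert (H : exists (A : R) (n : nat), 0 <= A /\ forall z, Cmod (poly_eval a z) <= A * (1 + Cmod z) ^ n).
  { clear. induction a as [|x a [A [n [HA IH]]]].
    - exists 0, 0%nat. split; [lra|]. intros z. simpl. rewrite Cmod_0. lra.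
    - exists (Cmod x + A), (S n). pose proof (Cmod_ge_0 x). split; [lra|]. intros z. simpl.
      fold (poly_eval a z). eapply Rle_trans; [apply Cmod_triangle|]. rewrite Cmod_mult.
      specialize (IH z). pose proof (Cmod_ge_0 z).
      assert (1 <= (1 + Cmod z) ^ n) by (apply pow_R1_Rle; lra).
      assert (Cmod z * Cmod (poly_eval a z) <= Cmod z * (A * (1 + Cmod z) ^ n)) by (apply Rmult_le_compat_l; assumption).
      assert (0 <= A * (1 + Cmod z) ^ n) by (apply Rmult_le_pos; lra).
      assert (1 <= (1 + Cmod z) * (1 + Cmod z) ^ n) by nra.
      assert (Cmod x * 1 <= Cmod x * ((1 + Cmod z) * (1 + Cmod z) ^ n)) by (apply Rmult_le_compat_l; assumption).
      lra. }
  destruct H as [A [n [HA H]]]. exists A, n. split; [exact HA|]. intros z. rewrite Ha. apply H.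
Qed.

Lemma finite_avoid (l : list C) (z : C) : exists e, 0 < e /\ forall w, 0 < Cmod (w - z)%C < e -> ~ In w l.
Proof.
  induction l as [|p l [e [He IH]]].
  - exists 1. split; [lra|]. intros w _ H. exact H.
  - destruct (classic (p = z)) as [->|N].
    + exists e. split; [exact He|]. intros w Hw [->|H]; [rewrite Cmod_sub_self in Hw; lra|apply (IH w Hw H)].
    + apply Cmod_sub_pos in N. exists (Rmin e (Cmod (p - z)%C)). split; [apply Rmin_glb_lt; assumption|].
      intros w [Hw0 Hw] [->|H].
      * pose proof (Rmin_r e (Cmod (w - z)%C)). lra.
      * apply (IH w); [|exact H]. split; [exact Hw0|]. apply Rlt_le_trans with (1 := Hw), Rmin_l.
Qed.

Lemma finite_bounded (l : list C) : exists R0, 0 < R0 /\ forall p, In p l -> Cmod p < R0.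
Proof.
  induction l as [|p l [R0 [HR IH]]].
  - exists 1. split; [lra|]. intros p [].
  - exists (Rmax R0 (Cmod p + 1)). split; [apply Rlt_le_trans with (1 := HR), Rmax_l|].
    intros q [->|H].
    + apply Rlt_le_trans with (Cmod q + 1); [lra|apply Rmax_r].
    + apply Rlt_le_trans with (1 := IH q H), Rmax_l.
Qed.

(** Passing to the difference quotient at a point [b] lowers the growth exponent by one, and
    [g z = g b + (z - b) * dquot g b d z] recovers [g]. The list [l] collects the points where only
    continuity is known; each step adds [b] to it. *)
Lemma liouville_polynomial (m : nat) : forall (g : C -> C) (l : list C) (A R0 : R),
  (forall z, pcont g z) -> (forall z, ~ In z l -> exists d, cder g z d) ->
  (forall z, R0 <= Cmod z -> Cmod (g z) <= A * Cmod z ^ m) -> polynomial g.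
Proof.
  assert (Hol : forall (g : C -> C) l, (forall z, ~ In z l -> exists d, cder g z d) ->
     forall z, exists e, 0 < e /\ forall w, 0 < Cmod (w - z)%C < e -> exists d, cder g w d).
  { intros g l H z. destruct (finite_avoid l z) as [e [He Hav]]. exists e. split; [exact He|].
    intros w Hw. apply H, Hav, Hw. }
  assert (Pick : forall l : list C, exists b, ~ In b l).
  { intros l. destruct (finite_bounded l) as [R1 [HR1 Hl]]. exists (RtoC R1). intros H.
    specialize (Hl _ H). rewrite Cmod_R, Rabs_pos_eq in Hl; lra. }
  assert (Quot : forall g l b d, (forall z, pcont g z) -> (forall z, ~ In z l -> exists d, cder g z d) -> cder g b d ->
     (forall z, pcont (dquot g b d) z) /\ (forall z, ~ In z (b :: l) -> exists d', cder (dquot g b d) z d')).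
  { intros g l b d Hc Hg Hb. split.
    - intros z. destruct (classic (z = b)) as [->|N]; [apply dquot_pcont, Hb|].
      assert (L := proj1 (Cmod_sub_pos z b) N).
      apply pcont_ext with (f := fun w => ((g w - g b) * / (w - b))%C) (d := Cmod (z - b)%C); [exact L| |].
      + intros w Hw. symmetry. apply dquot_eq, Cmod_sub_pos.
        pose proof (Cmod_tri z w b) as T. rewrite (Cmod_sub_comm z w) in T. lra.
      + apply (pcont_mult (fun w => g w - g b)%C (fun w => / (w - b))%C).
        * intros e He. destruct (Hc z e He) as [dl [Hdl H]]. exists dl. split; [exact Hdl|].
          intros w Hw. replace (g w - g b - (g z - g b))%C with (g w - g z)%C by ring. apply H, Hw.
        * eapply cder_pcont. apply (cder_inv (fun w => w - b)%C); [|apply Csub_neq0, N].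
          apply (cder_minus (fun w => w) (fun _ => b)); [apply cder_id|apply cder_const].
    - intros z Hz. destruct (Hg z) as [dz Hdz]; [intros H; apply Hz; right; exact H|].
      apply dquot_cder with dz; [|exact Hdz]. intros ->. apply Hz. left. reflexivity. }
  induction m as [|m IH]; intros g l A R0 Hc Hg HA.
  - destruct (Pick l) as [b Hb]. destruct (Hg b Hb) as [d Hd].
    destruct (Quot g l b d Hc Hg Hd) as [Qc Qd].
    apply (polynomial_ext (fun _ => g b)); [|apply polynomial_const].
    intros z. set (K := Rabs A + Cmod (g b)).
    assert (HK : 0 <= K) by (unfold K; pose proof (Rabs_pos A); pose proof (Cmod_ge_0 (g b)); lra).
    set (R1 := 1 + Rabs R0 + Cmod z + Cmod b).
    assert (HR1 : 1 <= R1 /\ R0 <= R1 /\ Cmod z <= R1 /\ Cmod b <= R1).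
    { unfold R1. pose proof (Rle_abs R0). pose proof (Cmod_ge_0 z). pose proof (Cmod_ge_0 b). pose proof (Rabs_pos R0). lra. }
    assert (E : Cmod (dquot g b d z) <= 0).
    (* For bounded [g] the quotient is at most [K / 2 ^ n] on the circle of radius [R1 + 2 ^ n],
       hence by the maximum principle also at [z]. *)
    { apply (half_pow_lim K _ HK). intros n. assert (P : 1 <= 2 ^ n) by (apply pow_R1_Rle; lra).
      set (R2 := R1 + 2 ^ n).
      apply (max_principle (dquot g b d) 0%C R2); [unfold R2; lra| | | |].
      - intros w _. apply Qc.
      - intros w _. apply (Hol _ _ Qd).
      - intros w Hw. replace (w - 0)%C with w in Hw by ring.
        assert (Dw : 2 ^ n <= Cmod (w - b)%C) by (pose proof (Cmod_sub_le w b); unfold R2 in Hw; lra).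
        assert (N : w <> b) by (apply Cmod_sub_pos; lra).
        rewrite dquot_eq, Cmod_div by (try apply Csub_neq0; exact N).
        specialize (HA w ltac:(unfold R2 in Hw; lra)). simpl in HA. rewrite Rmult_1_r in HA.
        pose proof (Cmod_minus_le (g w) (g b)). pose proof (Rle_abs A).
        apply Rmult_le_compat; [apply Cmod_ge_0| |unfold K; lra|].
        + left. apply Rinv_0_lt_compat. lra.
        + apply Rinv_le_contravar; lra.
      - replace (z - 0)%C with z by ring. unfold R2. lra. }
    assert (E0 : dquot g b d z = 0%C) by (apply Cmod_eq_0; pose proof (Cmod_ge_0 (dquot g b d z)); lra).
    pose proof (dquot_mult g b d z) as E1. rewrite E0 in E1.
    replace (g z) with (g z - g b + g b)%C by ring. rewrite E1. ring.
  - destruct (Pick l) as [b Hb]. destruct (Hg b Hb) as [d Hd].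
    destruct (Quot g l b d Hc Hg Hd) as [Qc Qd].
    apply (polynomial_ext (fun z => g b + (z - b) * dquot g b d z)%C).
    { intros z. rewrite (Cmult_comm (z - b)%C), <- dquot_mult. ring. }
    apply (polynomial_plus (fun _ => g b)); [apply polynomial_const|].
    apply polynomial_mult_linear.
    apply (IH _ (b :: l) (2 * (Rabs A + Cmod (g b))) (1 + Rabs R0 + 2 * Cmod b) Qc Qd).
    intros z Hz. pose proof (Rle_abs R0). pose proof (Cmod_ge_0 b). pose proof (Rabs_pos R0).
    set (x := Cmod z) in *.
    assert (Dz : x / 2 <= Cmod (z - b)%C) by (pose proof (Cmod_sub_le z b); fold x in H2; lra).
    assert (N : z <> b) by (apply Cmod_sub_pos; lra).
    rewrite dquot_eq, Cmod_div by (try apply Csub_neq0; exact N).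
    specialize (HA z ltac:(fold x; lra)). fold x in HA. simpl in HA.
    assert (Px : 1 <= x ^ m) by (apply pow_R1_Rle; lra).
    assert (Num : Cmod (g z - g b)%C <= (Rabs A + Cmod (g b)) * (x * x ^ m)).
    { pose proof (Cmod_minus_le (g z) (g b)). pose proof (Rle_abs A). pose proof (Cmod_ge_0 (g b)).
      assert (1 <= x * x ^ m) by nra. nra. }
    apply Rle_trans with ((Rabs A + Cmod (g b)) * (x * x ^ m) * / (x / 2)).
    + apply Rmult_le_compat; [apply Cmod_ge_0| |exact Num|].
      * left. apply Rinv_0_lt_compat. lra.
      * apply Rinv_le_contravar; lra.
    + right. field. lra.
Qed.

(** The exponent [k p] will make the product with [f] bounded near [p]; the extra factor in
    [S (k p)] makes it tend to [0], so that the value [0] on [l] is the continuous one. *)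
Definition denominator (k : C -> nat) (l : list C) (z : C) : C :=
  fold_right (fun p acc => (z - p) ^ S (k p) * acc)%C 1%C l.

Lemma denominator_cons (k : C -> nat) (p : C) (l : list C) (z : C) :
  denominator k (p :: l) z = ((z - p) ^ S (k p) * denominator k l z)%C.
Proof. reflexivity. Qed.

Lemma denominator_polynomial (k : C -> nat) (l : list C) : polynomial (denominator k l).
Proof.
  induction l as [|p l IH].
  - exists (RtoC 1 :: nil). intros z. simpl. ring.
  - apply (polynomial_ext (fun z => (z - p) ^ S (k p) * denominator k l z)%C); [reflexivity|].
    apply polynomial_mult_pow, IH.
Qed.

Lemma denominator_neq_0 (k : C -> nat) (l : list C) (z : C) : ~ In z l <-> denominator k l z <> 0%C.
Proof.
  induction l as [|p l IH].
  - split; [intros _; intros E; apply (f_equal fst) in E; simpl in E; lra|intros _ []].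
  - rewrite denominator_cons. split.
    + intros H. apply Cmult_neq_0.
      * apply Cpow_neq_0, Csub_neq0. intros ->. apply H. left. reflexivity.
      * apply IH. intros H'. apply H. right. exact H'.
    + intros H [->|H'].
      * apply H. simpl. ring.
      * apply IH in H'; [exact H'|]. intros E. apply H. rewrite E. ring.
Qed.

Lemma denominator_vanishing (k : C -> nat) (l : list C) (p : C) : In p l ->
  exists B, forall z, Cmod (z - p)%C < 1 -> Cmod (denominator k l z) <= B * Cmod (z - p)%C ^ S (k p).
Proof.
  assert (Loc : forall l, exists B, 0 <= B /\ forall z, Cmod (z - p)%C < 1 -> Cmod (denominator k l z) <= B).
  { intros l'. destruct (polynomial_growth _ (denominator_polynomial k l')) as [A [n [HA H]]].
    exists (A * (2 + Cmod p) ^ n). pose proof (Cmod_ge_0 p). split.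
    - apply Rmult_le_pos; [exact HA|apply pow_le; lra].
    - intros z Hz. eapply Rle_trans; [apply H|]. apply Rmult_le_compat_l; [exact HA|].
      apply pow_incr. pose proof (Cmod_ge_0 z). pose proof (Cmod_sub_le z p). lra. }
  induction l as [|q l IH]; [intros []|]. intros Hin.
  destruct (classic (q = p)) as [->|N].
  - destruct (Loc l) as [B [HB H]]. exists B. intros z Hz. rewrite denominator_cons, Cmod_mult, Cmod_pow.
    rewrite Rmult_comm. apply Rmult_le_compat_r; [apply pow_le, Cmod_ge_0|apply H, Hz].
  - destruct Hin as [E|Hin]; [contradiction|]. destruct (IH Hin) as [B H].
    exists ((1 + Cmod (p - q)%C) ^ S (k q) * B). intros z Hz. rewrite denominator_cons, Cmod_mult, Cmod_pow, Rmult_assoc.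
    apply Rmult_le_compat; [apply pow_le, Cmod_ge_0|apply Cmod_ge_0| |apply H, Hz].
    apply pow_incr. split; [apply Cmod_ge_0|]. pose proof (Cmod_tri z p q). lra.
Qed.

Lemma polynomial_cder (g : C -> C) (z : C) : polynomial g -> exists l, cder g z l.
Proof.
  intros [a Ha]. revert g Ha. induction a as [|x a IH]; intros g Ha.
  - exists 0%C. apply (cder_ext_loc (fun _ => 0%C) g z _ 1); [lra|intros w _; symmetry; apply Ha|apply (cder_const 0%C)].
  - destruct (IH (poly_eval a) (fun _ => eq_refl)) as [l Hl]. eexists.
    apply (cder_ext_loc (fun z => x + z * poly_eval a z)%C g z _ 1); [lra|intros w _; symmetry; apply Ha|].
    apply (cder_plus (fun _ => x) (fun z => z * poly_eval a z)%C); [apply cder_const|].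
    apply (cder_mult (fun z => z) (poly_eval a)); [apply cder_id|exact Hl].
Qed.

(** The product of [f] with its denominator, set to [0] on [l], is continuous, differentiable off
    [l] and of polynomial growth, hence a polynomial. Points of [l] that are not poles are treated
    alike, as [pole_order] covers them. *)
Lemma rational_of_polynomial_growth (f : C -> C) (A R0 : R) (m : nat) :
  meromorphic f -> finitely_many_poles f ->
  (forall z, R0 <= Cmod z -> Cmod (f z) <= A * Cmod z ^ m) -> rational f.
Proof.
  intros Hf [l Hl] HA.
  assert (Ord : forall p, exists k : nat, exists r B, 0 < r /\ forall z, 0 < Cmod (z - p)%C < r -> Cmod (z - p)%C ^ k * Cmod (f z) <= B).
  { intros p. apply pole_order. destruct (Hf p) as [H|H]; [left; apply holomorphic_at_hol, H|right; exact H]. }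
  destruct (choice _ Ord) as [k Hk].
  set (q := denominator k l).
  set (g := fun z => if excluded_middle_informative (In z l) then RtoC 0 else (q z * f z)%C).
  assert (Gout : forall z, ~ In z l -> g z = (q z * f z)%C).
  { intros z Hz. unfold g. destruct (excluded_middle_informative (In z l)); [contradiction|reflexivity]. }
  assert (Gin : forall z, In z l -> g z = 0%C).
  { intros z Hz. unfold g. destruct (excluded_middle_informative (In z l)); [reflexivity|contradiction]. }
  assert (Gd : forall z, ~ In z l -> exists d, cder g z d).
  { intros z Hz. destruct (finite_avoid l z) as [e [He Hav]].
    destruct (hol_cder f z) as [d Hd]; [apply meromorphic_cases; [exact Hf|]; intros Hp; apply Hz, Hl, Hp|].
    destruct (polynomial_cder q z (denominator_polynomial k l)) as [d' Hd'].
    eexists. apply (cder_ext_loc (fun z => q z * f z)%C g z _ e He); [|apply (cder_mult q f); eassumption].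
    intros w Hw. symmetry. apply Gout. destruct (classic (w = z)) as [->|N]; [exact Hz|].
    apply Hav. split; [apply Cmod_sub_pos, N|exact Hw]. }
  assert (Gc : forall z, pcont g z).
  { intros z. destruct (classic (In z l)) as [Hz|Hz].
    - intros eps Heps. destruct (Hk z) as [r [B [Hr HB]]].
      destruct (denominator_vanishing k l z Hz) as [B' HB'].
      set (c := Rabs B * Rabs B' + 1). assert (Hc : 0 < c) by (unfold c; pose proof (Rabs_pos B); pose proof (Rabs_pos B'); nra).
      exists (Rmin (Rmin r 1) (eps / c)). split; [repeat apply Rmin_glb_lt; try lra; apply Rdiv_lt_0_compat; lra|].
      intros w Hw. assert (W1 := Rlt_le_trans _ _ _ Hw (Rmin_l _ _)). assert (W2 := Rlt_le_trans _ _ _ Hw (Rmin_r _ _)).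
      assert (W3 := Rlt_le_trans _ _ _ W1 (Rmin_l _ _)). assert (W4 := Rlt_le_trans _ _ _ W1 (Rmin_r _ _)).
      rewrite (Gin z Hz). replace (g w - 0)%C with (g w) by ring.
      destruct (classic (In w l)) as [Hwl|Hwl]; [rewrite Gin by exact Hwl; rewrite Cmod_0; exact Heps|].
      assert (Nw : 0 < Cmod (w - z)%C) by (apply Cmod_sub_pos; intros ->; contradiction).
      rewrite Gout by exact Hwl. rewrite Cmod_mult.
      specialize (HB w (conj Nw W3)). specialize (HB' w W4). fold (q w) in HB'. simpl in HB'.
      set (d := Cmod (w - z)%C) in *. set (F := Cmod (f w)) in *. set (D := d ^ k z) in *.
      assert (PF : 0 <= F) by apply Cmod_ge_0. assert (PD : 0 < D) by (apply pow_lt; exact Nw).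
      assert (S1 : Cmod (q w) * F <= Rabs B' * (d * D) * F).
      { apply Rmult_le_compat_r; [exact PF|]. eapply Rle_trans; [exact HB'|].
        apply Rmult_le_compat_r; [nra|apply Rle_abs]. }
      assert (S2 : D * F <= Rabs B) by (pose proof (Rle_abs B); lra).
      assert (S3 : Rabs B' * (d * D) * F <= Rabs B' * d * Rabs B).
      { replace (Rabs B' * (d * D) * F) with (Rabs B' * d * (D * F)) by ring.
        apply Rmult_le_compat_l; [|exact S2]. apply Rmult_le_pos; [apply Rabs_pos|lra]. }
      apply Rle_lt_trans with (c * d); [unfold c; lra|].
      replace eps with (c * (eps / c)) by (field; lra). apply Rmult_lt_compat_l; lra.
    - destruct (Gd z Hz) as [d Hd]. exact (cder_pcont _ _ _ Hd). }
  destruct (polynomial_growth q (denominator_polynomial k l)) as [A' [n [HA' Hq]]].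
  destruct (finite_bounded l) as [R1 [HR1 Hl1]].
  destruct (liouville_polynomial (n + m) g l (A' * 2 ^ n * Rabs A) (1 + Rabs R0 + R1) Gc Gd) as [a Ha].
  { intros z Hz. pose proof (Rle_abs R0). pose proof (Rabs_pos R0).
    rewrite Gout by (intros H'; specialize (Hl1 z H'); lra). rewrite Cmod_mult.
    specialize (Hq z). specialize (HA z ltac:(lra)). set (x := Cmod z) in *.
    assert (Px : 0 <= x ^ m) by (apply pow_le; lra).
    rewrite pow_add.
    apply Rle_trans with (A' * 2 ^ n * x ^ n * (Rabs A * x ^ m)); [|right; ring].
    apply Rmult_le_compat; try apply Cmod_ge_0.
    - eapply Rle_trans; [exact Hq|]. rewrite Rmult_assoc. apply Rmult_le_compat_l; [exact HA'|].
      rewrite <- Rpow_mult_distr. apply pow_incr. lra.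
    - eapply Rle_trans; [exact HA|]. apply Rmult_le_compat_r; [exact Px|apply Rle_abs]. }
  destruct (denominator_polynomial k l) as [b Hb].
  exists a, b. split.
  - exists (RtoC R1). rewrite <- Hb. apply denominator_neq_0. intros H. specialize (Hl1 _ H).
    rewrite Cmod_R, Rabs_pos_eq in Hl1; lra.
  - intros z _ Hz. rewrite <- Hb in *. assert (Nz := proj2 (denominator_neq_0 k l z) Hz).
    rewrite <- Ha, Gout by exact Nz. unfold q. field. exact Hz.
Qed.

(** * Points of exponential growth *)

Lemma exp_mult_INR (n : nat) (x : R) : exp (INR n * x) = exp x ^ n.
Proof.
  induction n as [|n IH]; [simpl; rewrite Rmult_0_l; apply exp_0|].
  rewrite S_INR, Rmult_plus_distr_r, Rmult_1_l, exp_plus, IH. simpl. ring.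
Qed.

Lemma hol_comp_entire (f h h' : C -> C) (z : C) : (forall w, cder h w (h' w)) -> hol f (h z) -> hol (fun w => f (h w)) z.
Proof.
  intros Hh [r [Hr Hf]]. destruct (cder_cont h z _ (Hh z) r Hr) as [d [Hd Hc]].
  exists d. split; [exact Hd|]. intros w Hw. destruct (Hf (h w) (Hc w Hw)) as [l Hl].
  eexists. apply (cder_comp f h); [exact Hl|apply Hh].
Qed.

Lemma hol_mult (f g : C -> C) (z : C) : hol f z -> hol g z -> hol (fun w => f w * g w)%C z.
Proof.
  intros [r1 [Hr1 H1]] [r2 [Hr2 H2]]. exists (Rmin r1 r2). split; [apply Rmin_glb_lt; assumption|].
  intros w Hw. destruct (H1 w (Rlt_le_trans _ _ _ Hw (Rmin_l _ _))) as [l1 L1].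
  destruct (H2 w (Rlt_le_trans _ _ _ Hw (Rmin_r _ _))) as [l2 L2].
  eexists. apply (cder_mult f g); eassumption.
Qed.

Lemma hol_entire (f f' : C -> C) (z : C) : (forall w, cder f w (f' w)) -> hol f z.
Proof. intros H. exists 1. split; [lra|]. intros w _. exists (f' w). apply H. Qed.

Lemma cder_Cexp_scal (k : C) (z : C) : cder (fun w => Cexp (k * w)%C) z (Cexp (k * z) * k)%C.
Proof.
  apply (cder_comp Cexp (fun w => k * w)%C); [apply cder_Cexp|].
  eapply cder_eq; [apply (cder_mult (fun _ => k) (fun w => w)); [apply cder_const|apply cder_id]|ring].
Qed.

Lemma Cexp_period (s : C) : Cexp (s + RtoC (2 * PI) * Ci)%C = Cexp s.
Proof.
  rewrite Cexp_plus. pose proof (Cexp_2PI 1) as H. simpl INR in H. rewrite Rmult_1_r in H.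
  rewrite H. ring.
Qed.

(* Schwarz-Pick at the point [1] for maps into the disc of radius [M]. *)
Lemma near_one_of_bound (H : C -> C) (r R0 M : R) : 0 < r < R0 -> 1 < M ->
  (forall w, Cmod (w - 0)%C < R0 -> exists l, cder H w l) ->
  (forall w, Cmod (w - 0)%C < R0 -> Cmod (H w) <= M) -> H 0%C = 1%C ->
  forall w, Cmod w <= r / 2 -> Cmod (H w - 1)%C <= M * M - 1.
Proof.
  intros Hr HM Hd HB H1 w Hw.
  assert (Z0 : Cmod (0 - 0)%C < R0) by (rewrite Cmod_sub_self; lra).
  destruct (Hd 0%C Z0) as [l Hl].
  (* [M * (H - 1) / (M ^ 2 - H)] is the Moebius map of the disc of radius [M] onto the unit disc
     that sends [1] to [0]; the function [phi] below is this expression divided by [M * w]. *)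
  set (den := fun w => (RtoC (M * M) - H w)%C).
  assert (Nden : forall w, Cmod (w - 0)%C < R0 -> den w <> 0%C).
  { intros u Hu E. specialize (HB u Hu). unfold den in E.
    assert (E' : H u = RtoC (M * M)) by (transitivity (RtoC (M * M) - (RtoC (M * M) - H u))%C; [ring|rewrite E; ring]).
    rewrite E', Cmod_R, Rabs_pos_eq in HB; nra. }
  assert (Dden : forall w, Cmod (w - 0)%C < R0 -> exists l, cder (fun w => / den w)%C w l).
  { intros u Hu. destruct (Hd u Hu) as [lu Hlu]. eexists. apply cder_inv; [|apply Nden, Hu].
    apply (cder_minus (fun _ => RtoC (M * M)) H); [apply cder_const|exact Hlu]. }
  set (phi := fun w => (dquot H 0 l w * / den w)%C).
  assert (Dphi : forall u : C, u <> 0%C -> Cmod (u - 0)%C < R0 -> exists k, cder phi u k).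
  { intros u Nu Hu. destruct (Hd u Hu) as [lu Hlu]. destruct (Dden u Hu) as [ld Hld].
    destruct (dquot_cder H 0%C l u lu Nu Hlu) as [k Hk].
    eexists. apply (cder_mult (dquot H 0 l) (fun w => / den w)%C); eassumption. }
  assert (Q : Cmod (phi w) <= / (r * M)).
  { apply (max_principle phi 0%C r); [lra| | | |replace (w - 0)%C with w by ring; lra].
    - intros u Hu. apply (pcont_mult (dquot H 0 l) (fun w => / den w)%C).
      + destruct (classic (u = 0%C)) as [->|N]; [apply dquot_pcont, Hl|].
        destruct (Hd u ltac:(lra)) as [lu Hlu]. destruct (dquot_cder H 0%C l u lu N Hlu) as [k Hk].
        exact (cder_pcont _ _ _ Hk).
      + destruct (Dden u ltac:(lra)) as [ld Hld]. exact (cder_pcont _ _ _ Hld).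
    - intros u Hu. destruct (classic (u = 0%C)) as [->|N].
      + exists R0. split; [lra|]. intros x Hx. apply Dphi; [apply Cmod_sub_pos, Hx|apply Hx].
      + apply Cmod_sub_pos in N. exists (Rmin (Cmod (u - 0)%C) (R0 - r)). split; [apply Rmin_glb_lt; lra|].
        intros x [_ Hx]. assert (W1 := Rlt_le_trans _ _ _ Hx (Rmin_l _ _)). assert (W2 := Rlt_le_trans _ _ _ Hx (Rmin_r _ _)).
        pose proof (Cmod_tri x u 0%C). pose proof (Cmod_tri u x 0%C). rewrite (Cmod_sub_comm u x) in H2.
        apply Dphi; [apply Cmod_sub_pos; lra|lra].
    - intros u Hu. assert (Hu' : Cmod (u - 0)%C < R0) by lra.
      assert (N : u <> 0%C) by (apply Cmod_sub_pos; lra).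
      unfold phi. rewrite dquot_eq by exact N. rewrite Cmod_mult, Cmod_div by (apply Csub_neq0, N).
      rewrite Cmod_inv by (apply Nden, Hu'). rewrite Hu, H1.
      assert (Pd := proj1 (Cmod_gt_0 _) (Nden u Hu')).
      (* The squares differ by [(M ^ 2 - 1) * (M ^ 2 - Cmod (H u) ^ 2)], which is nonnegative. *)
      assert (Alg : M * Cmod (H u - 1)%C <= Cmod (den u)).
      { apply Rsqr_incr_0; [|apply Rmult_le_pos; [lra|apply Cmod_ge_0]|apply Cmod_ge_0]. unfold Rsqr.
        assert (E1 : Cmod (H u - 1)%C * Cmod (H u - 1)%C = (Re (H u) - 1) ^ 2 + Im (H u) ^ 2).
        { transitivity (Cmod (H u - 1)%C ^ 2); [ring|]. rewrite Cmod2_alt. simpl. unfold Re, Im. ring. }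
        assert (E2 : Cmod (den u) * Cmod (den u) = (M * M - Re (H u)) ^ 2 + Im (H u) ^ 2).
        { transitivity (Cmod (den u) ^ 2); [ring|]. unfold den. rewrite Cmod2_alt. simpl. unfold Re, Im. ring. }
        assert (E3 : Re (H u) ^ 2 + Im (H u) ^ 2 <= M ^ 2).
        { rewrite <- Cmod2_alt. apply pow_incr. split; [apply Cmod_ge_0|apply HB, Hu']. }
        replace (M * Cmod (H u - 1)%C * (M * Cmod (H u - 1)%C)) with (M * M * (Cmod (H u - 1)%C * Cmod (H u - 1)%C)) by ring.
        rewrite E1, E2. set (x := Re (H u)) in *. set (y := Im (H u)) in *.
        assert (0 <= (M * M - 1) * (M ^ 2 - (x ^ 2 + y ^ 2))) by (apply Rmult_le_pos; nra).
        lra. }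
      apply Rmult_le_reg_r with (r * M * Cmod (den u)); [apply Rmult_lt_0_compat; nra|].
      replace (Cmod (H u - 1)%C / r * / Cmod (den u) * (r * M * Cmod (den u))) with (M * Cmod (H u - 1)%C) by (field; lra).
      replace (/ (r * M) * (r * M * Cmod (den u))) with (Cmod (den u)) by (field; lra). exact Alg. }
  assert (Hw' : Cmod (w - 0)%C < R0) by (replace (w - 0)%C with w by ring; lra).
  assert (Pd := proj1 (Cmod_gt_0 _) (Nden w Hw')).
  unfold phi in Q. rewrite Cmod_mult, Cmod_inv in Q by (apply Nden, Hw').
  set (q := Cmod (dquot H 0 l w)) in *. set (D := Cmod (den w)) in *. set (X := Cmod (H w - 1)%C).
  assert (EX : X = q * Cmod w).
  { unfold X, q. rewrite <- H1 at 1. rewrite (dquot_mult H 0%C l w), Cmod_mult. f_equal. f_equal. ring. }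
  assert (HD : D <= M * M - 1 + X).
  { unfold D, den, X. replace (RtoC (M * M) - H w)%C with (RtoC (M * M - 1) - (H w - 1))%C by (rewrite RtoC_minus; ring).
    eapply Rle_trans; [apply Cmod_minus_le|]. rewrite Cmod_R, Rabs_pos_eq by nra. lra. }
  assert (Hq : q * (r * M) <= D).
  { apply Rmult_le_compat_r with (r := r * M * D) in Q; [|apply Rmult_le_pos; [nra|lra]].
    replace (q * / D * (r * M * D)) with (q * (r * M)) in Q by (field; lra).
    replace (/ (r * M) * (r * M * D)) with D in Q by (field; lra). exact Q. }
  assert (Hq0 : 0 <= q) by apply Cmod_ge_0.
  (* In the chain [2 * X <= q * r <= D <= M * M - 1 + X] the last [X] is absorbed on the left. *)
  assert (X2 : 2 * X <= q * r) by (rewrite EX; nra).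
  assert (q * r <= q * (r * M)) by (apply Rmult_le_compat_l; nra).
  lra.
Qed.

Section Selection.
Variables (f : C -> C) (a : R).
Hypothesis Ha : 1 <= a.
Hypothesis f_hol : forall z, exp a <= Cmod z -> hol f z.

(* Under [z = exp s], the equation [z' = f z] becomes [s' = logfield s]. *)
Definition logfield (s : C) : C := (f (Cexp s) * Cexp (- s))%C.

Lemma logfield_hol (s : C) : a <= Re s -> hol logfield s.
Proof.
  intros Hs. apply (hol_mult (fun s => f (Cexp s)) (fun s => Cexp (- s)%C)).
  - apply (hol_comp_entire f Cexp Cexp); [apply cder_Cexp|]. apply f_hol. rewrite Cmod_Cexp. apply exp_le, Hs.
  - apply (hol_entire _ (fun s => - Cexp (- s))%C). intros w. apply cder_Cexp_neg.
Qed.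

Lemma logfield_period (s : C) : logfield (s + RtoC (2 * PI) * Ci)%C = logfield s.
Proof.
  unfold logfield. rewrite !Cexp_opp, Cexp_period. reflexivity.
Qed.

(** With [z = exp s] this is [Cmod (f z) / Cmod z ^ (n + 1)]. *)
Definition tilted (n : nat) (s : C) : R := Cmod (logfield s) * exp (- (INR n * Re s)).

Lemma tilted_period (n : nat) (s : C) : tilted n (s + RtoC (2 * PI) * Ci)%C = tilted n s.
Proof.
  unfold tilted. rewrite logfield_period, Re_plus.
  replace (Re (RtoC (2 * PI) * Ci)%C) with 0 by (simpl; ring). rewrite Rplus_0_r. reflexivity.
Qed.

Lemma tilted_Cmod (n : nat) (s : C) : tilted n s = Cmod (logfield s * Cexp (RtoC (- INR n) * s))%C.
Proof.
  unfold tilted. rewrite Cmod_mult, Cmod_Cexp, Re_scal. f_equal. f_equal. ring.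
Qed.

Lemma tilted_cont (n : nat) (s : C) : a <= Re s -> forall eps, 0 < eps -> exists e, 0 < e /\
  forall w, Cmod (w - s)%C < e -> Rabs (tilted n w - tilted n s) < eps.
Proof.
  intros Hs eps Heps. destruct (hol_cder _ _ (logfield_hol s Hs)) as [l Hl].
  destruct (cder_cont (fun s => logfield s * Cexp (RtoC (- INR n) * s))%C s _
    (cder_mult _ _ _ _ _ Hl (cder_Cexp_scal (RtoC (- INR n)) s)) eps Heps) as [d [Hd Hc]].
  exists d. split; [exact Hd|]. intros w Hw. rewrite !tilted_Cmod. specialize (Hc w Hw).
  pose proof (Cmod_sub_le (logfield w * Cexp (RtoC (- INR n) * w))%C (logfield s * Cexp (RtoC (- INR n) * s))%C).
  pose proof (Cmod_sub_le (logfield s * Cexp (RtoC (- INR n) * s))%C (logfield w * Cexp (RtoC (- INR n) * w))%C) as H2.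
  rewrite Cmod_sub_comm in H2. apply Rabs_def1; lra.
Qed.

(** Otherwise, for all [x >= x0], the maximum of [tilted n] up to [Re s = 5 * x] would be at most
    [K] times that up to [x]. Iterated along [x0], [5 * x0], [25 * x0] and so on, this bounds
    [tilted n] by a multiple of [exp (m * Re s)], and so [f] by a power of [Cmod z]. *)
Lemma growth_jump (n : nat) (K x0 : R) :
  (forall (A R0 : R) (m : nat), ~ forall z, R0 <= Cmod z -> Cmod (f z) <= A * Cmod z ^ m) ->
  0 < K -> a <= x0 ->
  exists x s1, x0 <= x /\ a <= Re s1 <= 5 * x /\ forall s, a <= Re s <= x -> K * tilted n s < tilted n s1.
Proof.
  intros Hf HK Hx0. apply NNPP. intros Hno.
  assert (Weak : forall x s1, x0 <= x -> a <= Re s1 <= 5 * x ->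
    exists s, a <= Re s <= x /\ tilted n s1 <= K * tilted n s).
  { intros x s1 Hx Hs1. apply NNPP. intros N. apply Hno. exists x, s1. split; [exact Hx|]. split; [exact Hs1|].
    intros s Hs. apply Rnot_le_lt. intros L. apply N. exists s. split; assumption. }
  assert (HPI : 0 < 2 * PI) by (pose proof PI_RGT_0; lra).
  destruct (periodic_strip_max (tilted n) (2 * PI) a (5 * x0) HPI ltac:(lra)) as [z0 [K0 Hmax]].
  { intros z _. apply tilted_period. }
  { intros z Hz eps Heps. destruct (tilted_cont n z (proj1 Hz) eps Heps) as [e [He Hc]].
    exists e. split; [exact He|]. intros w _ Hw. specialize (Hc w Hw). apply Rabs_def2 in Hc. lra. }
  set (M0 := tilted n z0) in *.
  assert (Tpos : forall s, 0 <= tilted n s).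
  { intros s. unfold tilted. apply Rmult_le_pos; [apply Cmod_ge_0|left; apply exp_pos]. }
  destruct (INR_unbounded K) as [m Hm]. pose proof (pos_INR m) as Hm0.
  (* Each step costs a factor [K <= exp m], which is affordable since [1 + Re s / 5 <= Re s]. *)
  assert (Claim : forall k s, a <= Re s <= 5 ^ S k * x0 -> tilted n s <= M0 * exp (INR m * Re s)).
  { induction k as [|k IH]; intros s Hs.
    - simpl in Hs. rewrite Rmult_1_r in Hs. specialize (Hmax s Hs).
      assert (1 <= exp (INR m * Re s)) by (rewrite <- exp_0; apply exp_le; nra).
      assert (0 <= M0) by apply Tpos. nra.
    - destruct (Rle_lt_dec (Re s) (5 ^ S k * x0)) as [L|L]; [apply IH; lra|].
      assert (P5 : 1 <= 5 ^ k) by (apply pow_R1_Rle; lra). simpl in L, Hs.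
      destruct (Weak (Re s / 5) s) as [s' [Hs' Hle]]; [nra|lra|].
      specialize (IH s' ltac:(simpl; nra)). eapply Rle_trans; [exact Hle|].
      apply Rle_trans with (exp (INR m) * (M0 * exp (INR m * (Re s / 5)))).
      + apply Rmult_le_compat; [lra|apply Tpos| |].
        * pose proof (exp_ineq1_le (INR m)). lra.
        * eapply Rle_trans; [exact IH|]. apply Rmult_le_compat_l; [apply Tpos|]. apply exp_le. nra.
      + replace (exp (INR m) * (M0 * exp (INR m * (Re s / 5)))) with (M0 * (exp (INR m) * exp (INR m * (Re s / 5)))) by ring.
        rewrite <- exp_plus. apply Rmult_le_compat_l; [apply Tpos|]. apply exp_le. nra. }
  assert (All : forall s, a <= Re s -> tilted n s <= M0 * exp (INR m * Re s)).
  { intros s Hs. destruct (INR_unbounded (Re s)) as [k Hk]. apply (Claim k). split; [exact Hs|].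
    assert (INR k <= 5 ^ k).
    { clear. induction k as [|k IH]; [simpl; lra|]. rewrite S_INR. simpl.
      assert (1 <= 5 ^ k) by (apply pow_R1_Rle; lra). lra. }
    simpl. nra. }
  (* Undoing the tilt and the factor [Cexp (- s)] of [logfield] adds [n] and [1] to the exponent. *)
  apply (Hf M0 (exp a) (m + (n + 1))%nat). intros z Hz.
  destruct (polar_exists z) as [s <-].
  { apply Cmod_gt_0. pose proof (exp_pos a). lra. }
  rewrite Cmod_Cexp in *. apply exp_le_inv' in Hz. specialize (All s Hz).
  unfold tilted, logfield in All. rewrite Cmod_mult, Cmod_Cexp in All. simpl in All.
  rewrite <- exp_mult_INR, !plus_INR. simpl INR.
  replace ((INR m + (INR n + 1)) * Re s) with (INR m * Re s + (INR n * Re s + Re s)) by ring.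
  rewrite exp_plus, <- Rmult_assoc.
  apply Rmult_le_compat_r with (r := exp (INR n * Re s + Re s)) in All; [|left; apply exp_pos].
  eapply Rle_trans; [|exact All]. right.
  rewrite !Rmult_assoc, <- !exp_plus.
  change (fst s) with (Re s).
  replace (- Re s + (- (INR n * Re s) + (INR n * Re s + Re s))) with 0 by ring. rewrite exp_0. ring.
Qed.

(* [s0] maximises [|logfield s| exp (- n Re s) (b - Re s) ^ B]; the weight [- B log (b - x)] has derivative
   [B / (b - x)] and second derivative only [1 / B] times the square of the first. *)
Lemma exponential_domination (n0 : nat) (K delta : R) :
  (forall (A R0 : R) (m : nat), ~ forall z, R0 <= Cmod z -> Cmod (f z) <= A * Cmod z ^ m) ->
  1 <= K -> 0 < delta <= 1 -> (1 <= n0)%nat ->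
  exists (s0 : C) (N : R), INR n0 <= N /\ logfield s0 <> 0%C /\ a + K / N <= Re s0 /\
    forall s, Rabs (Re s - Re s0) <= K / N ->
      Cmod (logfield s) <= (1 + delta) * (Cmod (logfield s0) * exp (N * (Re s - Re s0))).
Proof.
  intros Hf HK Hdel Hn0.
  (* In the window, [y = (Re s - Re s0) / (b - Re s0)] will have size at most [K / B <= / 20], and
     the second order error [2 * B * y ^ 2] will be at most [delta / 2]. *)
  destruct (INR_unbounded (20 * K + 4 * K ^ 2 / delta)) as [B HB].
  assert (HB1 : 20 * K <= INR B).
  { assert (0 <= 4 * K ^ 2 / delta) by (apply Rmult_le_pos; [nra|left; apply Rinv_0_lt_compat; lra]). lra. }
  assert (HB2 : 4 * K ^ 2 <= delta * INR B).
  { assert (4 * K ^ 2 / delta <= INR B) by lra.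
    apply Rmult_le_compat_l with (r := delta) in H; [|lra].
    replace (delta * (4 * K ^ 2 / delta)) with (4 * K ^ 2) in H by (field; lra). exact H. }
  assert (P2 : 0 < 2 ^ B) by (apply pow_lt; lra).
  destruct (growth_jump n0 (2 ^ B) (2 * a) Hf P2 ltac:(lra)) as [x [s1 [Hx [Hs1 Hjump]]]].
  (* As [Re s1 <= 5 * x = b / 2], the weight at [s1] is at least [(b / 2) ^ B], whereas it never
     exceeds [b ^ B]; the jump by [2 ^ B] therefore forces the maximum to lie at [Re s0 > x]. *)
  set (b := 10 * x).
  set (psi := fun s => tilted n0 s * (b - Re s) ^ B).
  assert (HPI : 0 < 2 * PI) by (pose proof PI_RGT_0; lra).
  assert (Tpos : forall s, 0 <= tilted n0 s).
  { intros s. unfold tilted. apply Rmult_le_pos; [apply Cmod_ge_0|left; apply exp_pos]. }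
  destruct (periodic_strip_max psi (2 * PI) a b HPI ltac:(unfold b; lra)) as [s0 [K0 Hmax]].
  { intros z _. unfold psi. rewrite tilted_period, Re_plus.
    replace (Re (RtoC (2 * PI) * Ci)%C) with 0 by (simpl; ring). rewrite Rplus_0_r. reflexivity. }
  { intros z Hz eps Heps.
    set (T := tilted n0 z + 1). assert (HT : 0 < T) by (unfold T; specialize (Tpos z); lra).
    assert (Cp : continuity_pt (fun y => (b - y) ^ B) (Re z)).
    { apply derivable_continuous_pt. apply (derivable_pt_comp (fun y => b - y) (fun y => y ^ B)).
      - apply derivable_pt_minus; [apply derivable_pt_const|apply derivable_pt_id].
      - apply derivable_pt_pow. }
    destruct (Cp (eps / 2 / T)) as [d1 [Hd1 C1]]; [apply Rdiv_lt_0_compat; lra|].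
    set (Q := (b - a) ^ B + 1).
    assert (HQ : 0 < Q).
    { assert (0 <= (b - a) ^ B) by (apply pow_le; unfold b; lra). unfold Q. lra. }
    destruct (tilted_cont n0 z (proj1 Hz) (Rmin 1 (eps / 2 / Q))) as [d2 [Hd2 C2]].
    { apply Rmin_glb_lt; [lra|apply Rdiv_lt_0_compat; lra]. }
    exists (Rmin d1 d2). split; [apply Rmin_glb_lt; assumption|]. intros w Hw Hwz.
    specialize (C2 w (Rlt_le_trans _ _ _ Hwz (Rmin_r _ _))).
    assert (W1 := Rlt_le_trans _ _ _ Hwz (Rmin_l _ _)).
    assert (C1' : (b - Re w) ^ B <= (b - Re z) ^ B + eps / 2 / T).
    { destruct (Req_dec (Re w) (Re z)) as [E|E].
      - rewrite E. assert (0 < eps / 2 / T) by (apply Rdiv_lt_0_compat; lra). lra.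
      - specialize (C1 (Re w)). simpl in C1. unfold Rdist in C1.
        assert (X : Rabs ((b - Re w) ^ B - (b - Re z) ^ B) < eps / 2 / T).
        { apply C1. split; [split; [exact I|congruence]|].
          eapply Rle_lt_trans; [|exact W1]. apply (re_le_Cmod (w - z)%C). }
        apply Rabs_def2 in X. lra. }
    assert (C2a := Rlt_le_trans _ _ _ C2 (Rmin_l _ _)). assert (C2b := Rlt_le_trans _ _ _ C2 (Rmin_r _ _)).
    apply Rabs_def2 in C2a. apply Rabs_def2 in C2b.
    assert (Pw : 0 <= (b - Re w) ^ B) by (apply pow_le; lra).
    assert (Qz : (b - Re z) ^ B <= (b - a) ^ B) by (apply pow_incr; lra).
    assert (Pz : 0 <= (b - Re z) ^ B) by (apply pow_le; lra).
    unfold psi. specialize (Tpos w).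
    apply Rle_lt_trans with (tilted n0 w * ((b - Re z) ^ B + eps / 2 / T)); [apply Rmult_le_compat_l; assumption|].
    assert (E1 : tilted n0 w * (eps / 2 / T) <= eps / 2).
    { apply Rle_trans with (T * (eps / 2 / T)); [|right; field; lra].
      apply Rmult_le_compat_r; [left; apply Rdiv_lt_0_compat; lra|unfold T; lra]. }
    assert (E2 : (tilted n0 w - tilted n0 z) * (b - Re z) ^ B < eps / 2).
    { apply Rle_lt_trans with (eps / 2 / Q * (b - Re z) ^ B); [apply Rmult_le_compat_r; lra|].
      apply Rlt_le_trans with (eps / 2 / Q * Q); [|right; field; lra].
      apply Rmult_lt_compat_l; [apply Rdiv_lt_0_compat; lra|unfold Q; lra]. }
    lra. }
  assert (T1 : 0 < tilted n0 s1).
  { specialize (Hjump ((a, 0) : C) ltac:(simpl; lra)). specialize (Tpos ((a, 0) : C)). nra. }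
  assert (V1 : tilted n0 s1 * (b / 2) ^ B <= psi s0).
  { apply Rle_trans with (psi s1); [|apply Hmax; unfold b; lra]. unfold psi.
    apply Rmult_le_compat_l; [lra|]. apply pow_incr. unfold b. lra. }
  assert (Eb : b ^ B = 2 ^ B * (b / 2) ^ B) by (rewrite <- Rpow_mult_distr; f_equal; field).
  assert (Pb : 0 < (b / 2) ^ B) by (apply pow_lt; unfold b; lra).
  assert (Hs0 : x < Re s0).
  { apply Rnot_le_lt. intros L. specialize (Hjump s0 ltac:(lra)).
    assert (psi s0 <= tilted n0 s0 * (2 ^ B * (b / 2) ^ B)).
    { unfold psi. rewrite <- Eb. apply Rmult_le_compat_l; [apply Tpos|]. apply pow_incr. lra. }
    assert (2 ^ B * tilted n0 s0 * (b / 2) ^ B < tilted n0 s1 * (b / 2) ^ B) by (apply Rmult_lt_compat_r; assumption).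
    lra. }
  assert (Psi0 : 0 < psi s0) by (assert (0 < tilted n0 s1 * (b / 2) ^ B) by (apply Rmult_lt_0_compat; assumption); lra).
  assert (T0 : 0 < tilted n0 s0).
  { destruct (Rle_lt_or_eq_dec _ _ (Tpos s0)) as [L|L]; [exact L|]. unfold psi in Psi0. rewrite <- L in Psi0. lra. }
  assert (HBp : 0 < INR B) by lra.
  assert (Hb : Re s0 < b).
  { destruct (Rle_lt_or_eq_dec _ _ (proj2 K0)) as [L|L]; [exact L|]. unfold psi in Psi0.
    rewrite L, Rminus_diag, pow_i in Psi0; [lra|]. apply INR_lt. simpl. lra. }
  set (Lg := b - Re s0). assert (HL : 0 < Lg) by (unfold Lg; lra).
  (* The logarithmic derivative at [x = Re s0] of [exp (n0 * x) / (b - x) ^ B], the majorant that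
     maximality gives for [Cmod (logfield s)] up to a constant. *)
  set (N := INR n0 + INR B / Lg).
  assert (Hn0' : 1 <= INR n0) by (apply (le_INR 1), Hn0).
  assert (HBL : 0 < INR B / Lg) by (apply Rdiv_lt_0_compat; lra).
  assert (HKN : K / N <= K * Lg / INR B).
  { replace (K * Lg / INR B) with (K / (INR B / Lg)) by (field; lra).
    apply Rmult_le_compat_l; [lra|]. apply Rinv_le_contravar; [lra|unfold N; lra]. }
  assert (HKN2 : K * Lg / INR B <= Lg / 20).
  { apply Rmult_le_reg_r with (20 * INR B); [lra|].
    replace (K * Lg / INR B * (20 * INR B)) with (20 * K * Lg) by (field; lra).
    replace (Lg / 20 * (20 * INR B)) with (INR B * Lg) by field. apply Rmult_le_compat_r; lra. }
  exists s0, N. split; [unfold N; lra|]. split; [|split].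
  - intros E. unfold tilted in T0. rewrite E, Cmod_0 in T0. lra.
  (* [K / N <= Lg / 20 <= x / 2] and [a <= x / 2], while [Re s0 > x]. *)
  - assert (Lg <= b) by (unfold Lg; lra). unfold b in *. lra.
  - intros s Hs. apply abs_le_between in Hs. set (h := Re s - Re s0) in *.
    assert (Hin : a <= Re s <= b).
    { assert (Lg <= b) by (unfold Lg; lra). unfold h in Hs. unfold Lg, b in *. lra. }
    specialize (Hmax s Hin). unfold psi in Hmax.
    replace (b - Re s) with (Lg - h) in Hmax by (unfold Lg, h; ring). fold Lg in Hmax.
    set (y := h / Lg).
    assert (Eh : h = y * Lg) by (unfold y; field; lra).
    assert (Hy : Rabs y <= K / INR B).
    { unfold y. unfold Rdiv at 1. rewrite Rabs_mult, (Rabs_pos_eq (/ Lg)) by (left; apply Rinv_0_lt_compat; lra).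
      apply Rmult_le_reg_r with Lg; [lra|]. rewrite Rmult_assoc, Rinv_l by lra.
      replace (K / INR B * Lg) with (K * Lg / INR B) by (field; lra). rewrite Rmult_1_r. apply Rabs_le. lra. }
    assert (Hy2 : K / INR B <= / 20).
    { apply Rmult_le_reg_r with (INR B); [lra|]. replace (K / INR B * INR B) with K by (field; lra). lra. }
    assert (Hy3 := abs_le_between _ _ Hy).
    (* An inequality form of [- ln (1 - y) = y + O(y ^ 2)]: the linear term combines with [n0] to
       [N * h], the quadratic one is absorbed by [delta]. *)
    assert (E1 : 1 <= (1 - y) * exp (y + 2 * y ^ 2)).
    { assert (Hz : / (1 - y) <= exp (y + 2 * y ^ 2)).
      { apply Rle_trans with (exp (y / (1 - y))).
        - pose proof (exp_ineq1_le (y / (1 - y))). replace (/ (1 - y)) with (1 + y / (1 - y)) by (field; lra). exact H.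
        - apply exp_le. replace (y / (1 - y)) with (y + y ^ 2 * / (1 - y)) by (field; lra).
          assert (/ (1 - y) <= 2).
          { replace 2 with (/ (/ 2)) by field. apply Rinv_le_contravar; lra. }
          pose proof (pow2_ge_0 y). nra. }
      apply Rmult_le_compat_l with (r := 1 - y) in Hz; [|lra]. rewrite Rinv_r in Hz by lra. exact Hz. }
    assert (E2 : Lg ^ B <= (Lg - h) ^ B * exp (INR B * (y + 2 * y ^ 2))).
    { rewrite exp_mult_INR, <- Rpow_mult_distr. apply pow_incr. split; [lra|].
      replace (Lg - h) with (Lg * (1 - y)) by (rewrite Eh; ring). rewrite Rmult_assoc.
      rewrite <- (Rmult_1_r Lg) at 1. apply Rmult_le_compat_l; lra. }
    assert (PLh : 0 < (Lg - h) ^ B) by (apply pow_lt; lra).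
    assert (Tle : tilted n0 s <= tilted n0 s0 * exp (INR B * (y + 2 * y ^ 2))).
    { apply Rmult_le_reg_r with ((Lg - h) ^ B); [exact PLh|].
      eapply Rle_trans; [exact Hmax|]. rewrite Rmult_assoc. apply Rmult_le_compat_l; [lra|]. lra. }
    assert (Ey : INR B * (2 * y ^ 2) <= delta / 2).
    { assert (y ^ 2 <= (K / INR B) ^ 2).
      { rewrite <- (Rabs_pos_eq (y ^ 2)) by apply pow2_ge_0. rewrite <- RPow_abs. apply pow_incr.
        split; [apply Rabs_pos|exact Hy]. }
      apply Rle_trans with (INR B * (2 * (K / INR B) ^ 2)); [apply Rmult_le_compat_l; lra|].
      replace (INR B * (2 * (K / INR B) ^ 2)) with (2 * K ^ 2 / INR B) by (field; lra).
      apply Rmult_le_reg_r with (INR B); [lra|]. replace (2 * K ^ 2 / INR B * INR B) with (2 * K ^ 2) by (field; lra). lra. }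
    assert (Edel : exp (delta / 2) <= 1 + delta).
    { pose proof (exp_ineq1_le (- (delta / 2))) as Q. rewrite exp_Ropp in Q.
      pose proof (exp_pos (delta / 2)) as Pe.
      apply Rmult_le_compat_r with (r := exp (delta / 2)) in Q; [|lra]. rewrite Rinv_l in Q by lra. nra. }
    unfold tilted in Tle.
    apply Rmult_le_compat_r with (r := exp (INR n0 * Re s)) in Tle; [|left; apply exp_pos].
    rewrite Rmult_assoc, <- exp_plus, Rplus_opp_l, exp_0, Rmult_1_r in Tle.
    eapply Rle_trans; [exact Tle|].
    rewrite !Rmult_assoc, <- !exp_plus.
    rewrite <- (Rmult_assoc (1 + delta)), (Rmult_comm (1 + delta)), Rmult_assoc.
    apply Rmult_le_compat_l; [apply Cmod_ge_0|].
    apply Rle_trans with (exp (delta / 2 + N * h)).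
    + apply exp_le.
      assert (EN : N * h = INR n0 * Re s - INR n0 * Re s0 + INR B * y).
      { unfold N, y. unfold h. field. lra. }
      rewrite EN. lra.
    + rewrite exp_plus. apply Rmult_le_compat_r; [left; apply exp_pos|exact Edel].
Qed.
End Selection.

(** * Infinitely many disjoint trajectories *)

(* [(alpha, b, z)] stands for the path [z] on the interval (alpha, b), with finite right end. *)
Definition path_data : Type := (Rbar * R * (R -> C))%type.

Definition escaping (f : C -> C) (D : path_data) : Prop :=
  maximal f (snd D 0) (fst (fst D)) (snd (fst D)) (snd D) /\
  forall M, exists t1, t1 < snd (fst D) /\ forall t, t1 < t < snd (fst D) -> M < Cmod (snd D t).

Definition meets (D1 D2 : path_data) : Prop :=
  exists t u, in_interval (fst (fst D1)) (snd (fst D1)) t /\ in_interval (fst (fst D2)) (snd (fst D2)) u /\ snd D1 t = snd D2 u.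

Lemma not_blow_up (s : R -> C) (t : R) (l : C) (w : R -> C) (t0 : R) : rder s t l -> t0 < t ->
  (forall u, t0 < u < t -> w u = s u) ->
  (forall M, exists t1, t1 < t /\ forall u, t1 < u < t -> M < Cmod (w u)) -> False.
Proof.
  intros H L E B. destruct (rder_cont s t l H 1 Rlt_0_1) as [d [Hd Hc]].
  destruct (B (Cmod (s t) + 1)) as [t1 [Ht1 Hb]].
  set (m := Rmax t0 (Rmax t1 (t - d))). assert (Hm : m < t) by (repeat apply Rmax_lub_lt; lra).
  assert (M1 : t0 <= m) by apply Rmax_l.
  assert (M2 : t1 <= m) by (eapply Rle_trans; [apply Rmax_l|apply Rmax_r]).
  assert (M3 : t - d <= m) by (eapply Rle_trans; [apply Rmax_r|apply Rmax_r]).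
  set (u := (m + t) / 2). assert (Hu : m < u < t) by (unfold u; lra).
  specialize (Hb u ltac:(lra)). specialize (Hc u ltac:(apply Rabs_def1; lra)).
  rewrite E in Hb by lra. pose proof (Cmod_sub_le (s u) (s t)). lra.
Qed.

(** The maximal solution through [w 0] cannot pass [b]: it would be bounded near [b], while [w] is
    not. *)
Lemma escaping_of_solution (f : C -> C) (e b : R) (w : R -> C) : 0 < e -> 0 < b -> sol f (- e) b w ->
  (forall M, exists t1, t1 < b /\ forall t, t1 < t < b -> M < Cmod (w t)) ->
  exists alpha Z, escaping f (alpha, b, Z) /\ forall t, - e < t < b -> Z t = w t.
Proof.
  intros He Hb Sw Hblow.
  assert (I0 : in_interval (- e) b 0) by (split; simpl; lra).
  destruct (maximal_solution f (w 0) (proj1 (Sw 0 I0))) as [alpha [beta [Z [J0 [Z0 [SZ Max]]]]]].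
  destruct (Max _ _ w I0 eq_refl Sw) as [M1 [M2 M3]].
  assert (E : beta = Finite b).
  { apply Rbar_le_antisym; [|exact M2]. apply Rbar_not_lt_le. intros L.
    assert (Ib : in_interval alpha beta b).
    { split; [|exact L]. apply Rbar_lt_trans with (Finite 0); [apply J0|simpl; lra]. }
    apply (not_blow_up Z b _ w 0 (proj2 (SZ b Ib)) Hb); [|exact Hblow].
    intros u Hu. apply M3. split; simpl; lra. }
  exists alpha, Z. assert (EZ : forall t, - e < t < b -> Z t = w t) by (intros t Ht; symmetry; apply M3; split; simpl; lra).
  split; [split|exact EZ]; simpl.
  - rewrite Z0, <- E. split; [exact J0|]. split; [exact Z0|]. split; [exact SZ|exact Max].
  - intros M. destruct (Hblow M) as [t1 [Ht1 H]]. exists (Rmax t1 0). split; [apply Rmax_lub_lt; lra|].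
    intros t Ht. pose proof (Rmax_l t1 0). pose proof (Rmax_r t1 0). rewrite EZ by lra. apply H. lra.
Qed.

(** After a shift in time the two paths coincide where both are defined. If [D2] lived longer, it
    would be finite at the moment when [D1] blows up. *)
Lemma escape_le (f : C -> C) (D1 D2 : path_data) (t u : R) : escaping f D1 -> escaping f D2 ->
  in_interval (fst (fst D1)) (snd (fst D1)) t -> in_interval (fst (fst D2)) (snd (fst D2)) u -> snd D1 t = snd D2 u ->
  snd (fst D2) - u <= snd (fst D1) - t /\
  forall x, in_interval (fst (fst D1)) (snd (fst D1)) (x + t) -> in_interval (fst (fst D2)) (snd (fst D2)) (x + u) ->
    snd D1 (x + t) = snd D2 (x + u).
Proof.
  destruct D1 as [[a1 b1] Z1], D2 as [[a2 b2] Z2]; simpl.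
  intros [[_ [_ [S1 _]]] B1] [[_ [_ [S2 _]]] B2] I1 I2 E; simpl in *.
  assert (Eq : forall x, in_interval a1 b1 (x + t) -> in_interval a2 b2 (x + u) -> Z1 (x + t) = Z2 (x + u)).
  { intros x X1 X2.
    apply (ode_unique_overlap f (Rbar_minus a1 t) (Rbar_minus b1 t) (Rbar_minus a2 u) (Rbar_minus b2 u)
      (fun x => Z1 (x + t)) (fun x => Z2 (x + u)) 0 x).
    - apply in_interval_shift. rewrite Rplus_0_l. exact I1.
    - apply in_interval_shift. rewrite Rplus_0_l. exact I2.
    - apply in_interval_shift, X1.
    - apply in_interval_shift, X2.
    - apply sol_shift, S1.
    - apply sol_shift, S2.
    - rewrite !Rplus_0_l. exact E. }
  split; [|exact Eq]. apply Rnot_lt_le. intros L.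
  destruct I1 as [I11 I12], I2 as [I21 I22]. simpl in I12, I22.
  assert (Ib : in_interval a2 b2 (b1 - t + u)).
  { split; [|simpl; lra]. apply Rbar_lt_trans with (Finite u); [exact I21|simpl; lra]. }
  assert (D := rder_shift Z2 (u - t) b1 (f (Z2 (b1 - t + u)))).
  replace (b1 + (u - t)) with (b1 - t + u) in D by ring. specialize (D (proj2 (S2 _ Ib))).
  apply (not_blow_up (fun x => Z2 (x + (u - t))) b1 _ Z1 t D I12); [|exact B1].
  intros x Hx. replace x with ((x - t) + t) at 1 by ring. replace (x + (u - t)) with ((x - t) + u) by ring.
  apply Eq.
  - replace (x - t + t) with x by ring. split; [|simpl; lra]. apply Rbar_lt_trans with (Finite t); [exact I11|simpl; lra].
  - split; [|simpl; lra]. apply Rbar_lt_trans with (Finite u); [exact I21|simpl; lra].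
Qed.

(** The remaining life depends on the point alone, by [escape_le] in both directions. *)
Lemma escape_sync (f : C -> C) (D1 D2 : path_data) (t u : R) : escaping f D1 -> escaping f D2 ->
  in_interval (fst (fst D1)) (snd (fst D1)) t -> in_interval (fst (fst D2)) (snd (fst D2)) u -> snd D1 t = snd D2 u ->
  snd (fst D1) - t = snd (fst D2) - u /\
  forall x, in_interval (fst (fst D1)) (snd (fst D1)) (x + t) -> in_interval (fst (fst D2)) (snd (fst D2)) (x + u) ->
    snd D1 (x + t) = snd D2 (x + u).
Proof.
  intros E1 E2 I1 I2 E.
  destruct (escape_le f D1 D2 t u E1 E2 I1 I2 E) as [H1 H2].
  destruct (escape_le f D2 D1 u t E2 E1 I2 I1 (eq_sym E)) as [H3 _].
  split; [lra|exact H2].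
Qed.

Lemma meets_sym (D1 D2 : path_data) : meets D1 D2 -> meets D2 D1.
Proof. intros [t [u [H1 [H2 E]]]]. exists u, t. split; [exact H2|]. split; [exact H1|symmetry; exact E]. Qed.

(** Both [D1] and [D2] run along [D] from their meeting points to its end, so they share the point
    of [D] at a late time [T]. *)
Lemma meets_trans (f : C -> C) (D1 D2 D : path_data) : escaping f D1 -> escaping f D2 -> escaping f D ->
  meets D1 D -> meets D2 D -> meets D1 D2.
Proof.
  intros E1 E2 E3 [t [t' [I1 [I1' Et]]]] [u [u' [I2 [I2' Eu]]]].
  destruct (escape_sync f D1 D t t' E1 E3 I1 I1' Et) as [B1 Q1].
  destruct (escape_sync f D2 D u u' E2 E3 I2 I2' Eu) as [B2 Q2].
  set (b := snd (fst D)) in *.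
  pose proof (proj2 I1') as L1. pose proof (proj2 I2') as L2. simpl in L1, L2.
  set (T := (Rmax t' u' + b) / 2).
  assert (HT : t' < T /\ u' < T /\ T < b).
  { assert (Rmax t' u' < b) by (apply Rmax_lub_lt; assumption). pose proof (Rmax_l t' u'). pose proof (Rmax_r t' u').
    unfold T. lra. }
  exists (T - t' + t), (T - u' + u).
  assert (In : forall (a : Rbar) (b0 s s' x : R), in_interval a b0 s -> s <= x -> x < b0 -> in_interval a b0 x).
  { intros a b0 s s' x [J1 J2] Hx1 Hx2. split; [apply Rbar_lt_le_trans with (1 := J1); exact Hx1|exact Hx2]. }
  assert (X1 : in_interval (fst (fst D1)) (snd (fst D1)) (T - t' + t)) by (apply (In _ _ t t); [exact I1|lra|lra]).
  assert (X2 : in_interval (fst (fst D2)) (snd (fst D2)) (T - u' + u)) by (apply (In _ _ u u); [exact I2|lra|lra]).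
  assert (X3 : in_interval (fst (fst D)) b (T - t' + t')) by (apply (In _ _ t' t'); [exact I1'|lra|lra]).
  assert (X4 : in_interval (fst (fst D)) b (T - u' + u')) by (apply (In _ _ u' u'); [exact I2'|lra|lra]).
  split; [exact X1|]. split; [exact X2|].
  rewrite (Q1 _ X1 X3), (Q2 _ X2 X4). f_equal. ring.
Qed.

(** * From arbitrarily large finite families to an infinite one *)

Section InfiniteFamily.
Variables (T : Type) (good : T -> Prop) (R0 : T -> T -> Prop).
Hypothesis R0_sym : forall x y, R0 x y -> R0 y x.
Hypothesis R0_trans : forall x y z, good x -> good y -> good z -> R0 x z -> R0 y z -> R0 x y.
Hypothesis R0_many : forall L : nat, exists E : nat -> T,
  (forall j, (j < L)%nat -> good (E j)) /\ forall j k, (j < k < L)%nat -> ~ R0 (E j) (E k).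

(** By transitivity [y] is related to at most one of several pairwise unrelated elements. A family
    with one member more than required is taken, and a member related to [y], if there is one, is
    left out. *)
Lemma many_avoiding (l : list T) : (forall y, In y l -> good y) -> forall L : nat, exists E : nat -> T,
  (forall j, (j < L)%nat -> good (E j)) /\ (forall j k, (j < k < L)%nat -> ~ R0 (E j) (E k)) /\
  forall j y, (j < L)%nat -> In y l -> ~ R0 (E j) y.
Proof.
  induction l as [|y l IH]; intros Hl L.
  - destruct (R0_many L) as [E [H1 H2]]. exists E. split; [exact H1|]. split; [exact H2|]. intros j y _ [].
  - destruct (IH (fun z Hz => Hl z (or_intror Hz)) (S L)) as [E [H1 [H2 H3]]].
    assert (Gy : good y) by (apply Hl; left; reflexivity).
    destruct (classic (exists j0, (j0 < S L)%nat /\ R0 (E j0) y)) as [[j0 [Hj0 HR]]|N].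
    + assert (Other : forall j, (j < S L)%nat -> j <> j0 -> ~ R0 (E j) y).
      { intros j Hj Nj HR'. destruct (Nat.lt_gt_cases j j0) as [Hc _]. destruct (Hc Nj) as [Lt|Gt].
        - apply (H2 j j0); [lia|]. apply (R0_trans (E j) (E j0) y); auto.
        - apply (H2 j0 j); [lia|]. apply (R0_trans (E j0) (E j) y); auto. }
      exists (fun j => if Nat.ltb j j0 then E j else E (S j)). split; [|split].
      * intros j Hj. destruct (Nat.ltb_spec j j0); apply H1; lia.
      * intros j k Hjk. destruct (Nat.ltb_spec j j0); destruct (Nat.ltb_spec k j0); apply H2; lia.
      * intros j z Hj [<-|Hz].
        -- destruct (Nat.ltb_spec j j0); apply Other; lia.
        -- destruct (Nat.ltb_spec j j0); apply H3; (exact Hz || lia).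
    + exists E. split; [intros; apply H1; lia|]. split; [intros; apply H2; lia|].
      intros j z Hj [<-|Hz]; [|apply H3; [lia|exact Hz]]. intros HR. apply N. exists j. split; [lia|exact HR].
Qed.

Lemma infinite_family : exists E : nat -> T, (forall n, good (E n)) /\ forall m n, m <> n -> ~ R0 (E m) (E n).
Proof.
  (* The premise on [l] sits inside the existential so that [choice] yields a function on all lists;
     its values on other lists are arbitrary. *)
  assert (Pick : forall l : list T, exists x, (forall y, In y l -> good y) -> good x /\ forall y, In y l -> ~ R0 x y).
  { intros l. destruct (classic (forall y, In y l -> good y)) as [G|G].
    - destruct (many_avoiding l G 1) as [E [H1 [_ H3]]]. exists (E 0%nat). intros _.
      split; [apply H1; lia|]. intros y Hy. apply H3; [lia|exact Hy].
    - destruct (R0_many 1) as [E _]. exists (E 0%nat). intros G'. contradiction. }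
  destruct (choice _ Pick) as [pick Hpick].
  set (acc := fix acc (n : nat) : list T := match n with O => nil | S n => pick (acc n) :: acc n end).
  assert (G : forall n y, In y (acc n) -> good y).
  { induction n as [|n IH]; simpl; [intros y []|]. intros y [<-|H]; [apply Hpick, IH|apply IH, H]. }
  assert (Inc : forall m n, (m < n)%nat -> In (pick (acc m)) (acc n)).
  { intros m n. induction n as [|n IH]; intros H; [lia|]. simpl.
    destruct (Nat.eq_dec m n) as [->|N]; [left; reflexivity|right; apply IH; lia]. }
  exists (fun n => pick (acc n)). split; [intros n; apply Hpick, G|].
  assert (Lt : forall m n, (m < n)%nat -> ~ R0 (pick (acc n)) (pick (acc m))).
  { intros m n H. apply Hpick; [apply G|apply Inc, H]. }
  intros m n N HR. destruct (Nat.lt_gt_cases m n) as [Hc _]. destruct (Hc N) as [H|H].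
  - apply (Lt m n H), R0_sym, HR.
  - apply (Lt n m H), HR.
Qed.
End InfiniteFamily.

(** * Disjoint escaping trajectories in neighbouring strips *)

Lemma unit_angle (u : C) : Cmod u = 1 -> exists k, 0 <= k <= 2 * PI /\ Cexp (RtoC k * Ci)%C = u.
Proof.
  intros Hu. destruct (polar_exists u) as [s Hs]; [apply Cmod_gt_0; lra|].
  assert (Hre : Re s = 0).
  { rewrite <- Hs, Cmod_Cexp in Hu. rewrite <- (ln_exp (Re s)), Hu. apply ln_1. }
  assert (E : Cexp (RtoC (Im s) * Ci)%C = u).
  { rewrite <- Hs. f_equal. transitivity ((Re s, Im s) : C); [rewrite pair_C, Hre; ring|destruct s; reflexivity]. }
  pose proof PI_RGT_0. destruct (period_reduce (2 * PI) (Im s) ltac:(lra)) as [n [k [Hk [K|K]]]]; exists k; (split; [exact Hk|]).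
  - rewrite <- E, K. replace (RtoC (k + INR n * (2 * PI)) * Ci)%C with (RtoC k * Ci + RtoC (2 * INR n * PI) * Ci)%C.
    + rewrite Cexp_plus, Cexp_2PI. ring.
    + replace (2 * INR n * PI) with (INR n * (2 * PI)) by ring. rewrite RtoC_plus. ring.
  - rewrite <- E, K. replace (RtoC (Im s + INR n * (2 * PI)) * Ci)%C with (RtoC (Im s) * Ci + RtoC (2 * INR n * PI) * Ci)%C.
    + rewrite Cexp_plus, Cexp_2PI. ring.
    + replace (2 * INR n * PI) with (INR n * (2 * PI)) by ring. rewrite RtoC_plus. ring.
Qed.

Lemma Cexp_inj_near (x y : C) : Cexp x = Cexp y -> Rabs (Im x - Im y) < 2 * PI -> Im x = Im y.
Proof.
  intros E H. assert (E1 : Cexp (x - y)%C = 1%C).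
  { rewrite Cexp_minus, E. field. apply Cexp_neq_0. }
  assert (Hre : exp (Re (x - y)%C) = 1) by (rewrite <- Cmod_Cexp, E1; apply Cmod_1).
  apply (f_equal Re) in E1. rewrite Re_Cexp, Hre, Rmult_1_l in E1. simpl in E1.
  change (cos (Im x + - Im y) = 1) in E1. apply Rabs_def2 in H.
  set (d := Im x + - Im y) in *.
  assert (Hs : sin (d / 2) = 0).
  { assert (C2 := cos_2a_sin (d / 2)). replace (2 * (d / 2)) with d in C2 by field. rewrite E1 in C2.
    apply Rsqr_0_uniq. unfold Rsqr. lra. }
  destruct (Rtotal_order d 0) as [L|[L|L]]; [exfalso| |exfalso].
  - assert (0 < sin (- (d / 2))) by (apply sin_gt_0; unfold d in *; lra). rewrite sin_neg in H0. lra.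
  - unfold d in L. lra.
  - assert (0 < sin (d / 2)) by (apply sin_gt_0; unfold d in *; lra). lra.
Qed.

(** All [L] trajectories come from one point [s0]: the coordinate of strip [j] is shifted upwards by
    [kapj j], where [logfield] again looks like [m * Cexp w]. The shifts are bounded in terms of
    [L], so the size [K] of the window can be fixed before [s0]. *)
Lemma many_escapes (f : C -> C) (L : nat) : transcendental_meromorphic f -> finitely_many_poles f ->
  exists E : nat -> path_data, (forall j, (j < L)%nat -> escaping f (E j)) /\
    forall j k, (j < k < L)%nat -> ~ meets (E j) (E k).
Proof.
  intros [Hmer Hnr] Hfin. pose proof Hfin as [l Hl].
  destruct (finite_bounded l) as [R1 [HR1 HlR]].
  set (a := 1 + R1). assert (Ha : 1 <= a) by (unfold a; lra).
  assert (f_hol : forall z, exp a <= Cmod z -> hol f z).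
  { intros z Hz. apply (meromorphic_cases f Hmer). intros Hp. specialize (HlR z (Hl z Hp)).
    pose proof (exp_ineq1_le a). unfold a in *. lra. }
  assert (Hgrow : forall (A R0 : R) (m : nat), ~ forall z, R0 <= Cmod z -> Cmod (f z) <= A * Cmod z ^ m).
  { intros A R0 m H. apply Hnr. exact (rational_of_polynomial_growth f A R0 m Hmer Hfin H). }
  pose proof PI_RGT_0 as HPI0. pose proof PI_4 as HPI4. pose proof (pos_INR L) as HL0.
  (* [Hnear] will hold for [Cmod w <= K / 4]; this has to contain the disc of radius [10] shifted by
     up to [8 * (L + 1)], where [8] bounds [2 * PI]. *)
  set (K := 4 * (10 + 8 * (INR L + 2))). assert (HK : 1 <= K) by (unfold K; lra). assert (HK40 : 40 <= K) by (unfold K; lra).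
  destruct (INR_unbounded K) as [n0 Hn0].
  assert (Hn1 : (1 <= n0)%nat) by (apply INR_le; simpl; lra).
  (* [eta / 4], because Schwarz-Pick turns the bound [M = 1 + eta / 4] into the error
     [M * M - 1 <= eta]. *)
  destruct (exponential_domination f a Ha f_hol n0 K (eta / 4) Hgrow HK ltac:(unfold eta; lra) Hn1)
    as [s0 [N [HN [Hc [Hs0 Hdom]]]]].
  set (c := logfield f s0) in *. set (m := Cmod c). assert (Hm : 0 < m) by (apply Cmod_gt_0, Hc).
  assert (HNK : K < N) by lra. assert (HN0 : 0 < N) by lra.
  (* Shifting [w] by [i * kap] multiplies [c * Cexp w] by [m / c], which makes the leading
     coefficient the positive number [m]. *)
  destruct (unit_angle (RtoC m / c)%C) as [kap [Hkap Ekap]].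
  { rewrite Cmod_div, Cmod_R, Rabs_pos_eq by (exact Hc || lra). fold m. field. lra. }
  assert (field_hol : forall w, - K <= Re w -> hol (logfield f) (s0 + w * RtoC (/ N))%C).
  { intros w Hw. apply (logfield_hol f a f_hol). rewrite Re_plus.
    replace (Re (w * RtoC (/ N))%C) with (Re w / N) by (unfold Re; simpl; unfold Rdiv; ring).
    assert (- (K / N) <= Re w / N); [|lra]. unfold Rdiv. rewrite <- Ropp_mult_distr_l_reverse.
    apply Rmult_le_compat_r; [left; apply Rinv_0_lt_compat; lra|lra]. }
  assert (field_bound : forall w, Rabs (Re w) <= K -> Cmod (logfield f (s0 + w * RtoC (/ N))%C) <= (1 + eta / 4) * (m * exp (Re w))).
  { intros w Hw. assert (ER : Re (s0 + w * RtoC (/ N))%C - Re s0 = Re w / N).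
    { rewrite Re_plus. replace (Re (w * RtoC (/ N))%C) with (Re w / N) by (unfold Re; simpl; unfold Rdiv; ring). ring. }
    pose proof (Hdom (s0 + w * RtoC (/ N))%C) as H. rewrite ER in H. fold m in H.
    replace (N * (Re w / N)) with (Re w) in H by (field; lra). apply H.
    unfold Rdiv. rewrite Rabs_mult, (Rabs_pos_eq (/ N)) by (left; apply Rinv_0_lt_compat; lra).
    apply Rmult_le_compat_r; [left; apply Rinv_0_lt_compat; lra|exact Hw]. }
  assert (Affine : forall b z, cder (fun w => s0 + (w + b) * RtoC (/ N))%C z (RtoC (/ N))).
  { intros b z. eapply cder_eq.
    - apply (cder_plus (fun _ => s0) (fun w => (w + b) * RtoC (/ N))%C); [apply cder_const|].
      apply (cder_mult (fun w => w + b)%C (fun _ => RtoC (/ N))); [|apply cder_const].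
      apply (cder_plus (fun w => w) (fun _ => b)); [apply cder_id|apply cder_const].
    - ring. }
  set (H := fun w => (logfield f (s0 + w * RtoC (/ N)) * Cexp (- w) / c)%C).
  assert (Hnear : forall w, Cmod w <= K / 2 / 2 -> Cmod (H w - 1)%C <= eta).
  { intros w Hw.
    apply Rle_trans with ((1 + eta / 4) * (1 + eta / 4) - 1); [|unfold eta; lra].
    apply (near_one_of_bound H (K / 2) K); [lra|unfold eta; lra| | | |exact Hw].
    - intros u Hu. replace (u - 0)%C with u in Hu by ring.
      pose proof (re_le_Cmod u) as Ru. assert (Ru' := abs_le_between _ _ (Rle_trans _ _ _ Ru (Rlt_le _ _ Hu))).
      destruct (hol_cder _ _ (field_hol u ltac:(lra))) as [d Hd]. eexists. unfold H.
      apply (cder_mult (fun w => logfield f (s0 + w * RtoC (/ N)) * Cexp (- w))%C (fun _ => / c)%C); [|apply cder_const].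
      apply (cder_mult (fun w => logfield f (s0 + w * RtoC (/ N)))%C (fun w => Cexp (- w))%C); [|apply cder_Cexp_neg].
      apply (cder_ext_loc (fun w => logfield f (s0 + (w + 0) * RtoC (/ N)))%C _ u _ 1); [lra| |].
      + intros x _. replace (x + 0)%C with x by ring. reflexivity.
      + apply (cder_comp (logfield f) (fun w => s0 + (w + 0) * RtoC (/ N))%C u d (RtoC (/ N))); [|apply Affine].
        replace (u + 0)%C with u by ring. exact Hd.
    - intros u Hu. replace (u - 0)%C with u in Hu by ring. unfold H.
      rewrite Cmod_div by exact Hc. rewrite Cmod_mult, Cmod_Cexp. fold m.
      pose proof (re_le_Cmod u) as Ru. pose proof (field_bound u ltac:(lra)) as B.
      apply Rmult_le_reg_r with m; [exact Hm|]. unfold Rdiv. rewrite (Rmult_assoc _ (/ m)), Rinv_l, Rmult_1_r by lra.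
      apply Rmult_le_compat_r with (r := exp (Re (- u)%C)) in B; [|left; apply exp_pos].
      eapply Rle_trans; [exact B|]. right. change (Re (- u)%C) with (- Re u).
      replace ((1 + eta / 4) * (m * exp (Re u)) * exp (- Re u)) with ((1 + eta / 4) * m * (exp (Re u) * exp (- Re u))) by ring.
      rewrite <- exp_plus, Rplus_opp_r, exp_0. unfold Rdiv. ring.
    - unfold H. replace (s0 + 0 * RtoC (/ N))%C with s0 by ring. replace (- 0)%C with (RtoC 0) by ring.
      rewrite Cexp_0. fold c. field. exact Hc. }
  (* All these shifts have the same effect on [Cexp], so each [j] gives a copy of the model equation
     in a strip of its own. *)
  set (kapj := fun j : nat => kap + 2 * INR j * PI).
  set (sig := fun (j : nat) (w : C) => (s0 + (w + RtoC (kapj j) * Ci) * RtoC (/ N))%C).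
  set (V := fun (j : nat) (w : C) => (RtoC (/ m) * logfield f (sig j w))%C).
  assert (Ekapj : forall j, Cexp (RtoC (kapj j) * Ci)%C = (RtoC m / c)%C).
  { intros j. unfold kapj. rewrite RtoC_plus, Cmult_plus_distr_r, Cexp_plus, Cexp_2PI, Ekap. ring. }
  assert (Rkap : forall j w, Re (w + RtoC (kapj j) * Ci)%C = Re w).
  { intros j w. rewrite Re_plus. replace (Re (RtoC (kapj j) * Ci)%C) with 0 by (simpl; ring). ring. }
  (* For [w = N * (s - s0) - i * kapj j] the equation [s' = logfield s] becomes
     [w' = N * m * V j w], so time is rescaled by [lam]. *)
  set (lam := N * m). assert (Hlam : 0 < lam) by (apply Rmult_lt_0_compat; assumption).
  assert (NC : RtoC N <> 0%C) by (intros X; apply (f_equal fst) in X; simpl in X; lra).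
  assert (mC : RtoC m <> 0%C) by (intros X; apply (f_equal fst) in X; simpl in X; lra).
  assert (Strip : forall j, exists D : path_data, (j < L)%nat -> escaping f D /\ exists (b : R) (s : R -> C),
     9 / 10 < b <= 3 / 2 /\ snd (fst D) = b / lam /\
     (forall t, 0 <= t < b / lam -> snd D t = Cexp (sig j (s (lam * t)))) /\
     (forall t, 0 <= t <= 9 / 10 -> Rabs (Im (s t)) < PI / 2)).
  { intros j. destruct (Nat.lt_ge_cases j L) as [Hj|Hj]; [|exists (p_infty, 0, fun _ => RtoC 0); lia].
    assert (HjL : INR j <= INR L) by (apply le_INR; lia). pose proof (pos_INR j) as Hj0.
    assert (Hkapj : 0 <= kapj j <= 8 * (INR L + 1)).
    { unfold kapj. assert (0 <= INR j * PI) by (apply Rmult_le_pos; lra).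
      assert (INR j * PI <= INR L * 4) by (apply Rmult_le_compat; lra). lra. }
    destruct (strip_escape (V j) (2 * PI * N)) as [e [b [s [He [Hb [Hsol [Hblow Him]]]]]]].
    - apply Rmult_lt_0_compat; lra.
    - intros w Hw. apply (hol_scale (fun w => logfield f (sig j w))).
      apply (hol_comp_entire (logfield f) (sig j) (fun _ => RtoC (/ N))); [intros; apply Affine|].
      apply field_hol. rewrite Rkap. lra.
    - intros w Hw. unfold V, sig. f_equal.
      rewrite <- (logfield_period f (s0 + (w + RtoC (kapj j) * Ci) * RtoC (/ N))%C).
      f_equal. rewrite (RtoC_mult (2 * PI) N), RtoC_inv by lra. field. exact NC.
    - intros w Hw. unfold V. rewrite Cmod_mult, Cmod_R, Rabs_pos_eq by (left; apply Rinv_0_lt_compat, Hm).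
      pose proof (field_bound (w + RtoC (kapj j) * Ci)%C) as B. rewrite Rkap in B.
      specialize (B ltac:(rewrite Rabs_left1; lra)). fold (sig j w) in B.
      pose proof (exp_pos (Re w)) as Pe.
      apply Rmult_le_reg_l with m; [exact Hm|]. rewrite <- Rmult_assoc, Rinv_r, Rmult_1_l by lra.
      eapply Rle_trans; [exact B|].
      replace ((1 + eta / 4) * (m * exp (Re w))) with (m * ((1 + eta / 4) * exp (Re w))) by ring.
      apply Rmult_le_compat_l; [lra|]. apply Rmult_le_compat_r; [lra|]. unfold eta. lra.
    - intros w Hw1 Hw2.
      set (w' := (w + RtoC (kapj j) * Ci)%C).
      assert (Hw' : Cmod w' <= K / 2 / 2).
      { unfold w'. eapply Rle_trans; [apply Cmod_triangle|]. rewrite Cmod_mult, Cmod_Ci, Cmod_R, Rabs_pos_eq by lra.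
        unfold K. lra. }
      pose proof (Hnear w' Hw') as B.
      assert (Ew : (V j w - Cexp w)%C = ((H w' - 1) * Cexp w)%C).
      { unfold V, H. fold w'. unfold sig. fold w'.
        assert (EE : (Cexp (- w') = / (Cexp w * (RtoC m / c)))%C).
        { rewrite Cexp_opp. unfold w'. rewrite Cexp_plus, Ekapj. reflexivity. }
        rewrite EE, RtoC_inv by lra. pose proof (Cexp_neq_0 w). field. repeat split; assumption. }
      rewrite Ew, Cmod_mult, Cmod_Cexp. apply Rmult_le_compat_r; [left; apply exp_pos|exact B].
    - set (w := fun t => Cexp (sig j (s (lam * t)))).
      assert (Scale : forall t, - (e / lam) < t < b / lam -> - e < lam * t < b).
      { intros t [T1 T2]. apply Rmult_lt_compat_l with (r := lam) in T1; [|exact Hlam].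
        apply Rmult_lt_compat_l with (r := lam) in T2; [|exact Hlam].
        replace (lam * - (e / lam)) with (- e) in T1 by (field; lra).
        replace (lam * (b / lam)) with b in T2 by (field; lra). lra. }
      assert (Rsig : forall u, Re (sig j u) = Re s0 + Re u / N).
      { intros u. unfold sig. rewrite Re_plus. f_equal.
        rewrite <- (Rkap j u). unfold Re; simpl; unfold Rdiv; ring. }
      assert (Sw : sol f (- (e / lam)) (b / lam) w).
      { intros t [T1 T2]. simpl in T1, T2. destruct (Hsol (lam * t) (Scale t (conj T1 T2))) as [H1 H2].
        split.
        - apply f_hol. unfold w. rewrite Cmod_Cexp. apply exp_le. rewrite Rsig.
          assert (- (K / N) <= Re (s (lam * t)) / N); [|lra]. unfold Rdiv. rewrite <- Ropp_mult_distr_l_reverse.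
          apply Rmult_le_compat_r; [left; apply Rinv_0_lt_compat; lra|lra].
        - apply rder_eq with (Cexp (sig j (s (lam * t)%R)) * RtoC (/ N) * (RtoC lam * V j (s (lam * t)%R)))%C.
          + apply (rder_comp (fun u => Cexp (sig j u)) (fun t => s (lam * t))).
            * apply (cder_comp Cexp (sig j)); [apply cder_Cexp|apply Affine].
            * apply rder_scale, H2.
          + unfold w, V, logfield. set (S := sig j (s (lam * t))). rewrite Cexp_opp. unfold lam.
            rewrite RtoC_mult, !RtoC_inv by lra. field. repeat split; try assumption. apply Cexp_neq_0. }
      destruct (escaping_of_solution f (e / lam) (b / lam) w) as [alpha [Z [HZ EZ]]].
      + apply Rdiv_lt_0_compat; assumption.
      + apply Rdiv_lt_0_compat; lra.
      + exact Sw.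
      (* Beyond this threshold [Re (sig j u) = Re s0 + Re u / N] exceeds [Rabs M], and then
         [exp x >= 1 + x] suffices. *)
      + intros M. destruct (Hblow (N * (Rabs M - Re s0))) as [t1 [Ht1 Hbig]].
        exists (t1 / lam). split; [apply Rmult_lt_compat_r; [apply Rinv_0_lt_compat; lra|exact Ht1]|].
        intros t [T1 T2]. apply Rmult_lt_compat_l with (r := lam) in T1; [|exact Hlam].
        apply Rmult_lt_compat_l with (r := lam) in T2; [|exact Hlam].
        replace (lam * (t1 / lam)) with t1 in T1 by (field; lra).
        replace (lam * (b / lam)) with b in T2 by (field; lra).
        specialize (Hbig _ (conj T1 T2)). unfold w. rewrite Cmod_Cexp, Rsig.
        assert (Rabs M - Re s0 < Re (s (lam * t)) / N).
        { apply Rmult_lt_reg_l with N; [exact HN0|]. replace (N * (Re (s (lam * t)) / N)) with (Re (s (lam * t))) by (field; lra). exact Hbig. }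
        pose proof (exp_ineq1_le (Re s0 + Re (s (lam * t)) / N)). pose proof (Rle_abs M). lra.
      + exists (alpha, b / lam, Z). intros _. split; [exact HZ|]. exists b, s. simpl.
        split; [exact Hb|]. split; [reflexivity|]. split.
        * intros t Ht. apply EZ. assert (0 < e / lam) by (apply Rdiv_lt_0_compat; assumption). lra.
        * intros t Ht. apply Him, Ht. }
  destruct (choice _ Strip) as [E HE].
  exists E. split; [intros j Hj; apply HE, Hj|].
  (* Equal remaining lives place the point of [E k] at time [0] on [E j] at a time [x] with
     [lam * x = bj - bk <= 3 / 2 - 9 / 10]. This is below [9 / 10], so both points still lie in
     their own strips of half width [PI / 2]. *)
  assert (Ord : forall j k, (j < L)%nat -> (k < L)%nat -> j <> k -> snd (fst (E k)) <= snd (fst (E j)) -> ~ meets (E j) (E k)).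
  { intros j k Hj Hk Njk Hb [t [u [I1 [I2 Eq]]]].
    destruct (HE j Hj) as [Ej [bj [sj [Bj [Fj [Zj Imj]]]]]]. destruct (HE k Hk) as [Ek [bk [sk [Bk [Fk [Zk Imk]]]]]].
    destruct (escape_sync f (E j) (E k) t u Ej Ek I1 I2 Eq) as [Sync Agree].
    set (x := t - u).
    assert (Ex : x = (bj - bk) / lam) by (unfold x; rewrite Fj, Fk in Sync; unfold Rdiv in *; lra).
    assert (Elx : lam * x = bj - bk) by (rewrite Ex; field; lra).
    assert (Hx0 : 0 <= x) by (unfold x; lra).
    assert (Hxj : x < bj / lam).
    { rewrite Ex. apply Rmult_lt_compat_r; [apply Rinv_0_lt_compat; lra|lra]. }
    assert (Hbk : 0 < bk / lam) by (apply Rdiv_lt_0_compat; lra).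
    assert (J0 : forall i, (i < L)%nat -> in_interval (fst (fst (E i))) (snd (fst (E i))) 0).
    { intros i Hi. destruct (HE i Hi) as [[[I0 _] _] _]. exact I0. }
    specialize (Agree (- u)). replace (- u + t) with x in Agree by (unfold x; ring). rewrite Rplus_opp_l in Agree.
    assert (P1 : snd (E j) x = snd (E k) 0).
    { apply Agree; [|apply J0, Hk]. split; [|rewrite Fj; exact Hxj].
      apply Rbar_lt_le_trans with (Finite 0); [apply (J0 j Hj)|exact Hx0]. }
    rewrite Zj, Zk, Elx, Rmult_0_r in P1 by lra.
    assert (Hbjk : 0 <= bj - bk) by (rewrite <- Elx; apply Rmult_le_pos; lra).
    pose proof (Imj (bj - bk) ltac:(lra)) as A1. pose proof (Imk 0 ltac:(lra)) as A2.
    apply Rabs_def2 in A1. apply Rabs_def2 in A2.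
    set (y1 := Im (sj (bj - bk))) in *. set (y2 := Im (sk 0)) in *.
    assert (Isig : forall i v, Im (sig i v) = Im s0 + (Im v + kapj i) / N).
    { intros i v. unfold sig. unfold Im; simpl; unfold Rdiv; ring. }
    assert (HjL : INR j <= INR L) by (apply le_INR; lia). pose proof (pos_INR j) as Hj0.
    assert (HkL : INR k <= INR L) by (apply le_INR; lia). pose proof (pos_INR k) as Hk0.
    assert (Hd : Rabs (INR j - INR k) <= INR L) by (apply Rabs_le; lra).
    assert (Hdp : - (4 * INR L) <= (INR j - INR k) * PI <= 4 * INR L).
    { apply abs_le_between. rewrite Rabs_mult, (Rabs_pos_eq PI) by lra. rewrite Rmult_comm.
      apply Rmult_le_compat; try lra. apply Rabs_pos. }
    (* In the coordinate [w] the heights differ by at most [4 + 8 * L < K < N], so after division by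
       [N] the difference is below [2 * PI], where [Cexp] determines the imaginary part. *)
    assert (Eim : Im (sig j (sj (bj - bk))) = Im (sig k (sk 0))).
    { apply Cexp_inj_near; [exact P1|]. rewrite !Isig. fold y1 y2.
      replace (Im s0 + (y1 + kapj j) / N - (Im s0 + (y2 + kapj k) / N)) with ((y1 - y2 + 2 * ((INR j - INR k) * PI)) / N)
        by (unfold kapj; field; lra).
      unfold Rdiv. rewrite Rabs_mult, (Rabs_pos_eq (/ N)) by (left; apply Rinv_0_lt_compat; lra).
      apply Rmult_lt_reg_r with N; [exact HN0|]. rewrite Rmult_assoc, Rinv_l, Rmult_1_r by lra.
      apply Rle_lt_trans with (4 + 8 * INR L); [apply Rabs_le; lra|].
      pose proof PI2_1. assert (2 * N <= 2 * PI * N) by (apply Rmult_le_compat_r; lra). unfold K in HNK. lra. }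
    rewrite !Isig in Eim. fold y1 y2 in Eim.
    assert (Ey : y1 + kapj j = y2 + kapj k).
    { apply Rmult_eq_reg_r with (/ N); [|apply Rinv_neq_0_compat; lra]. unfold Rdiv in Eim. lra. }
    unfold kapj in Ey.
    assert (Hdiff : (INR j + 1 <= INR k) \/ (INR k + 1 <= INR j)).
    { rewrite <- !S_INR. destruct (Nat.lt_gt_cases j k) as [Hc' _]. destruct (Hc' Njk) as [Lt|Gt];
      [left|right]; apply le_INR; lia. }
    (* [y1 - y2] would be a nonzero multiple of [2 * PI], yet it is smaller than [PI] in size. *)
    destruct Hdiff as [Df|Df]; apply Rmult_le_compat_r with (r := PI) in Df; lra. }
  intros j k Hjk M. destruct (Rle_lt_dec (snd (fst (E k))) (snd (fst (E j)))) as [Le|Lt].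
  - apply (Ord j k); try lia; assumption.
  - apply (Ord k j); try lia; [lra|]. apply meets_sym, M.
Qed.

(** [trajectory] compares with solutions that extend [Z]; these pass through [Z 0] at time [0], so
    [maximal] covers them. *)
Lemma escaping_trajectory (f : C -> C) (alpha : Rbar) (b : R) (Z : R -> C) : meromorphic f ->
  escaping f (alpha, b, Z) ->
  trajectory f alpha b Z /\ to_infinity_in_finite_increasing_time b Z.
Proof.
  intros Hf [[I0 [_ [S Max]]] B]. simpl in *. split; [split|].
  - split; [apply Rbar_lt_trans with (Finite 0); apply I0|]. intros t Ht. destruct (S t Ht) as [H1 H2].
    split; [apply not_pole_of_hol, H1|apply rder_is_derive, H2].
  - intros alpha' beta' w [Hab Sw] La Lb Eq.
    assert (I0' : in_interval alpha' beta' 0).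
    { split; [apply Rbar_le_lt_trans with (1 := La), I0|apply Rbar_lt_le_trans with (2 := Lb), I0]. }
    destruct (Max alpha' beta' w I0' (Eq 0 I0)) as [M1 [M2 _]].
    + intros t Ht. destruct (Sw t Ht) as [H1 H2]. split; [apply (meromorphic_cases f Hf), H1|apply rder_is_derive, H2].
    + split; apply Rbar_le_antisym; assumption.
  - exists b. split; [reflexivity|]. intros P [M HP]. destruct (B M) as [t1 [Ht1 H]].
    exists (mkposreal (b - t1) ltac:(lra)). intros t Ht Htb. apply HP, H.
    assert (Ht' : Rabs (t - b) < b - t1) by exact Ht. apply Rabs_def2 in Ht'. lra.
Qed.

Theorem theorem1p1 :
  forall f : C -> C,
    transcendental_meromorphic f ->
    finitely_many_poles f ->
    exists (alpha beta : nat -> Rbar) (z : nat -> R -> C),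
      (forall n : nat,
         trajectory f (alpha n) (beta n) (z n) /\
         to_infinity_in_finite_increasing_time (beta n) (z n)) /\
      (forall m n : nat, m <> n ->
         forall p : C,
           ~ (on_path (alpha m) (beta m) (z m) p /\
              on_path (alpha n) (beta n) (z n) p)).
Proof.
  intros f Hf Hfin.
  destruct (infinite_family path_data (escaping f) meets meets_sym (meets_trans f)
    (fun L => many_escapes f L Hf Hfin)) as [E [HE Hdisj]].
  exists (fun n => fst (fst (E n))), (fun n => Finite (snd (fst (E n)))), (fun n => snd (E n)).
  split.
  - intros n. apply escaping_trajectory; [apply Hf|].
    specialize (HE n). destruct (E n) as [[alpha b] Z]. exact HE.
  - intros m n Hmn p [[t [Ht Et]] [u [Hu Eu]]].
    apply (Hdisj m n Hmn). exists t, u. split; [exact Ht|]. split; [exact Hu|]. rewrite Et, Eu. reflexivity.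
Qed.
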